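(* Let $(M,\omega)$ be a symplectic manifold of dimension $2n$ and let $0\le p\le n$. Then the sequence $$0\to F^p\Omega^0\xrightarrow{d_+}F^p\Omega^1\xrightarrow{d_+}\cdots\xrightarrow{d_+}F^p\Omega^{n+p-1}\xrightarrow{d_+}F^p\Omega^{n+p}\xrightarrow{\partial_+\partial_-}F^p\Omega^{n+p}\xrightarrow{d_-}F^p\Omega^{n+p-1}\xrightarrow{d_-}\cdots\xrightarrow{d_-}F^p\Omega^1\xrightarrow{d_-}F^p\Omega^0\to 0$$ is a differential complex (the composition of any two consecutive maps is zero) and it is elliptic.
   Context: $\Omega^k$ denotes the smooth real $k$-forms on $M$ (zero for $k<0$ or $k>2n$), and $L(A)=\omega\wedge A$. For $0\le s\le n$, $\mathcal P^s=\{B\in\Omega^s: L^{n+1-s}B=0\}$ is the space of primitive $s$-forms; set $\mathcal P^s=0$ for other $s$. Every $A_k\in\Omega^k$ has a unique Lefschetz decomposition $A_k=\sum_{\max(0,k-n)\le r\le\lfloor k/2\rfloor}L^rB_{k-2r}$ with $B_{k-2r}\in\mathcal P^{k-2r}$. Reflection: $*_r$ is the linear operator with $*_r(L^rB_s)=L^{n-r-s}B_s$ for $B_s\in\mathcal P^s$, $0\le r\le n-s$. Projection: $\Pi^p A_k=\sum_{r\le p}L^rB_{k-2r}$ (only the terms with $r\le p$ of the Lefschetz decomposition are kept). Filtered forms: $F^p\Omega^k=\Pi^p\Omega^k$ (nonzero only for $0\le k\le n+p$); in particular $F^p\Omega^{n+p}=L^p\mathcal P^{n-p}$. Operators $\partial_\pm$: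 for $B_s\in\mathcal P^s$ write uniquely $dB_s=\partial_+B_s+\omega\wedge\partial_-B_s$ with $\partial_\pm B_s\in\mathcal P^{s\pm1}$, and set $\partial_\pm(L^rB_s)=L^r\partial_\pm B_s$. Operators $d_\pm$: $d_+=\Pi^p\circ d:F^p\Omega^k\to F^p\Omega^{k+1}$ and $d_-=*_r\,d\,*_r:F^p\Omega^k\to F^p\Omega^{k-1}$ (which preserves the filtration). Elliptic means: for every $x\in M$ and every nonzero $\xi\in T^*_xM$, the associated sequence of principal symbols (first-order symbols for $d_\pm$, second-order symbol for $\partial_+\partial_-$) is exact. *)

(* Defs.v *)
From HB Require Import structures.
From mathcomp Require Import all_boot all_order all_algebra.
From mathcomp Require Import all_classical all_reals all_analysis.
Import numFieldNormedType.Exports.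
Import Order.TTheory GRing.Theory Num.Theory.

Set Implicit Arguments.
Unset Strict Implicit.
Unset Printing Implicit Defensive.

Local Open Scope classical_set_scope.
Local Open Scope ring_scope.

(** * Exterior algebra of R^m

   [a : ext R m] stands for the sum over S = {i_1 < ... < i_k} of
   [a S] dx_{i_1} /\ ... /\ dx_{i_k}, so elements need not be homogeneous.
   Keeping all degrees in one type avoids casts between degrees such as
   k and (k - 2r) + 2r. *)

Definition ext (R : realType) (m : nat) := {ffun {set 'I_m} -> R}.

Section Exterior.
Variables (R : realType) (m : nat).
Implicit Types (a b : ext R m) (S T : {set 'I_m}).

Definition homogeneous (k : nat) : set (ext R m) :=
  [set a | forall S, #|S| != k -> a S = 0].

(* dx_S /\ dx_T = wedge_sign S T dx_(S :|: T) for disjoint S and T. *)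
Definition wedge_sign S T : R :=
  (-1) ^+ #|[set ij : 'I_m * 'I_m |
              [&& ij.1 \in S, ij.2 \in T & (ij.2 < ij.1)%N]]%SET|.

Definition wedge a b : ext R m :=
  [ffun S : {set 'I_m} => \sum_(T : {set 'I_m} | T \subset S)
     wedge_sign T (S :\: T) * a T * b (S :\: T)].

Definition ext1 : ext R m := [ffun S => (S == finset.set0)%:R].

Definition covector (xi : 'rV[R]_m) : ext R m :=
  [ffun S => \sum_i (S == [set i]%SET)%:R * xi 0 i].

Definition eval2 a (u v : 'rV[R]_m) : R :=
  \sum_(i < m) \sum_(j < m | (i < j)%N)
    a [set i; j]%SET * (u 0 i * v 0 j - u 0 j * v 0 i).

End Exterior.

(** * Calculus on open subsets of R^m

   Fields are total functions; only their values on the open set under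
   consideration are relevant. *)

Section Calculus.
Variables (R : realType) (m : nat).
Local Notation E := 'rV[R]_m.

Definition partial (i : 'I_m) (f : E -> R) (y : E) : R :=
  'D_(delta_mx 0 i : E) f y.

Definition grad (f : E -> R) (y : E) : E := \row_i partial i f y.

Fixpoint class_C (k : nat) (U : set E) (f : E -> R) : Prop :=
  match k with
  | 0 => forall y, U y -> {for y, continuous f}
  | k'.+1 => (forall y, U y -> differentiable f y) /\
             (forall i, class_C k' U (partial i f))
  end.

Definition smooth (U : set E) (f : E -> R) : Prop :=
  forall k, class_C k U f.

Definition smooth_ext (U : set E) (A : E -> ext R m) : Prop :=
  forall S, smooth U (fun y => A y S).

Definition ext_d (A : E -> ext R m) (y : E) : ext R m :=
  \sum_(i < m) wedge (covector (delta_mx 0 i))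
                     [ffun S => partial i (fun z => A z S) y].

(* Pullback to y of an element a of the exterior algebra at tau y:
   dx_{i_1} /\ ... /\ dx_{i_k} is sent to
   dtau_{i_1} /\ ... /\ dtau_{i_k}; [enum S] is increasing. *)
Definition pullback (tau : E -> E) (y : E) (a : ext R m) : ext R m :=
  \sum_(S : {set 'I_m}) a S *:
    \big[@wedge R m/ext1 R m]_(i <- enum S)
       covector (grad (fun z => tau z 0 i) y).

End Calculus.

(** * Smooth manifolds and differential forms *)

Record manifold (R : realType) (m : nat) := Manifold {
  space :> topologicalType ;
  chart : Type ;
  dom : chart -> set space ;
  coord : chart -> space -> 'rV[R]_m ;
  param : chart -> 'rV[R]_m -> space ;
  manifold_hausdorff : hausdorff_space space ;
  manifold_second_countable : @second_countable space ;
  dom_cover : forall x, exists c, dom c x ;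
  dom_open : forall c, open (dom c) ;
  img_open : forall c, open (coord c @` dom c) ;
  coordK : forall c x, dom c x -> param c (coord c x) = x ;
  coord_continuous : forall c x, dom c x -> {for x, continuous (coord c)} ;
  param_continuous : forall c y, (coord c @` dom c) y ->
    {for y, continuous (param c)} ;
  transition_smooth : forall c c' i,
    smooth (coord c @` (dom c `&` dom c'))
           (fun y => coord c' (param c y) 0 i)
}.

Section Forms.
Variables (R : realType) (m : nat) (M : manifold R m).

Definition img (c : chart M) : set 'rV[R]_m := coord c @` dom c.

Definition transition (c c' : chart M) (y : 'rV[R]_m) : 'rV[R]_m :=
  coord c' (param c y).

(* The coordinate expressions of a form in all charts of the atlas. *)
Definition form_field := chart M -> 'rV[R]_m -> ext R m.

(* [A c] is meaningful on [img c] only. *)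
Definition eq_field (A B : form_field) : Prop :=
  forall c y, img c y -> A c y = B c y.

Definition Omega (k : nat) : set form_field :=
  [set A | [/\ forall c y, img c y -> homogeneous k (A c y),
               forall c, smooth_ext (img c) (A c) &
               forall c c' y, (coord c @` (dom c `&` dom c')) y ->
                 A c y = pullback (transition c c') y
                           (A c' (transition c c' y)) ]].

Definition symplectic (w : form_field) : Prop :=
  [/\ Omega 2 w,
      eq_field (fun c => ext_d (w c)) (fun _ _ => 0) &
      forall c y, img c y ->
        forall u, (forall v, eval2 (w c y) u v = 0) -> u = 0].

End Forms.

(** * Lefschetz decomposition at a point *)

Section Lefschetz.
Variables (R : realType) (n : nat).
Local Notation Lambda := (ext R (2 * n)%N).
Implicit Types (w a b : Lambda) (r s : nat).

Definition Lef w a : Lambda := wedge w a.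

Definition primitive w s : set Lambda :=
  [set b | if (s <= n)%N
           then homogeneous s b /\ iter (n.+1 - s)%N (Lef w) b = 0
           else b = 0].

Definition primitive_pred w s : set Lambda :=
  if s is s'.+1 then primitive w s' else [set 0].

(* [B (r, s)] is the primitive s-form B_s in the term L^r B_s; the constraint
   r + s <= n says k - n <= r for the degree k = s + 2r. The degree-k
   part of [a] gives the terms with s + 2r = k, and all degrees are decomposed
   at once. *)
Definition lefschetz_decomposition w a
    (B : {ffun 'I_n.+1 * 'I_n.+1 -> Lambda}) : Prop :=
  [/\ forall r s : 'I_n.+1, primitive w s (B (r, s)),
      forall r s : 'I_n.+1, (n < r + s)%N -> B (r, s) = 0 &
      a = \sum_(r < n.+1) \sum_(s < n.+1 | (r + s <= n)%N)
            iter r (Lef w) (B (r, s))].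

Definition lefschetz w a : {ffun 'I_n.+1 * 'I_n.+1 -> Lambda} :=
  xget 0 [set B | lefschetz_decomposition w a B].

Definition reflection w a : Lambda :=
  \sum_(r < n.+1) \sum_(s < n.+1 | (r + s <= n)%N)
    iter (n - r - s)%N (Lef w) (lefschetz w a (r, s)).

Definition projection w (p : nat) a : Lambda :=
  \sum_(r < n.+1 | (r <= p)%N) \sum_(s < n.+1 | (r + s <= n)%N)
    iter r (Lef w) (lefschetz w a (r, s)).

(* c = b.1 + w /\ b.2, used for c = dB_s with B_s a primitive s-form. *)
Definition primitive_split w s (c : Lambda) : Lambda * Lambda :=
  xget 0 [set b | [/\ primitive w s.+1 b.1, primitive_pred w s b.2 &
                      c = b.1 + Lef w b.2]].

(* The fibre of the bundle of filtered k-forms. *)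
Definition filtered w (p k : nat) : set Lambda :=
  projection w p @` @homogeneous R (2 * n)%N k.

End Lefschetz.

(** * The operators in a chart *)

Section LocalOperators.
Variables (R : realType) (n : nat).
Local Notation E := 'rV[R]_(2 * n).
Local Notation Lambda := (ext R (2 * n)%N).
Variable w : E -> Lambda.

Definition d_plus (p : nat) (A : E -> Lambda) (y : E) : Lambda :=
  projection (w y) p (ext_d A y).

Definition d_minus (A : E -> Lambda) (y : E) : Lambda :=
  reflection (w y) (ext_d (fun z => reflection (w z) (A z)) y).

Definition split_d (r s : 'I_n.+1) (A : E -> Lambda) (y : E) :
    Lambda * Lambda :=
  primitive_split (w y) s (ext_d (fun z => lefschetz (w z) (A z) (r, s)) y).

Definition del_plus (A : E -> Lambda) (y : E) : Lambda :=
  \sum_(r < n.+1) \sum_(s < n.+1 | (r + s <= n)%N)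
    iter r (Lef (w y)) (split_d r s A y).1.

Definition del_minus (A : E -> Lambda) (y : E) : Lambda :=
  \sum_(r < n.+1) \sum_(s < n.+1 | (r + s <= n)%N)
    iter r (Lef (w y)) (split_d r s A y).2.

(* The sequence has spaces in positions 0, ..., 2(n+p)+1: filtered forms of
   degree 0, ..., n+p, n+p, ..., 0. The j-th map goes from position j to
   position j.+1. *)
Definition cplx_last (p : nat) : nat := (2 * (n + p)).+1.

Definition cplx_degree (p j : nat) : nat :=
  if (j <= n + p)%N then j else (cplx_last p - j)%N.

Definition cplx_map (p j : nat) : (E -> Lambda) -> (E -> Lambda) :=
  if (j < n + p)%N then d_plus p
  else if (j == n + p)%N then del_plus \o del_minus
  else d_minus.

Definition cplx_order (p j : nat) : nat := if (j == n + p)%N then 2 else 1.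

End LocalOperators.

(** * Principal symbols

   The symbol at (y, xi) of a linear differential operator P of order q between
   sections of vector bundles sends A y to P (f^q A) y / q!, for every
   section A of the source bundle [V] and every smooth f with f y = 0 and
   df_y = xi. As P is local, sections over the coordinate domain [U] are used;
   each vector of the fibre at y is a value of one of them, so that sigma is
   determined on that fibre. *)

Definition principal_symbol (R : realType) (m : nat) (q : nat)
    (P : ('rV[R]_m -> ext R m) -> 'rV[R]_m -> ext R m)
    (U : set 'rV[R]_m) (V : 'rV[R]_m -> set (ext R m))
    (y xi : 'rV[R]_m) (sigma : ext R m -> ext R m) : Prop :=
  forall (f : 'rV[R]_m -> R) (A : 'rV[R]_m -> ext R m),
    smooth U f -> f y = 0 -> grad f y = xi ->
    smooth_ext U A -> (forall z, U z -> V z (A z)) ->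
    sigma (A y) = (q`!%:R)^-1 *: P (fun z => f z ^+ q *: A z) y.

(** * The complex of filtered forms *)

Section Complex.
Variables (R : realType) (n : nat) (M : manifold R (2 * n)).
Variable w : form_field M.
Variable p : nat.

Definition F_Omega (k : nat) : set (form_field M) :=
  [set A | exists2 A', Omega k A' &
     eq_field A (fun c y => projection (w c y) p (A' c y))].

Definition cplx_operator (j : nat) (A : form_field M) : form_field M :=
  fun c => cplx_map (w c) p j (A c).

Definition differential_complex : Prop :=
  (forall j A, (j < cplx_last n p)%N -> F_Omega (cplx_degree n p j) A ->
     F_Omega (cplx_degree n p j.+1) (cplx_operator j A)) /\
  (forall j A, (j.+1 < cplx_last n p)%N -> F_Omega (cplx_degree n p j) A ->
     eq_field (cplx_operator j.+1 (cplx_operator j A)) (fun _ _ => 0)).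

Definition fibre (c : chart M) (y : 'rV[R]_(2 * n)) (j : nat) :
    set (ext R (2 * n)%N) :=
  filtered (w c y) p (cplx_degree n p j).

(* Exactness of 0 -> V_0 -> V_1 -> ... -> V_last -> 0, including both ends. *)
Definition exact_sequence (V : nat -> set (ext R (2 * n)%N))
    (sigma : nat -> ext R (2 * n)%N -> ext R (2 * n)%N) (last : nat) : Prop :=
  [/\ forall a, V 0%N a -> sigma 0%N a = 0 -> a = 0,
      forall j, (j.+1 < last)%N ->
        sigma j @` V j = [set b | V j.+1 b /\ sigma j.+1 b = 0] &
      sigma last.-1 @` V last.-1 = V last].

Definition elliptic : Prop :=
  forall (c : chart M) (x : M) (xi : 'rV[R]_(2 * n)), dom c x -> xi != 0 ->
  exists sigma : nat -> ext R (2 * n)%N -> ext R (2 * n)%N,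
    (forall j, (j < cplx_last n p)%N ->
       principal_symbol (cplx_order n p j) (cplx_map (w c) p j)
         (img c) (fun z => fibre c z j) (coord c x) xi (sigma j)) /\
    exact_sequence (fibre c (coord c x)) sigma (cplx_last n p).

End Complex.

(* Main.v *)
(* All the analysis is reduced to the hard Lefschetz theorem. With Lam the
   contraction with the inverse of the symplectic form, [Lam, L] = n - k on
   k-forms, hence L^m is injective on degrees k <= n - m and surjective onto
   degrees k >= n + m, both at a point and for smooth forms.

   A k-form decomposes as a = Pi^p a + L^(p+1) c, and Pi^p L^(p+1) = 0. Let D be
   d or, for the symbols, xi /\ _; it commutes with L and D^2 = 0. On the first
   half of the sequence the operator is Pi^p D. On F^p of degree n + p one has
   D a = L^(p+1) c for a unique c, and the middle operator (del_plus del_minus, or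
   its symbol) is a |-> L^p D c. On the second half the reflection identifies
   F^p with ker L^(p+1), on which the operator is D itself. Thus the sequence
   behaves like the mapping cone of L^(p+1), and it is a complex because
   D^2 = 0; for xi <> 0 the operator xi /\ _ is acyclic, and the diagram chase
   gives exactness of the symbol sequence.

   Invariance under changes of charts follows from the uniqueness of the
   Lefschetz decomposition and from d commuting with pullbacks. *)

Require Import Defs.
From HB Require Import structures.
From mathcomp Require Import all_boot all_order all_algebra.
From mathcomp Require Import zify ring.
From mathcomp Require Import all_classical all_reals all_analysis.
Import numFieldNormedType.Exports.
Import Order.TTheory GRing.Theory Num.Theory.

Set Implicit Arguments.
Unset Strict Implicit.
Unset Printing Implicit Defensive.

Local Open Scope ring_scope.

(** * Linear algebra of sl(2)-modules *)

(** The obstacle is that [lefschetz] and [primitive_split] are chosen point by point, so nothing in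
    them makes the components of a smooth form smooth, and d could not be applied to these
    components. The sl(2) argument is therefore stated for an arbitrary module with two linear maps
    subject to [Lam, L] = n - k. It is used once for the exterior algebra at a point and once for
    smooth fields, where Lam exists because the inverse matrix of the symplectic form has smooth
    entries. Uniqueness then identifies the values of a smooth decomposition with the pointwise one.
    Degrees are integers, so that k - 2r and 2n - k are never truncated.

    In the same way [lefschetz_complex] records what d on fields and xi /\ _ at a point share.
    Acyclicity of D is kept apart from it: d does not have it, as constant functions are closed in
    degree 0, and only exactness of the symbols calls for it.

    The exponent p + 1 comes from the reflection: L^r B_s with B_s nonzero and r + s <= n goes to
    L^(n-r-s) B_s, which L^(p+1) kills exactly when r <= p. *)

Section IterLinear.
Variables (R : nzRingType) (X : lmodType R) (L : {linear X -> X}).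

Lemma iter_linear m (c : R) a b :
  iter m L (c *: a + b) = c *: iter m L a + iter m L b.
Proof. by elim: m => //= m ->; rewrite linearP. Qed.

Lemma iter_linear0 m : iter m L 0 = 0.
Proof. by elim: m => //= m ->; rewrite linear0. Qed.

Lemma iter_linearD m a b : iter m L (a + b) = iter m L a + iter m L b.
Proof. by rewrite -[a]scale1r iter_linear !scale1r. Qed.

Lemma iter_linearZ m c a : iter m L (c *: a) = c *: iter m L a.
Proof. by rewrite -[c *: a]addr0 iter_linear iter_linear0 addr0. Qed.

Lemma iter_linearN m a : iter m L (- a) = - iter m L a.
Proof. by rewrite -scaleN1r iter_linearZ scaleN1r. Qed.

Lemma iter_linearB m a b : iter m L (a - b) = iter m L a - iter m L b.
Proof. by rewrite iter_linearD iter_linearN. Qed.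

Lemma iter_linear_sum m (I : Type) (r : seq I) (P : pred I) (F : I -> X) :
  iter m L (\sum_(i <- r | P i) F i) = \sum_(i <- r | P i) iter m L (F i).
Proof. exact: (big_morph _ (@iter_linearD m) (iter_linear0 m)). Qed.

Lemma iter_linear_le m1 m2 a : (m1 <= m2)%N -> iter m1 L a = 0 -> iter m2 L a = 0.
Proof. by move=> /subnK <- h; rewrite iterD h iter_linear0. Qed.

End IterLinear.

(** * Hard Lefschetz and primitive decompositions from the relation [Lam, L] = n - k *)

Section Sl2.
Variables (R : numFieldType) (X : lmodType R) (n : nat).
Variables (hom : int -> X -> Prop) (L Lam : {linear X -> X}).
Hypothesis hom0 : forall k, hom k 0.
Hypothesis hom_lin : forall (k : int) (c : R) a b, hom k a -> hom k b -> hom k (c *: a + b).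
Hypothesis hom_L : forall (k : int) (a : X), hom k a -> hom (k + 2) (L a).
Hypothesis hom_Lam : forall (k : int) (a : X), hom k a -> hom (k - 2) (Lam a).
Hypothesis hom_out : forall (k : int) (a : X), (k < 0) || (n%:Z *+ 2 < k) -> hom k a -> a = 0.
Hypothesis comm_Lam_L : forall (k : int) (a : X), hom k a ->
  Lam (L a) = L (Lam a) + (n%:Z - k)%:~R *: a.

Lemma homB (k : int) a b : hom k a -> hom k b -> hom k (a - b).
Proof.
by move=> ha hb; rewrite addrC -scaleN1r; apply: hom_lin.
Qed.

Lemma homD (k : int) a b : hom k a -> hom k b -> hom k (a + b).
Proof. by move=> ha hb; rewrite -[a]scale1r; apply: hom_lin. Qed.

Lemma homZ (k : int) c a : hom k a -> hom k (c *: a).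
Proof. by move=> ha; rewrite -[_ *: _]addr0; apply: hom_lin. Qed.

Lemma hom_iter_L m (k : int) a : hom k a -> hom (k + m%:Z *+ 2) (iter m L a).
Proof.
move=> ha; elim: m => [|m /= /hom_L]; first by rewrite mul0rn addr0.
by congr hom; lia.
Qed.

Lemma hom_iter_Lam m (k : int) a : hom k a -> hom (k - m%:Z *+ 2) (iter m Lam a).
Proof.
move=> ha; elim: m => [|m /= /hom_Lam]; first by rewrite mul0rn subr0.
by congr hom; lia.
Qed.

(** Moving Lam through m factors L collects n - k - 2i for i < m, whose sum is m (n - k - m + 1). At
    m = 0 this coefficient vanishes, so the value of [m.-1] is irrelevant. *)
Lemma Lam_iter_L m (k : int) a : hom k a ->
  Lam (iter m L a) = iter m L (Lam a) +
    (m%:Z * (n%:Z - k - m%:Z + 1))%:~R *: iter m.-1 L a.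
Proof.
move=> ha; elim: m => [|m IH]; first by rewrite /= mul0r scale0r addr0.
rewrite iterS (comm_Lam_L (hom_iter_L m ha)) IH linearD linearZ /= -addrA.
congr (_ + _); case: m {IH} => [|m] /=.
  by rewrite mul0r scale0r add0r; congr (_%:~R *: _); lia.
by rewrite -scalerDl -intrD; congr (_%:~R *: _); lia.
Qed.

(** The mirror computation: the degrees now go down, and the sum of n - k + 2i for i < m is m (n - k
    + m - 1). *)
Lemma L_iter_Lam m (k : int) a : hom k a ->
  L (iter m Lam a) = iter m Lam (L a) -
    (m%:Z * (n%:Z - k + m%:Z - 1))%:~R *: iter m.-1 Lam a.
Proof.
move=> ha; elim: m => [|m IH]; first by rewrite /= mul0r scale0r subr0.
have := comm_Lam_L (hom_iter_Lam m ha).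
move/eqP; rewrite -subr_eq => /eqP; rewrite -iterS => <-.
rewrite IH linearB linearZ /= -addrA -opprD.
congr (_ - _); case: m {IH} => [|m] /=.
  by rewrite mul0r scale0r add0r; congr (_%:~R *: _); lia.
by rewrite -scalerDl -intrD; congr (_%:~R *: _); lia.
Qed.

(* Applying Lam and then L to [L^m a = 0] gives [L^(m+1) (Lam a) = 0], so that
   Lam a = 0 by induction on the degree; then [L^(m-1) a = 0]. *)
Lemma iter_L_inj m (k : int) a : k + m%:Z <= n%:Z -> hom k a -> iter m L a = 0 -> a = 0.
Proof.
have [N] := ubnP (absz (k)%R); elim: N m k a => // N IHN m k a hN.
have [k0|k0] := ltP k 0; first by move=> _ ha _; apply: hom_out ha; rewrite k0.
elim: m => [|m IHm] // hk ha hL.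
have Lam0 : Lam a = 0.
  (* The measure |k| does not drop from k to k - 2 when k is 0 or 1; there Lam a vanishes for
     reasons of degree. *)
  have [k2|k2] := ltP (k - 2) 0.
    by apply: (hom_out _ (hom_Lam ha)); rewrite k2.
  apply: (IHN m.+2 (k - 2)) (hom_Lam ha) _; [lia|lia|].
  have := Lam_iter_L m.+1 ha; rewrite hL linear0 => /(congr1 L).
  rewrite linear0 linearD linearZZ -[m.+1.-1]/m -[L (iter m L a)]/(iter m.+1 L a).
  by rewrite hL scaler0 addr0 => /esym.
apply: IHm => //; first by lia.
have := Lam_iter_L m.+1 ha; rewrite hL Lam0 linear0 iter_linear0 add0r /=.
(* The coefficient is (m + 1)(n - k - m), which is positive because k + m + 1 <= n. *)
move/esym/eqP; rewrite scaler_eq0 intr_eq0 => /orP[|/eqP//].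
by rewrite mulf_eq0 => /orP[] /eqP; lia.
Qed.

(** A highest weight vector: L^m Lam^m a is a scalar multiple of a, the scalar being the product of
    -j (n - k + j - 1) for 1 <= j <= m. No factor vanishes as k >= n + m, so a multiple of Lam^m a
    is a preimage. *)
Lemma iter_L_Lam_surj m (k : int) a : n%:Z + m%:Z <= k -> hom k a -> L a = 0 ->
  exists2 c, hom (k - m%:Z *+ 2) c & a = iter m L c.
Proof.
move=> hk ha La0.
suff [x x0 E] : exists2 x : R, x != 0 & iter m L (iter m Lam a) = x *: a.
  exists (x^-1 *: iter m Lam a); first by apply: homZ; apply: hom_iter_Lam.
  by rewrite iter_linearZ E scalerA mulVf // scale1r.
elim: m hk => [|m IH] hk; first by exists 1; rewrite ?oner_neq0 ?scale1r.
have [|x x0 E] := IH; first by lia.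
exists (- (m.+1%:Z * (n%:Z - k + m.+1%:Z - 1))%:~R * x).
  by rewrite mulf_neq0 // oppr_eq0 intr_eq0 mulf_neq0 //; lia.
rewrite iterSr (L_iter_Lam m.+1 ha) La0 iter_linear0 add0r iter_linearN.
by rewrite iter_linearZ /= E scalerA mulNr scaleNr.
Qed.

(** Descending induction on the degree, starting above 2n. The form L a has degree k + 2, hence L a
    = L^(m+1) c'; the difference a - L^m c' is killed by L and falls under the highest weight
    case. *)
Lemma iter_L_surj m (k : int) a : n%:Z + m%:Z <= k -> hom k a ->
  exists2 c, hom (k - m%:Z *+ 2) c & a = iter m L c.
Proof.
have [N] := ubnP (absz (n%:Z *+ 2 + 2 - k)%R); elim: N m k a => // N IHN m k a hN.
have [k0 _ ha|k0 hk ha] := ltP (n%:Z *+ 2) k.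
  by exists 0; rewrite ?iter_linear0 //; apply: hom_out ha; rewrite k0 orbT.
have [c' hc' Ec'] : exists2 c', hom (k - m%:Z *+ 2) c' & L a = iter m.+1 L c'.
  have [|||c hc Ec] := IHN m.+1 (k + 2) (L a); [lia|lia|exact: hom_L|].
  by exists c => //; move: hc; congr hom; lia.
have hLc : hom k (iter m L c').
  by move: (hom_iter_L m hc'); congr hom; lia.
have [|c hc Ec] := iter_L_Lam_surj hk (homB ha hLc).
  by rewrite linearB Ec' /= subrr.
exists (c' + c); first exact: homD.
by rewrite iter_linearD -Ec addrC subrK.
Qed.

(** With m = n + 1 - k, the form L^m a lies in degree n + m + 1, hence equals L^(m+1) c; then a - L
    c is killed by L^m, that is, primitive. *)
Lemma lefschetz_step (k : int) a : k <= n%:Z -> 0 <= k -> hom k a ->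
  exists b c, [/\ hom k b, iter (absz (n%:Z + 1 - k)%R) L b = 0, hom (k - 2) c
                & a = b + L c].
Proof.
move=> kn k0 ha; set m := (absz (n%:Z + 1 - k)%R).
have [|c hc Ec] := iter_L_surj (m := m.+1) _ (hom_iter_L m ha); first by lia.
have hc' : hom (k - 2) c by move: hc; congr hom; lia.
exists (a - L c), c; split=> //; last by rewrite subrK.
  by apply: homB => //; move: (hom_L hc'); congr hom; lia.
by rewrite iter_linearB Ec iterSr subrr.
Qed.

(** Meant for a = dB with B primitive of degree s: as d commutes with L, the form dB inherits
    L^(n+1-s) dB = 0, and this leaves only the two terms that define del_plus B and del_minus B. *)
Lemma prim_split_exists (s : int) a : 0 <= s -> s <= n%:Z -> hom (s + 1) a ->
  iter (absz (n%:Z + 1 - s)%R) L a = 0 ->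
  exists b c, [/\ hom (s + 1) b, iter (absz (n%:Z - s)%R) L b = 0,
    hom (s - 1) c, iter (absz (n%:Z + 2 - s)%R) L c = 0 & a = b + L c].
Proof.
move=> s0 sn ha La; set m := absz (n%:Z - s)%R.
have [|c hc Ec] := iter_L_surj (m := m.+1) _ (hom_iter_L m ha); first by lia.
have hc' : hom (s - 1) c by move: hc; congr hom; lia.
exists (a - L c), c; split=> //; last by rewrite subrK.
- by apply: homB => //; move: (hom_L hc'); congr hom; lia.
- by rewrite iter_linearB Ec iterSr subrr.
- rewrite (_ : absz _ = m.+2); last by lia.
  by rewrite iterS -Ec -iterS -[RHS]La; congr (iter _ L); lia.
Qed.

(** Primitive parts are split off one at a time, [B r] having degree k - 2r. The length N of the sum
    is left free because each step lowers it by one together with the degree. *)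
Lemma lefschetz_low (k : int) a : k <= n%:Z -> hom k a ->
  exists B : nat -> X,
  [/\ forall r, hom (k - r%:Z *+ 2) (B r),
      forall r, iter (absz (n%:Z + 1 - (k - r%:Z *+ 2))%R) L (B r) = 0,
      forall r, (k - r%:Z *+ 2 < 0) -> B r = 0
    & forall N, (k < N%:Z) -> a = \sum_(r < N) iter r L (B r)].
Proof.
have [N] := ubnP (absz (k + 2)%R); elim: N k a => // N IHN k a hN kn ha.
have [k0|k0] := ltP k 0.
  have -> : a = 0 by apply: hom_out ha; rewrite k0.
  exists (fun=> 0); split=> // [r|N' _]; first by rewrite iter_linear0.
  by rewrite big1 // => i _; rewrite iter_linear0.
have [b [c [hb b0 hc Ea]]] := lefschetz_step kn k0 ha.
have [|||B [hB PB B0 EB]] := IHN (k - 2) c; [lia|lia|done|].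
exists (fun r => if r is r'.+1 then B r' else b); split.
- case=> [|r]; first by rewrite mul0rn subr0.
  by move: (hB r); congr hom; lia.
- case=> [|r]; first by rewrite mul0rn subr0.
  by rewrite -[RHS](PB r); congr (iter _ L); lia.
- by case=> [|r] hr; [lia|apply: B0; lia].
- case=> [|N' hN']; first by lia.
  rewrite big_ord_recl /= Ea; congr (_ + _).
  have [cN|] := ltP (k - 2) N'%:Z; last by lia.
  by rewrite [in LHS](EB N' cN) linear_sum.
Qed.

Lemma lefschetz_exists (k : int) a : hom k a ->
  exists B : nat -> X,
  [/\ forall r, hom (k - r%:Z *+ 2) (B r),
      forall r, iter (absz (n%:Z + 1 - (k - r%:Z *+ 2))%R) L (B r) = 0,
      forall r, (k - r%:Z *+ 2 < 0) || (n%:Z < k - r%:Z) -> B r = 0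
    & a = \sum_(r < n.+1) iter r L (B r)].
Proof.
move=> ha; have [kn|kn] := leP k n%:Z.
  have [B [hB PB B0 EB]] := lefschetz_low kn ha.
  by exists B; split=> // [r /orP[/B0//|]|]; [lia|apply: EB; lia].
(* Above the middle degree a = L^t c with c of degree 2n - k < n; the decomposition of c shifted by
   t is that of a, which is why it starts at r = k - n. *)
set t := (absz (k - n%:Z)%R); have tE : t%:Z = k - n%:Z by lia.
have [|c hc Ec] := iter_L_surj (m := t) _ ha; first by lia.
have [|B [hB PB B0 EB]] := lefschetz_low _ hc; first by lia.
exists (fun r => if (r < t)%N then 0 else B (r - t)%N); split=> [r|r|r|].
- case: ltnP => // tr; move: (hB (r - t)%N); congr hom; lia.
- case: ltnP => tr; first by rewrite iter_linear0.
  by rewrite -[RHS](PB (r - t)%N); congr (iter _ L); lia.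
- by case: ltnP => // tr hr; apply: B0; lia.
- rewrite Ec (EB n.+1); last by lia.
  rewrite iter_linear_sum [RHS](bigID (fun r : 'I_n.+1 => (r < t)%N)) /=.
  rewrite [X in _ = X + _]big1 ?add0r; last first.
    by move=> i ->; rewrite iter_linear0.
  have [tn|tn] := leqP t n; last first.
    rewrite [LHS]big1 => [|i _]; last by rewrite B0 ?iter_linear0 //; lia.
    by rewrite big1 // => i; have := ltn_ord i; lia.
  rewrite -(big_mkord xpredT (fun r => iter t L (iter r L (B r)))).
  rewrite -(big_mkord (fun r => ~~ (r < t)%N)
             (fun r => iter r L (if (r < t)%N then 0 else B (r - t)%N))).
  rewrite [RHS](big_cat_nat (n := t)) ?leq0n //=; last by lia.
  rewrite [X in X + _]big1_seq ?add0r; last first.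
    by move=> i; rewrite mem_index_iota => /andP[/negbTE/negP]; lia.
  rewrite -[X in _ = \sum_(X <= _ < _ | _) _]add0n big_addn.
  rewrite [LHS](big_cat_nat (n := (n.+1 - t)%N)) ?leq0n //=; last by lia.
  rewrite [X in _ + X]big1_seq ?addr0; last first.
    move=> i; rewrite mem_index_iota => /andP[_ hi].
    by rewrite B0 ?iter_linear0 //; lia.
  apply: eq_big => [i|i _]; first by lia.
  by rewrite -iterD addnK addnC ifF //; lia.
Qed.

End Sl2.

(** * Filtered complexes over a hard Lefschetz module *)

Definition filt (R : numFieldType) (X : lmodType R) (hom : int -> X -> Prop)
  (Pi : X -> X) (k : int) (a : X) := hom k a /\ Pi a = a.

(* An abstract model of the forms on a symplectic manifold ([hom k] are the
   k-forms, D = d) and of its symbol at a covector ([D] = xi /\ _). [Mid] is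
   characterised by [D a = L^(p+1) c] rather than by del_plus and del_minus. *)
Record lefschetz_complex (R : numFieldType) (X : lmodType R) (n p : nat)
  (hom : int -> X -> Prop) (L : {linear X -> X}) (D Pi Refl Mid : X -> X) : Prop :=
LefschetzComplex {
  lc_hom0 : forall k, hom k 0 ;
  lc_hom_lin : forall k c a b, hom k a -> hom k b -> hom k (c *: a + b) ;
  lc_hom_L : forall k a, hom k a -> hom (k + 2) (L a) ;
  lc_hom_D : forall k a, hom k a -> hom (k + 1) (D a) ;
  lc_D_B : forall k a b, hom k a -> hom k b -> D (a - b) = D a - D b ;
  lc_L_inj : forall m k a,
    k + m%:Z <= n%:Z -> hom k a -> iter m L a = 0 -> a = 0 ;
  lc_L_surj : forall m k a, n%:Z + m%:Z <= k -> hom k a ->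
    exists2 c, hom (k - m%:Z *+ 2) c & a = iter m L c ;
  lc_DL : forall k a, hom k a -> D (L a) = L (D a) ;
  lc_DD : forall k a, hom k a -> D (D a) = 0 ;
  lc_Pi_hom : forall k a, hom k a -> hom k (Pi a) ;
  lc_PiB : forall k a b, hom k a -> hom k b -> Pi (a - b) = Pi a - Pi b ;
  lc_Pi_split : forall k a, hom k a ->
    exists2 c, hom (k - p.+1%:Z *+ 2) c & a = Pi a + iter p.+1 L c ;
  lc_Pi_L : forall k c, hom k c -> Pi (iter p.+1 L c) = 0 ;
  lc_Refl_hom : forall k a, hom k a -> hom (n%:Z *+ 2 - k) (Refl a) ;
  lc_Refl0 : Refl 0 = 0 ;
  lc_ReflK : forall k a, hom k a -> Refl (Refl a) = a ;
  lc_Refl_Pi : forall k a, hom k a ->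
    Pi a = a <-> iter p.+1 L (Refl a) = 0 ;
  lc_Refl_prim : forall b, hom (n%:Z - p%:Z) b -> iter p.+1 L b = 0 ->
    Refl b = iter p L b ;
  lc_Mid_def : forall a c, filt hom Pi (n%:Z + p%:Z) a ->
    hom (n%:Z - p%:Z - 1) c -> D a = iter p.+1 L c -> Mid a = iter p L (D c)
}.

Section FilteredComplex.
Variables (R : numFieldType) (X : lmodType R) (n p : nat) (hpn : (p <= n)%N).
Variables (hom : int -> X -> Prop) (L : {linear X -> X}) (D Pi Refl Mid : X -> X).
Variable S : lefschetz_complex n p hom L D Pi Refl Mid.

Let hom0 := lc_hom0 S.
Let hom_lin := lc_hom_lin S.
Let hom_L := lc_hom_L S.
Let hom_D := lc_hom_D S.
Let D_B := lc_D_B S.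
Let L_inj := lc_L_inj S.
Let L_surj := lc_L_surj S.
Let DL := lc_DL S.
Let DD := lc_DD S.
Let Pi_hom := lc_Pi_hom S.
Let PiB := lc_PiB S.
Let Pi_split := lc_Pi_split S.
Let Pi_L := lc_Pi_L S.
Let Refl_hom := lc_Refl_hom S.
Let Refl0 := lc_Refl0 S.
Let ReflK := lc_ReflK S.
Let Refl_Pi := lc_Refl_Pi S.
Let Refl_prim := lc_Refl_prim S.
Let Mid_def := lc_Mid_def S.

Local Notation filt := (filt hom Pi).

Definition filt_map (j : nat) (a : X) : X :=
  if (j < n + p)%N then Pi (D a)
  else if (j == n + p)%N then Mid a
  else Refl (D (Refl a)).

Let hB := homB hom_lin.
Let hL := hom_iter_L hom_L.

Lemma D0 : D 0 = 0.
Proof. by have := D_B (hom0 0) (hom0 0); rewrite !subrr. Qed.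

Lemma DN k a : hom k a -> D (- a) = - D a.
Proof. by move=> ha; rewrite -[- a]sub0r (D_B (hom0 k) ha) D0 sub0r. Qed.

Lemma hom_cast k k' a : hom k a -> k = k' -> hom k' a.
Proof. by move=> ? <-. Qed.

Lemma D_iter_L m k a : hom k a -> D (iter m L a) = iter m L (D a).
Proof.
by move=> ha; elim: m => //= m IH; rewrite (DL (hL m ha)) IH.
Qed.

Lemma Pi_idem k a : hom k a -> Pi (Pi a) = Pi a.
Proof.
move=> ha; have [c hc Ea] := Pi_split ha.
have := PiB ha (Pi_hom ha); rewrite {1}Ea [Pi a + _]addrC addrK (Pi_L hc).
by move/esym/eqP; rewrite subr_eq0 => /eqP <-.
Qed.

Lemma filt_Pi k a : hom k a -> filt k (Pi a).
Proof. by move=> ha; split; [exact: Pi_hom|exact: Pi_idem ha]. Qed.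

(** D a lies in degree n + p + 1, the symmetric counterpart of n - p - 1, and L^(p+1) is bijective
    between these two degrees. *)
Lemma mid_witness a : hom (n%:Z + p%:Z) a ->
  exists2 c, hom (n%:Z - p%:Z - 1) c & D a = iter p.+1 L c.
Proof.
move=> ha; have [|c hc Ec] := L_surj (m := p.+1) _ (hom_D ha); first by lia.
by exists c => //; apply: hom_cast hc _; lia.
Qed.

(** L^(p+1) D c = D D a = 0 makes D c primitive of degree n - p, so L^p D c is its reflection. The
    equation [Refl (Mid a) = D c] is the link between the two halves of the sequence. *)
Lemma Mid_filt a : filt (n%:Z + p%:Z) a -> filt (n%:Z + p%:Z) (Mid a) /\
  exists2 c, hom (n%:Z - p%:Z - 1) c &
    [/\ D a = iter p.+1 L c, Mid a = iter p L (D c), hom (n%:Z - p%:Z) (D c),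
        iter p.+1 L (D c) = 0 & Refl (Mid a) = D c].
Proof.
move=> fa; have [c hc Ec] := mid_witness fa.1.
have hDc : hom (n%:Z - p%:Z) (D c) by apply: hom_cast (hom_D hc) _; lia.
have LDc : iter p.+1 L (D c) = 0 by rewrite -(D_iter_L _ hc) -Ec (DD fa.1).
have RM : Refl (Mid a) = D c.
  by rewrite (Mid_def fa hc Ec) -(Refl_prim hDc LDc) (ReflK hDc).
split; last by exists c => //; split=> //; apply: Mid_def.
have hM : hom (n%:Z + p%:Z) (Mid a).
  by rewrite (Mid_def fa hc Ec); apply: hom_cast (hL p hDc) _; lia.
by split=> //; apply/(Refl_Pi hM); rewrite RM.
Qed.

(** Reflection turns filtered elements into the kernel of L^(p+1), and D preserves that kernel since
    it commutes with L. *)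
Lemma Refl_D_Refl_filt k a : filt k a -> filt (k - 1) (Refl (D (Refl a))).
Proof.
move=> [ha /(Refl_Pi ha) La].
have hR := Refl_hom ha; have hDR := hom_D hR.
have hRDR : hom (k - 1) (Refl (D (Refl a))).
  by apply: hom_cast (Refl_hom hDR) _; lia.
split=> //; apply/(Refl_Pi hRDR).
by rewrite (ReflK hDR) -(D_iter_L _ hR) La D0.
Qed.

Lemma filt_map_filt j a : (j < cplx_last n p)%N ->
  filt (cplx_degree n p j)%:Z a ->
  filt (cplx_degree n p j.+1)%:Z (filt_map j a).
Proof.
rewrite /cplx_degree /cplx_last /filt_map => hj.
have [h1|h1|h1] := ltngtP j (n + p)%N.
- move=> [ha _]; have /filt_Pi := hom_D ha; congr filt.
  by lia.
- by move/Refl_D_Refl_filt; congr filt; lia.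
- rewrite h1 => fa; have [|fM _] := @Mid_filt a.
    by move: fa; congr filt; lia.
  by move: fM; congr filt; lia.
Qed.

Lemma filt_map_comp j a : (j.+1 < cplx_last n p)%N ->
  filt (cplx_degree n p j)%:Z a -> filt_map j.+1 (filt_map j a) = 0.
Proof.
rewrite /cplx_degree /cplx_last /filt_map => hj.
have [h1|h1|h1] := ltngtP j (n + p)%N; rewrite ?h1 ?ltnn ?eqxx.
- move=> [ha _]; have hDa := hom_D ha.
  have [c hc Ec] := Pi_split hDa.
  have EPi : Pi (D a) = D a - iter p.+1 L c by rewrite {2}Ec addrK.
  have hNc : hom (j%:Z + 1 - p.+1%:Z *+ 2) (- c).
    by rewrite -[- c]sub0r; apply: hB.
  (* This serves both continuations: Pi kills a multiple of L^(p+1), and in degree n + p the element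
     D (- c) is the witness defining [Mid], which then is L^p D D (- c) = 0. *)
  have DPi : D (Pi (D a)) = iter p.+1 L (D (- c)).
    have hLc : hom (j%:Z + 1) (iter p.+1 L c) by apply: hom_cast (hL p.+1 hc) _; lia.
    by rewrite EPi (D_B hDa hLc) (DD ha) sub0r (D_iter_L _ hc) -iter_linearN (DN hc).
  case: (ltngtP j.+1 (n + p)%N) => h2; [|by lia|]; first by rewrite DPi (Pi_L (hom_D hNc)).
  have fPi : filt (n%:Z + p%:Z) (Pi (D a)).
    by have := filt_Pi hDa; congr filt; lia.
  have hDNc : hom (n%:Z - p%:Z - 1) (D (- c)).
    by apply: hom_cast (hom_D hNc) _; lia.
  by rewrite (Mid_def fPi hDNc DPi) (DD hNc) iter_linear0.
- move=> [ha _]; rewrite ifF; last by lia.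
  rewrite ifF; last by lia.
  have hR := Refl_hom ha.
  by rewrite (ReflK (hom_D hR)) (DD hR) Refl0.
- move=> fa; rewrite ifF; last by lia.
  rewrite ifF; last by lia.
  have [|_ [c hc [_ _ _ _ ->]]] := @Mid_filt a.
    by move: fa; congr filt; lia.
  by rewrite (DD hc) Refl0.
Qed.

(** * Exactness of the filtered sequence when D is acyclic *)

Hypothesis acyclic : forall k a, hom k a -> D a = 0 ->
  exists2 b, hom (k - 1) b & a = D b.

(* [Pi (D a) = 0] means [D a = L^(p+1) c]; then [D c = 0] by injectivity, so
   [c = D c'] and [a - L^(p+1) c'] is closed. *)
Lemma filt_exact_up k a c : k <= n%:Z + p%:Z -> filt k a ->
  hom (k - p.+1%:Z *+ 2 + 1) c -> D a = iter p.+1 L c -> D c = 0 ->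
  exists2 b, filt (k - 1) b & a = Pi (D b).
Proof.
move=> hk [ha Pa] hc Ea Dc0.
have [c' hc' Ec] := acyclic hc Dc0.
have hLc' : hom k (iter p.+1 L c') by apply: hom_cast (hL p.+1 hc') _; lia.
have [|b hb Eb] := acyclic (hB ha hLc').
  by rewrite (D_B ha hLc') (D_iter_L _ hc') -Ec Ea subrr.
exists (Pi b); first exact: filt_Pi.
have [c2 hc2 Ec2] := Pi_split hb.
have -> : Pi b = b - iter p.+1 L c2 by rewrite {2}Ec2 addrK.
have h1 : hom k (D b) by apply: hom_cast (hom_D hb) _; lia.
have h2 : hom k (D (iter p.+1 L c2)).
  by apply: hom_cast (hom_D (hL p.+1 hc2)) _; lia.
have hLc2 : hom (k - 1) (iter p.+1 L c2) by apply: hom_cast (hL p.+1 hc2) _; lia.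
rewrite (D_B hb hLc2) (PiB h1 h2) (D_iter_L _ hc2) (Pi_L (hom_D hc2)) subr0 -Eb.
by rewrite (PiB ha hLc') Pa (Pi_L hc') subr0.
Qed.

(** Here D c has degree k - 2p, and L^(p+1) is injective there precisely in the range k < n + p. *)
Lemma filt_exact_low k a : k < n%:Z + p%:Z -> filt k a -> Pi (D a) = 0 ->
  exists2 b, filt (k - 1) b & a = Pi (D b).
Proof.
move=> hk fa PD0; have [ha Pa] := fa.
have hDa := hom_D ha; have [c hc Ec] := Pi_split hDa.
rewrite PD0 add0r in Ec.
apply: (filt_exact_up (c := c) _ fa _ Ec); first by lia.
  by apply: hom_cast hc _; lia.
apply: (L_inj (m := p.+1) _ (hom_D hc)); first by lia.
by rewrite -(D_iter_L _ hc) -Ec (DD ha).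
Qed.

(** In degree n + p injectivity of L^(p+1) on D c is lost, since primitive (n-p)-forms lie in its
    kernel; [Mid a = 0] supplies D c = 0 instead, through the reflection. *)
Lemma filt_exact_mid a : filt (n%:Z + p%:Z) a -> Mid a = 0 ->
  exists2 b, filt (n%:Z + p%:Z - 1) b & a = Pi (D b).
Proof.
move=> fa M0; have [_ [c hc [Ea _ hDc _ EM]]] := Mid_filt fa.
apply: (filt_exact_up _ fa _ Ea) => //; first by apply: hom_cast hc _; lia.
by rewrite -EM M0 Refl0.
Qed.

(** Write b = D c. Then L^(p+1) c is closed, hence equal to D a for some a of degree n + p.
    Replacing a by Pi a = a - L^(p+1) c' changes c into c - D c', which has the same differential
    b. *)
Lemma ker_exact_mid b : hom (n%:Z - p%:Z) b -> iter p.+1 L b = 0 -> D b = 0 ->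
  exists2 a, filt (n%:Z + p%:Z) a & Mid a = iter p L b.
Proof.
move=> hb Lb Db; have [c hc Ec] := acyclic hb Db.
have hLc := hL p.+1 hc.
have [|a ha Ea] := acyclic hLc; first by rewrite (D_iter_L _ hc) -Ec.
have {}ha : hom (n%:Z + p%:Z) a by apply: hom_cast ha _; lia.
have [c' hc' Ec'] := Pi_split ha.
exists (Pi a); first exact: filt_Pi.
have hDc' : hom (n%:Z - p%:Z - 1) (D c') by apply: hom_cast (hom_D hc') _; lia.
rewrite (Mid_def (c := c - D c')) ?(D_B hc hDc') ?(DD hc') ?subr0 -?Ec //.
- exact: filt_Pi.
- exact: hB.
have -> : Pi a = a - iter p.+1 L c' by rewrite {2}Ec' addrK.
have hLc' : hom (n%:Z + p%:Z) (iter p.+1 L c') by apply: hom_cast (hL p.+1 hc') _; lia.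
by rewrite (D_B ha hLc') (D_iter_L _ hc') -Ea iter_linearB.
Qed.

(** A primitive b' of b need not lie in the kernel of L^(p+1), but L^(p+1) b' = D g with g of degree
    k + 2p >= n + p + 1. So g = L^(p+1) g', and b' - D g' is in the kernel with the same
    differential. *)
Lemma ker_exact_high k b : n%:Z - p%:Z < k -> hom k b -> iter p.+1 L b = 0 ->
  D b = 0 -> exists b', [/\ hom (k - 1) b', iter p.+1 L b' = 0 & b = D b'].
Proof.
move=> hk hb Lb Db; have [b' hb' Eb] := acyclic hb Db.
have hLb' := hL p.+1 hb'.
have [|g hg Eg] := acyclic hLb'; first by rewrite (D_iter_L _ hb') -Eb.
have [|g' hg' Eg'] := L_surj (m := p.+1) _ hg; first by lia.
have hDg' : hom (k - 1) (D g') by apply: hom_cast (hom_D hg') _; lia.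
exists (b' - D g'); split; first exact: hB.
- by rewrite iter_linearB -(D_iter_L _ hg') -Eg' Eg subrr.
- by rewrite (D_B hb' hDg') (DD hg') subr0.
Qed.

Lemma filt_exact_high k a : 0 <= k -> k < n%:Z + p%:Z -> filt k a ->
  D (Refl a) = 0 -> exists2 b, filt (k + 1) b & a = Refl (D (Refl b)).
Proof.
move=> k0 hk [ha /(Refl_Pi ha) La] DR0.
have [|b [hb Lb Eb]] := ker_exact_high _ (Refl_hom ha) La DR0; first by lia.
have hRb : hom (k + 1) (Refl b) by apply: hom_cast (Refl_hom hb) _; lia.
exists (Refl b); last by rewrite (ReflK hb) -Eb (ReflK ha).
by split=> //; apply/(Refl_Pi hRb); rewrite (ReflK hb).
Qed.

Lemma filt_exact_middle a : filt (n%:Z + p%:Z) a -> D (Refl a) = 0 ->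
  exists2 b, filt (n%:Z + p%:Z) b & a = Mid b.
Proof.
move=> [ha /(Refl_Pi ha) La] DR0.
have hR : hom (n%:Z - p%:Z) (Refl a) by apply: hom_cast (Refl_hom ha) _; lia.
have [b fb Eb] := ker_exact_mid hR La DR0; exists b => //.
by rewrite Eb -(Refl_prim hR La) (ReflK ha).
Qed.

(** Injectivity at the left end is exactness in degree 0, the preimage having degree -1. *)
Lemma filt_exact0 a : (0 < n + p)%N -> (forall a, hom (- 1) a -> a = 0) ->
  filt 0 a -> filt_map 0 a = 0 -> a = 0.
Proof.
move=> np0 homN; rewrite /filt_map np0 => fa /(filt_exact_low _ fa)[|b fb ->].
  by lia.
have [hb _] := fb; have -> : b = 0 by apply: homN.
by have := PiB (hom0 0) (hom0 0); rewrite D0 !subrr.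
Qed.

Lemma Refl_inj0 k a : hom k a -> Refl a = 0 -> a = 0.
Proof. by move=> ha R0; rewrite -(ReflK ha) R0 Refl0. Qed.

Lemma filt_map_exact j b : (j.+1 < cplx_last n p)%N ->
  filt (cplx_degree n p j.+1)%:Z b -> filt_map j.+1 b = 0 ->
  exists2 a, filt (cplx_degree n p j)%:Z a & filt_map j a = b.
Proof.
rewrite /cplx_degree /cplx_last /filt_map => hj.
have [h1|h1|h1] := ltngtP j (n + p)%N; rewrite ?h1 ?ltnn ?eqxx.
- move=> fb; case: (ltngtP j.+1 (n + p)%N) => h2 H; [|by lia|].
    have [|a fa ->] := filt_exact_low _ fb H; first by lia.
    by exists a => //; move: fa; congr filt; lia.
  have [|a fa ->] := filt_exact_mid _ H; first by move: fb; congr filt; lia.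
  by exists a => //; move: fa; congr filt; lia.
- rewrite ifF; last by lia.
  rewrite ifF; last by lia.
  move=> fb /Refl_inj0 - /(_ _ (hom_D (Refl_hom fb.1))) H.
  have [||a fa ->] := filt_exact_high _ _ fb H; [lia|lia|].
  by exists a => //; move: fa; congr filt; lia.
- rewrite ifF; last by lia.
  rewrite ifF; last by lia.
  move=> fb /Refl_inj0 - /(_ _ (hom_D (Refl_hom fb.1))) H.
  have [|a fa ->] := filt_exact_middle _ H; first by move: fb; congr filt; lia.
  by exists a => //; move: fa; congr filt; lia.
Qed.

(** At the right end D (Refl b) has degree 2n + 1, so b satisfies the cycle condition
    automatically. *)
Lemma filt_map_surj b : (0 < n + p)%N -> (forall a, hom (n%:Z *+ 2 + 1) a -> a = 0) ->
  filt 0 b ->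
  exists2 a, filt 1 a & filt_map (cplx_last n p).-1 a = b.
Proof.
move=> np0 homT fb.
have H : D (Refl b) = 0.
  by apply: homT; apply: hom_cast (hom_D (Refl_hom fb.1)) _; lia.
have [||a fa ->] := filt_exact_high _ _ fb H; [lia|lia|].
exists a => //; rewrite /filt_map /cplx_last ifF ?ifF //; lia.
Qed.

End FilteredComplex.

(** * Exterior algebra *)

Section ExteriorAlgebra.
Variables (R : realType) (m : nat).
Local Notation ext := (ext R m).
Implicit Types (a b c : ext) (S T U : {set 'I_m}) (i j : 'I_m) (k : int).

Lemma ext_scaleE x a S : (x *: a) S = x * a S.
Proof. by rewrite ffunE. Qed.

Lemma ext_addE a b S : (a + b) S = a S + b S.
Proof. by rewrite ffunE. Qed.

Lemma ext_sumE I (r : seq I) (P : pred I) (F : I -> ext) S :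
  (\sum_(u <- r | P u) F u) S = \sum_(u <- r | P u) F u S.
Proof. exact: sum_ffunE. Qed.

Lemma wedge_is_linear a : linear (wedge a).
Proof.
move=> x b c; apply/ffunP => S.
rewrite ext_addE ext_scaleE !ffunE mulr_sumr -big_split /=.
by apply: eq_bigr => T _; rewrite ext_addE ext_scaleE mulrDr mulrCA.
Qed.
HB.instance Definition _ a :=
  GRing.isLinear.Build R ext ext *:%R (wedge a) (wedge_is_linear a).

Definition wedger b a : ext := wedge a b.

Lemma wedger_is_linear b : linear (wedger b).
Proof.
move=> x a c; apply/ffunP => S.
rewrite ext_addE ext_scaleE !ffunE mulr_sumr -big_split /=.
apply: eq_bigr => T _; rewrite ext_addE ext_scaleE; ring.
Qed.
HB.instance Definition _ b :=
  GRing.isLinear.Build R ext ext *:%R (wedger b) (wedger_is_linear b).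

Lemma wedge0l b : wedge 0 b = 0. Proof. exact: (linear0 (wedger b)). Qed.
Lemma wedgeZl x a b : wedge (x *: a) b = x *: wedge a b.
Proof. exact: (linearZZ (wedger b)). Qed.
Lemma wedgeNl a b : wedge (- a) b = - wedge a b.
Proof. exact: (linearN (wedger b)). Qed.
Lemma wedgeNr a b : wedge a (- b) = - wedge a b.
Proof. exact: (linearN (wedge a)). Qed.
Lemma wedge_suml I (r : seq I) (P : pred I) F b :
  wedge (\sum_(u <- r | P u) F u) b = \sum_(u <- r | P u) wedge (F u) b.
Proof. exact: (linear_sum (wedger b)). Qed.

Lemma wedge0r b : wedge b 0 = 0. Proof. exact: (linear0 (wedge b)). Qed.
Lemma wedgeDr a b c : wedge a (b + c) = wedge a b + wedge a c.
Proof. exact: (linearD (wedge a)). Qed.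
Lemma wedgeZr x a b : wedge a (x *: b) = x *: wedge a b.
Proof. exact: (linearZZ (wedge a)). Qed.
Lemma wedge_sumr I (r : seq I) (P : pred I) F b :
  wedge b (\sum_(u <- r | P u) F u) = \sum_(u <- r | P u) wedge b (F u).
Proof. exact: (linear_sum (wedge b)). Qed.

Definition dx S : ext := [ffun T => (T == S)%:R].

Lemma ext_dxE a : a = \sum_S a S *: dx S.
Proof.
apply/ffunP => T; rewrite ext_sumE (bigD1 T) //= big1 => [|S nST].
  by rewrite ext_scaleE ffunE eqxx addr0 mulr1.
by rewrite ext_scaleE ffunE eq_sym (negbTE nST) mulr0.
Qed.

Lemma ext_linear_ind (V : lmodType R) (f g : {linear ext -> V}) :
  (forall S, f (dx S) = g (dx S)) -> f =1 g.
Proof.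
by move=> fg a; rewrite [a]ext_dxE !linear_sum; apply: eq_bigr => S _;
  rewrite !linearZ /= fg.
Qed.

Definition swap_sign i j : R := if (j < i)%N then -1 else 1.

Lemma swap_sign_anti i j : i != j -> swap_sign i j = - swap_sign j i.
Proof.
by rewrite /swap_sign -val_eqE; case: ltngtP => //= _ _; rewrite opprK.
Qed.

Lemma swap_sign_sq i j : swap_sign i j * swap_sign i j = 1.
Proof. by rewrite /swap_sign; case: ifP; rewrite ?mulrNN mulr1. Qed.

(** Turning the count of inversions into a product over pairs makes the sign multiplicative in each
    argument; associativity of the wedge product rests on this. *)
Lemma wedge_signE S T :
  wedge_sign R S T = \prod_(i in S) \prod_(j in T) swap_sign i j.
Proof.
rewrite pair_big /= (bigID (fun ij : 'I_m * 'I_m => (ij.2 < ij.1)%N)) /=.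
rewrite [X in _ * X]big1 ?mulr1; last first.
  by move=> ij /andP[_ /negbTE h]; rewrite /swap_sign h.
rewrite (eq_bigr (fun=> -1)); last by move=> ij /andP[_ h]; rewrite /swap_sign h.
rewrite prodr_const; congr (_ ^+ _); apply: eq_card => ij.
by rewrite [LHS]inE [RHS]unfold_in /= andbA.
Qed.

Lemma wedge_sign_sq S T : wedge_sign R S T * wedge_sign R S T = 1.
Proof. by rewrite /wedge_sign -expr2 sqrr_sign. Qed.

Lemma wedge_signUl S T U : [disjoint S & T] ->
  wedge_sign R (S :|: T) U = wedge_sign R S U * wedge_sign R T U.
Proof.
by move=> dST; rewrite !wedge_signE -bigU //=; apply: eq_bigl => i; rewrite inE.
Qed.

Lemma wedge_signUr S T U : [disjoint T & U] ->
  wedge_sign R S (T :|: U) = wedge_sign R S T * wedge_sign R S U.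
Proof.
move=> dST; rewrite !wedge_signE -big_split /=; apply: eq_bigr => i _.
by rewrite -bigU //=; apply: eq_bigl => j; rewrite inE.
Qed.

Lemma wedge_sign11 i j : wedge_sign R [set i] [set j] = swap_sign i j.
Proof. by rewrite wedge_signE !big_set1. Qed.

Lemma dx_wedge S T : wedge (dx S) (dx T) =
  if [disjoint S & T] then wedge_sign R S T *: dx (S :|: T) else 0.
Proof.
apply/ffunP => U; rewrite ffunE.
have -> : (if [disjoint S & T] then wedge_sign R S T *: dx (S :|: T) else 0) U =
    ([disjoint S & T] && (U == S :|: T))%:R * wedge_sign R S T.
  by case: ifP => _; rewrite ?ext_scaleE !ffunE ?mul0r //= mulrC.
have [SU|SU] := boolP (S \subset U); last first.
  rewrite big1 => [|Q QU].
    rewrite (_ : (_ && _) = false) ?mul0r //; apply/negP => /andP[_ /eqP UE].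
    by move: SU; rewrite UE finset.subsetUl.
  by rewrite ffunE; case: eqP => [QS|]; [move: SU; rewrite -QS QU|rewrite mulr0 mul0r].
rewrite (bigD1 S) //= big1 ?addr0 => [|Q /andP[_ /negbTE QS]]; last first.
  by rewrite ffunE QS mulr0 mul0r.
rewrite !ffunE eqxx mulr1.
have -> : [disjoint S & T] && (U == S :|: T) = (U :\: S == T).
  apply/andP/eqP => [[dST /eqP ->]|<-].
    rewrite finset.setDUl finset.setDv finset.set0U; apply/finset.setDidPl.
    by rewrite disjoint_sym.
  split; last by rewrite -{1}(finset.setID U S) (finset.setIidPr SU).
  by rewrite finset.disjoints_subset; apply/fintype.subsetP => i iS; rewrite !inE iS.
by case: eqP => [->|]; rewrite ?mulr0 ?mul0r // mulrC.
Qed.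

Lemma dx_wedgeA S T U :
  wedge (dx S) (wedge (dx T) (dx U)) = wedge (wedge (dx S) (dx T)) (dx U).
Proof.
rewrite (dx_wedge T) (dx_wedge S T).
have [TU|TU] := boolP [disjoint T & U]; have [ST|ST] := boolP [disjoint S & T];
  rewrite ?wedge0r ?wedge0l ?wedgeZr ?wedgeZl ?dx_wedge //.
- rewrite -!setI_eq0 finset.setIUr finset.setIUl !finset.setU_eq0 !setI_eq0.
  rewrite TU ST andbT /=; case: ifP => SU; last by rewrite !scaler0.
  rewrite !scalerA wedge_signUr // wedge_signUl // finset.setUA.
  by congr (_ *: _); ring.
- by rewrite -setI_eq0 finset.setIUr finset.setU_eq0 !setI_eq0 (negbTE ST) scaler0.
- by rewrite -setI_eq0 finset.setIUl finset.setU_eq0 !setI_eq0 (negbTE TU)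
    andbF scaler0.
Qed.

Lemma wedgeA a b c : wedge a (wedge b c) = wedge (wedge a b) c.
Proof.
apply: (ext_linear_ind (f := wedger (wedge b c)) (g := wedger c \o wedger b)).
move=> S /=; rewrite /wedger.
apply: (ext_linear_ind (f := wedge (dx S) \o wedger c)
                       (g := wedger c \o wedge (dx S))) => T /=; rewrite /wedger.
apply: (ext_linear_ind (f := wedge (dx S) \o wedge (dx T))
                       (g := wedge (wedge (dx S) (dx T)))) => U /=.
exact: dx_wedgeA.
Qed.

Lemma ext1E : ext1 R m = dx finset.set0.
Proof. by apply/ffunP => S; rewrite !ffunE. Qed.

Lemma wedge1l a : wedge (ext1 R m) a = a.
Proof.
apply: (ext_linear_ind (f := wedge (ext1 R m)) (g := idfun)) => S /=.
rewrite ext1E dx_wedge -setI_eq0 finset.set0I eqxx finset.set0U.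
by rewrite wedge_signE big_set0 scale1r.
Qed.

Lemma wedge1r a : wedge a (ext1 R m) = a.
Proof.
apply: (ext_linear_ind (f := wedger (ext1 R m)) (g := idfun)) => S /=.
rewrite /wedger ext1E dx_wedge -setI_eq0 finset.setI0 eqxx finset.setU0.
by rewrite wedge_signE big1 ?scale1r // => i _; rewrite big_set0.
Qed.

Lemma covectorE (x : 'rV[R]_m) : covector x = \sum_i x 0 i *: dx [set i].
Proof.
apply/ffunP => S; rewrite ffunE ext_sumE; apply: eq_bigr => i _.
by rewrite ext_scaleE ffunE mulrC.
Qed.

Lemma covector_delta i : covector (delta_mx 0 i) = dx [set i].
Proof.
rewrite covectorE (bigD1 i) //= big1 => [|j ji].
  by rewrite addr0 mxE !eqxx scale1r.
by rewrite mxE (negbTE ji) andbF scale0r.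
Qed.

Lemma dx1_wedge_anti i j :
  wedge (dx [set i]) (dx [set j]) = - wedge (dx [set j]) (dx [set i]).
Proof.
rewrite !dx_wedge !disjoints1 !inE eq_sym; case: eqVneq => [|ij]; first by rewrite oppr0.
by rewrite finset.setUC -scaleNr !wedge_sign11 (swap_sign_anti ij) ?opprK.
Qed.

Lemma dx1_wedge_sq i : wedge (dx [set i]) (dx [set i]) = 0.
Proof. by rewrite dx_wedge disjoints1 inE eqxx. Qed.

Lemma covector_wedge_anti x y :
  wedge (covector x) (covector y) = - wedge (covector y) (covector x) :> ext.
Proof.
rewrite !covectorE wedge_suml.
under eq_bigr => i _ do rewrite wedge_sumr.
rewrite exchange_big wedge_suml -sumrN; apply: eq_bigr => j _.
rewrite wedge_sumr -sumrN; apply: eq_bigr => i _.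
by rewrite !wedgeZl !wedgeZr dx1_wedge_anti !scalerN !scalerA mulrC.
Qed.

Lemma covector_wedge_sq x : wedge (covector x) (covector x) = 0 :> ext.
Proof.
have := covector_wedge_anti x x => /eqP; rewrite -addr_eq0 -mulr2n.
by rewrite -scaler_nat scaler_eq0 pnatr_eq0 => /eqP.
Qed.

(* An inductive wrapper, so that [hom k a] does not unfold to a product. *)
Variant hom (k : int) a : Prop := Hom of forall S, #|S|%:Z != k -> a S = 0.

Lemma homE (k : int) a S : hom k a -> #|S|%:Z != k -> a S = 0.
Proof. by case=> /(_ S). Qed.

Lemma homogeneousP (k : nat) a : homogeneous k a <-> hom k%:Z a.
Proof. by split=> [h|[h]]; first constructor; move=> S hS; apply: h. Qed.

Lemma hom0 k : hom k 0. Proof. by constructor=> S _; rewrite ffunE. Qed.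

Lemma hom_lin (k : int) x a b : hom k a -> hom k b -> hom k (x *: a + b).
Proof.
by move=> [ha] [hb]; constructor=> S hS; rewrite ext_addE ext_scaleE ha ?hb // mulr0 addr0.
Qed.

Lemma hom_sum (k : int) (I : Type) (r : seq I) (P : pred I) (F : I -> ext) :
  (forall u : I, P u -> hom k (F u)) -> hom k (\sum_(u <- r | P u) F u).
Proof.
by move=> hF; constructor=> S hS; rewrite ext_sumE big1 // => u /hF/homE ->.
Qed.

Lemma hom_dx S : hom #|S|%:Z (dx S).
Proof. by constructor=> T; rewrite ffunE; case: (eqVneq T S) => // ->; rewrite eqxx. Qed.

Lemma hom_wedge (k l : int) a b : hom k a -> hom l b -> hom (k + l) (wedge a b).
Proof.
move=> [ha] [hb]; constructor=> S hS; rewrite ffunE big1 // => T TS.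
have [Tk|Tk] := eqVneq (#|T|%:Z) k; last by rewrite ha // mulr0 mul0r.
rewrite (hb (S :\: T)) ?mulr0 //; apply: contraNneq hS => <-.
by rewrite -Tk -PoszD -(cardsID T S) (finset.setIidPr TS) addnC.
Qed.

Lemma hom_covector x : hom 1 (covector x).
Proof.
rewrite covectorE; apply: hom_sum => i _.
have hi : hom 1 (dx [set i]) by have := hom_dx [set i]; rewrite cards1.
by have := hom_lin (x 0 i) hi (hom0 _); rewrite addr0.
Qed.

Lemma hom_out (k : int) a : (k < 0) || (m%:Z < k) -> hom k a -> a = 0.
Proof.
move=> hk [ha]; apply/ffunP => S; rewrite ffunE ha //.
by have := max_card S; rewrite card_ord; lia.
Qed.

(** The interior product with the i-th coordinate vector: the sign is chosen so that dx_i /\ dx_S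
    goes to dx_S when i is not in S. *)
Definition ctr i a : ext :=
  [ffun S : {set 'I_m} => if i \in S then 0 else wedge_sign R [set i] S * a (i |: S)].

Lemma ctrE i a S :
  ctr i a S = if i \in S then 0 else wedge_sign R [set i] S * a (i |: S).
Proof. by rewrite ffunE. Qed.

Lemma ctr_is_linear i : linear (ctr i).
Proof.
move=> x a b; apply/ffunP => S; rewrite ext_addE ext_scaleE !ctrE.
case: ifP => _; first by rewrite mulr0 addr0.
by rewrite ext_addE ext_scaleE; ring.
Qed.
HB.instance Definition _ i :=
  GRing.isLinear.Build R ext ext *:%R (ctr i) (ctr_is_linear i).

Lemma dx1_wedgeE i a S : wedge (dx [set i]) a S =
  if i \in S then wedge_sign R [set i] (S :\ i) * a (S :\ i) else 0.
Proof.
rewrite ffunE; case: ifP => iS; last first.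
  rewrite big1 // => T TS; rewrite ffunE; case: eqP => [Ti|]; last by rewrite mulr0 mul0r.
  by move: TS; rewrite Ti finset.sub1set iS.
rewrite (bigD1 [set i]%SET) ?finset.sub1set //= big1 => [|T /andP[_ /negbTE Ti]].
  by rewrite addr0 ffunE eqxx mulr1.
by rewrite ffunE Ti mulr0 mul0r.
Qed.

Lemma wedge_sign1U i j S : j \notin S ->
  wedge_sign R [set i] (j |: S) = swap_sign i j * wedge_sign R [set i] S.
Proof. by move=> jS; rewrite wedge_signUr ?disjoints1 // wedge_sign11. Qed.

(** The canonical anticommutation relation, from which the later commutation formulas for
    contractions are derived without further sign computations. *)
Lemma ctr_dx1_wedge i j a :
  ctr i (wedge (dx [set j]) a) + wedge (dx [set j]) (ctr i a) = (i == j)%:R *: a.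
Proof.
apply/ffunP => S; rewrite ext_addE ext_scaleE dx1_wedgeE !ctrE.
case: (eqVneq i j) => [<-|ij].
  rewrite mul1r dx1_wedgeE; case: ifP => iS.
    by rewrite finset.setD11 finset.setD1K // mulrA wedge_sign_sq mul1r add0r.
  by rewrite finset.setU11 finset.setU1K ?iS // mulrA wedge_sign_sq mul1r addr0.
rewrite mul0r dx1_wedgeE !inE [j == i]eq_sym (negbTE ij) /=.
case: (boolP (i \in S)) => iS; case: (boolP (j \in S)) => jS;
  rewrite ?mulr0 ?addr0 //.
have -> : (i |: S) :\ j = i |: (S :\ j).
  by apply/setP => l; rewrite !inE; case: (eqVneq l i) => // ->; rewrite ij.
rewrite wedge_sign1U; last by rewrite !inE (negbTE iS) andbF.
rewrite -{1}(finset.setD1K jS) wedge_sign1U; last by rewrite !inE eqxx.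
rewrite (swap_sign_anti ij).
have := swap_sign_sq j i; set s := swap_sign _ _ => E.
rewrite !mulrA; apply/eqP; rewrite addr_eq0 -!mulNr; apply/eqP; congr (_ * _).
by rewrite -[RHS]mul1r -E; ring.
Qed.

Lemma ctr_anti i j a : ctr i (ctr j a) = - ctr j (ctr i a).
Proof.
apply/ffunP => S; rewrite [RHS]ffunE !ctrE !inE [j == i]eq_sym.
case: (eqVneq i j) => [<-|ij] /=.
  by rewrite !mulr0 !if_same oppr0.
case: (boolP (i \in S)) => iS; case: (boolP (j \in S)) => jS;
  rewrite ?mulr0 ?oppr0 //= !wedge_sign1U // finset.setUCA (swap_sign_anti ij).
ring.
Qed.

Lemma hom_ctr (k : int) i a : hom k a -> hom (k - 1) (ctr i a).
Proof.
move=> [ha]; constructor=> S hS; rewrite ffunE; case: ifP => // iS.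
by rewrite ha ?mulr0 // cardsU1 iS; lia.
Qed.

(** The number operator: each index i in S reproduces dx_S once, so dx_S is counted |S| times. *)
Lemma sum_dx1_ctr (k : int) a : hom k a ->
  \sum_i wedge (dx [set i]) (ctr i a) = k%:~R *: a.
Proof.
move=> [ha]; apply/ffunP => S; rewrite ext_sumE ext_scaleE.
transitivity (\sum_i (i \in S)%:R * a S).
  apply: eq_bigr => i _; rewrite dx1_wedgeE; case: ifP => iS; last by rewrite mul0r.
  by rewrite ctrE finset.setD11 finset.setD1K // mulrA wedge_sign_sq.
rewrite -mulr_suml -natr_sum (_ : (\sum_i (i \in S))%N = #|S|); last first.
  by rewrite -sum1_card [RHS]big_mkcond; apply: eq_bigr => i _; case: (i \in S).
by have [<-|/ha ->] := eqVneq (#|S|%:Z) k; last by rewrite !mulr0.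
Qed.

End ExteriorAlgebra.

(** * Contraction with the inverse of a two-form *)

Section Contraction.
Variables (R : realType) (m : nat).
Local Notation ext := (ext R m).
Implicit Types (w a b c : ext) (S T U : {set 'I_m}) (i j : 'I_m) (k : int).

(** The Gram matrix w(e_i, e_j). Written with two contractions, its antisymmetry and its smooth
    dependence on w are inherited from [ctr]. *)
Definition form_mx w : 'M[R]_m :=
  \matrix_(i, j) ctr j (ctr i w) finset.set0.

Lemma form_mxE w i j :
  form_mx w i j = (i != j)%:R * (swap_sign R i j * w [set i; j]%SET).
Proof.
rewrite mxE !ctrE !inE /= finset.setU0 orbF.
rewrite wedge_signE big_set1 big_set0 mul1r.
case: (eqVneq i j) => [->|ij]; first by rewrite !mul0r.
by rewrite !mul1r wedge_sign11.
Qed.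

Lemma form_mx_anti w i j : form_mx w i j = - form_mx w j i.
Proof. by rewrite !mxE ctr_anti ffunE. Qed.

Lemma eval2E w (u v : 'rV[R]_m) : eval2 w u v = (u *m form_mx w *m v^T) 0 0.
Proof.
rewrite !mxE; under [RHS]eq_bigr => j _ do rewrite !mxE mulr_suml.
rewrite exchange_big /= /eval2.
have E i : \sum_j u 0 i * form_mx w i j * v 0 j =
   \sum_(j < m | (i < j)%N) w [set i; j]%SET * (u 0 i * v 0 j) +
   \sum_(j < m | (j < i)%N) - (w [set i; j]%SET * (u 0 i * v 0 j)).
  rewrite (bigID (fun j : 'I_m => (i < j)%N)) /=; congr (_ + _).
    apply: eq_bigr => j ij; rewrite form_mxE /swap_sign.
    by rewrite (ltnNge j i) ltnW //= -val_eqE neq_ltn ij /=; ring.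
  rewrite [LHS]big_mkcond [RHS]big_mkcond; apply: eq_bigr => j _.
  rewrite form_mxE /swap_sign -val_eqE -leqNgt.
  by case: ltngtP => //= _; ring.
under [RHS]eq_bigr => i _ do rewrite E.
rewrite big_split /= [X in _ = _ + X](exchange_big_dep xpredT) //= -big_split /=.
apply: eq_bigr => i _; rewrite -big_split; apply: eq_bigr => j _ /=.
by rewrite [[set j; i]%SET]finset.setUC; ring.
Qed.

Lemma form_mx_unit w :
  (forall u : 'rV[R]_m, (forall v, eval2 w u v = 0) -> u = 0) ->
  form_mx w \in unitmx.
Proof.
move=> nd; rewrite -row_free_unit; apply: inj_row_free => u uW.
by apply: nd => v; rewrite eval2E uW mul0mx mxE.
Qed.

Lemma hom_0E a : hom 0 a -> a = a finset.set0 *: ext1 R m.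
Proof.
move=> ha; apply/ffunP => S; rewrite ext_scaleE ffunE.
case: eqVneq => [->|S0]; first by rewrite mulr1.
by rewrite mulr0 (homE ha) // eqz_nat cards_eq0.
Qed.

Lemma hom_1E a : hom 1 a ->
  a = \sum_j ctr j a finset.set0 *: dx R [set j]%SET.
Proof.
move=> ha; rewrite -[LHS]scale1r -[1]/(1%:~R) -(sum_dx1_ctr ha).
apply: eq_bigr => j _; rewrite {1}[ctr j a]hom_0E; last first.
  by have := hom_ctr j ha; rewrite subrr.
by rewrite wedgeZr wedge1r.
Qed.

Definition form_row w i : ext := \sum_j form_mx w i j *: dx R [set j]%SET.

Lemma form_rowE w i : hom 2 w -> ctr i w = form_row w i.
Proof.
move=> hw; rewrite [LHS]hom_1E; last exact: (hom_ctr i hw).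
by apply: eq_bigr => j _; rewrite mxE.
Qed.

(** The number operator identity in degree 2, with [form_row w i] the one-form w(e_i, _). It reduces
    statements about w to products of two one-forms. *)
Lemma two_formE w : hom 2 w ->
  w = 2^-1 *: \sum_i wedge (dx R [set i]%SET) (form_row w i).
Proof.
move=> hw; under eq_bigr => i _ do rewrite -form_rowE //.
by rewrite (sum_dx1_ctr hw) scalerA mulVf ?scale1r // pnatr_eq0.
Qed.

Lemma dx1_wedgeCA i j a :
  wedge (dx R [set i]%SET) (wedge (dx R [set j]%SET) a) =
  - wedge (dx R [set j]%SET) (wedge (dx R [set i]%SET) a).
Proof. by rewrite !wedgeA dx1_wedge_anti wedgeNl. Qed.

Lemma ctr_wedge_row w i l a :
  ctr l (wedge (form_row w i) a) =
  form_mx w i l *: a - wedge (form_row w i) (ctr l a).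
Proof.
rewrite /form_row !wedge_suml linear_sum /=.
have -> : form_mx w i l *: a = \sum_j (form_mx w i j * (l == j)%:R) *: a.
  rewrite -scaler_suml (bigD1 l) //= eqxx mulr1 big1 ?addr0 // => j jl.
  by rewrite eq_sym (negbTE jl) mulr0.
rewrite -sumrB; apply: eq_bigr => j _.
rewrite !wedgeZl linearZ /= -scalerA -(ctr_dx1_wedge l j a) -scalerBr.
by rewrite addrK.
Qed.

Lemma ctr_wedge_two w i a : hom 2 w ->
  ctr i (wedge w a) = wedge w (ctr i a) + wedge (form_row w i) a.
Proof.
move=> hw; have Ew := two_formE hw; set s := \sum_i _ in Ew.
transitivity (wedge (2^-1 *: s) (ctr i a) + wedge (form_row w i) a); last by rewrite -Ew.
transitivity (ctr i (wedge (2^-1 *: s) a)); first by rewrite -Ew.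
rewrite {Ew}/s !wedgeZl [in LHS]wedge_suml linearZZ linear_sum /=.
rewrite [X in _ = _ *: X + _]wedge_suml.
suff E : \sum_j ctr i (wedge (wedge (dx R [set j]%SET) (form_row w j)) a) =
  \sum_j wedge (wedge (dx R [set j]%SET) (form_row w j)) (ctr i a) +
  2%:R *: wedge (form_row w i) a.
  by rewrite E scalerDr scalerA mulVf ?scale1r // pnatr_eq0.
rewrite -[2%:R]/(1 + 1) scalerDl scale1r.
(* The term (form_row w i) /\ a has to arise twice: from contracting the factor dx_j ([E1]), and
   from contracting [form_row w j], by antisymmetry of the matrix ([E2]). *)
have E1 : wedge (form_row w i) a =
    \sum_j (i == j)%:R *: wedge (form_row w j) a.
  rewrite (bigD1 i) //= eqxx scale1r big1 ?addr0 // => j ji.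
  by rewrite eq_sym (negbTE ji) scale0r.
have E2 : wedge (form_row w i) a =
    - \sum_j form_mx w j i *: wedge (dx R [set j]%SET) a.
  rewrite /form_row wedge_suml -sumrN; apply: eq_bigr => j _.
  by rewrite wedgeZl form_mx_anti scaleNr.
rewrite {1}E1 E2 -sumrN addrA -!big_split /=; apply: eq_bigr => j _.
rewrite -!wedgeA (canRL (addrK _) (ctr_dx1_wedge i j (wedge (form_row w j) a))).
rewrite ctr_wedge_row wedgeDr wedgeNr wedgeZr opprD opprK.
by rewrite [- _ + _]addrC addrA [X in X - _]addrC.
Qed.

(** Contraction with the bivector of matrix q. For q the inverse of [form_mx w] it is the dual
    Lefschetz operator. *)
Definition cowedge (q : 'M[R]_m) a : ext :=
  2^-1 *: \sum_i \sum_j q i j *: ctr i (ctr j a).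

Lemma cowedge_is_linear q : linear (cowedge q).
Proof.
move=> x a b; rewrite /cowedge [x *: (_ *: _)]scalerA [x * _]mulrC -[X in _ = X + _]scalerA.
rewrite -scalerDr; congr (_ *: _).
rewrite scaler_sumr -big_split; apply: eq_bigr => i _ /=.
rewrite scaler_sumr -big_split; apply: eq_bigr => j _ /=.
by rewrite (linearP (ctr j)) (linearP (ctr i)) scalerDr !scalerA [x * _]mulrC.
Qed.
HB.instance Definition _ q :=
  GRing.isLinear.Build R ext ext *:%R (cowedge q) (cowedge_is_linear q).

Lemma hom_cowedge q k a : hom k a -> hom (k - 2) (cowedge q a).
Proof.
move=> ha; rewrite -[X in hom _ X]addr0; apply: hom_lin (hom0 _ _ _).
apply: hom_sum => i _; apply: hom_sum => j _.
rewrite -[X in hom _ X]addr0; apply: hom_lin (hom0 _ _ _).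
by have := hom_ctr i (hom_ctr j ha); rewrite -addrA.
Qed.

(** Carrying ctr_i ctr_j past w leaves three cross terms. Since q inverts the matrix of w, they sum
    to -k ([EA]), m ([EB]) and -k ([EC]) times a, and half of m - 2k is m/2 - k. *)
Lemma cowedge_wedge w k a : hom 2 w -> form_mx w \in unitmx -> hom k a ->
  cowedge (invmx (form_mx w)) (wedge w a) =
  wedge w (cowedge (invmx (form_mx w)) a) + (m%:R / 2 - k%:~R) *: a.
Proof.
move=> hw wu ha; set q := invmx _.
have rowl i : \sum_j q i j *: form_row w j = dx R [set i]%SET.
  have E j : q i j *: form_row w j =
      \sum_l (q i j * form_mx w j l) *: dx R [set l]%SET.
    by rewrite scaler_sumr; apply: eq_bigr => l _; rewrite scalerA.
  under eq_bigr => j _ do rewrite E.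
  rewrite exchange_big [LHS](bigD1 i) //= [X in _ + X]big1 => [|l li].
    rewrite -scaler_suml; have /matrixP/(_ i i) := mulVmx wu.
    by rewrite !mxE eqxx => ->; rewrite scale1r addr0.
  rewrite -scaler_suml; have /matrixP/(_ i l) := mulVmx wu.
  by rewrite !mxE eq_sym (negbTE li) => ->; rewrite scale0r.
have rowr j : \sum_i q i j *: form_row w i = - dx R [set j]%SET.
  have E i : q i j *: form_row w i =
      - \sum_l (form_mx w l i * q i j) *: dx R [set l]%SET.
    rewrite scaler_sumr -sumrN; apply: eq_bigr => l _.
    by rewrite scalerA form_mx_anti mulrN mulrC scaleNr.
  under eq_bigr => i _ do rewrite E.
  rewrite sumrN exchange_big; congr (- _); rewrite [LHS](bigD1 j) //= [X in _ + X]big1 => [|l lj].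
    rewrite -scaler_suml; have /matrixP/(_ j j) := mulmxV wu.
    by rewrite !mxE eqxx => ->; rewrite scale1r addr0.
  rewrite -scaler_suml; have /matrixP/(_ l j) := mulmxV wu.
  by rewrite !mxE (negbTE lj) => ->; rewrite scale0r.
have EA : \sum_i \sum_j q i j *: wedge (form_row w i) (ctr j a) = - (k%:~R *: a).
  rewrite exchange_big -(sum_dx1_ctr ha) -sumrN; apply: eq_bigr => j _ /=.
  rewrite -wedgeNl -rowr wedge_suml; apply: eq_bigr => i _.
  by rewrite wedgeZl.
have EC : \sum_i \sum_j q i j *: wedge (form_row w j) (ctr i a) = k%:~R *: a.
  rewrite -(sum_dx1_ctr ha); apply: eq_bigr => i _ /=.
  by rewrite -rowl wedge_suml; apply: eq_bigr => j _; rewrite wedgeZl.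
have EB : \sum_i \sum_j (q i j * form_mx w j i) *: a = m%:R *: a.
  rewrite -[m in m%:R]card_ord -sumr_const scaler_suml; apply: eq_bigr => i _.
  have /matrixP/(_ i i) := mulVmx wu.
  by rewrite -scaler_suml !mxE eqxx => ->.
rewrite /cowedge wedgeZr wedge_sumr.
have -> : (m%:R / 2 - k%:~R) *: a =
    2^-1 *: (- (k%:~R *: a) + m%:R *: a - k%:~R *: a).
  by rewrite -!scaleNr -!scalerDl scalerA; congr (_ *: _); field.
rewrite -scalerDr -{1}EA -EB -EC; congr (_ *: _).
rewrite -sumrN -!big_split /=; apply: eq_bigr => i _.
rewrite wedge_sumr -sumrN -!big_split /=; apply: eq_bigr => j _.
rewrite (ctr_wedge_two j a hw) (linearD (ctr i)) /= (ctr_wedge_two i (ctr j a) hw) /=.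
by rewrite ctr_wedge_row wedgeZr !scalerDr scalerN scalerA !addrA.
Qed.

End Contraction.

(** * The Lefschetz decomposition at a point *)

Section PointwiseLefschetz.
Variables (R : realType) (n : nat).
Local Notation ext := (ext R (2 * n)).
Implicit Types (w a b c : ext) (k : int).

Definition symplectic_form w := hom 2 w /\ form_mx w \in unitmx.

HB.instance Definition _ w :=
  GRing.isLinear.Build R ext ext *:%R (Lef w) (wedge_is_linear w).

Lemma hom_Lef w k a : hom 2 w -> hom k a -> hom (k + 2) (Lef w a).
Proof. by move=> hw ha; rewrite addrC; apply: hom_wedge. Qed.

Lemma hom_out2 k a : (k < 0) || (n%:Z *+ 2 < k) -> hom k a -> a = 0.
Proof. by move=> hk; apply: hom_out; lia. Qed.

Variables (w : ext) (hw : symplectic_form w).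

Let Lam := cowedge (invmx (form_mx w)).

Lemma comm_cowedge_Lef k a : hom k a ->
  Lam (Lef w a) = Lef w (Lam a) + (n%:Z - k)%:~R *: a.
Proof.
move=> ha; rewrite /Lam /Lef (cowedge_wedge hw.1 hw.2 ha); congr (_ + _ *: _).
by rewrite intrB natrM mulrC mulKf // pnatr_eq0.
Qed.

Let homLef k a : hom k a -> hom (k + 2) (Lef w a).
Proof. exact: hom_Lef hw.1. Qed.

Lemma hom_iter_Lef m k a : hom k a -> hom (k + m%:Z *+ 2) (iter m (Lef w) a).
Proof. exact: (hom_iter_L homLef). Qed.

Lemma iter_Lef_inj m k a : k + m%:Z <= n%:Z -> hom k a ->
  iter m (Lef w) a = 0 -> a = 0.
Proof.
exact: (iter_L_inj homLef (@hom_cowedge _ _ _) hom_out2 comm_cowedge_Lef).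
Qed.

Lemma iter_Lef_surj m k a : n%:Z + m%:Z <= k -> hom k a ->
  exists2 c, hom (k - m%:Z *+ 2) c & a = iter m (Lef w) c.
Proof.
exact: (iter_L_surj (@hom0 _ _) (@hom_lin _ _) homLef (@hom_cowedge _ _ _)
  hom_out2 comm_cowedge_Lef).
Qed.

Lemma primitiveP (s : nat) b : (s <= n)%N ->
  primitive w s b <-> hom s%:Z b /\ iter (n.+1 - s) (Lef w) b = 0.
Proof. by move=> sn; rewrite /primitive /mkset sn homogeneousP. Qed.

Lemma primitive_hom (s : nat) b : primitive w s b -> hom s%:Z b.
Proof.
rewrite /primitive /mkset; case: ifP => _; last by move=> ->; apply: hom0.
by rewrite homogeneousP => -[].
Qed.

Lemma primitive0 s : primitive w s 0.
Proof.
rewrite /primitive /mkset; case: ifP => // _; rewrite homogeneousP.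
by split; [apply: hom0|rewrite iter_linear0].
Qed.

Lemma primitive_lin s x a b :
  primitive w s a -> primitive w s b -> primitive w s (x *: a + b).
Proof.
rewrite /primitive /mkset; case: ifP => _; last by move=> -> ->; rewrite scaler0 addr0.
rewrite !homogeneousP => -[ha a0] [hb b0]; split; first exact: hom_lin.
by rewrite iter_linear a0 b0 scaler0 addr0.
Qed.

Lemma primitive_iter0 s m b : (n < m + s)%N -> primitive w s b ->
  iter m (Lef w) b = 0.
Proof.
move=> ms; rewrite /primitive /mkset; case: ifP => sn; last first.
  by move=> ->; rewrite iter_linear0.
by move=> [_]; apply: iter_linear_le; lia.
Qed.

Lemma primitive_inj s m b : (m + s <= n)%N -> primitive w s b ->
  iter m (Lef w) b = 0 -> b = 0.
Proof. by move=> ms /primitive_hom hb; apply: iter_Lef_inj hb; lia. Qed.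

Lemma decomposition_lin x a B a' B' :
  lefschetz_decomposition w a B -> lefschetz_decomposition w a' B' ->
  lefschetz_decomposition w (x *: a + a') (x *: B + B').
Proof.
move=> [PB ZB ->] [PB' ZB' ->]; split=> [r s|r s rs|].
- by rewrite !ffunE; apply: primitive_lin.
- by rewrite !ffunE ZB // ZB' // scaler0 addr0.
- rewrite scaler_sumr -big_split; apply: eq_bigr => r _ /=.
  rewrite scaler_sumr -big_split; apply: eq_bigr => s _ /=.
  by rewrite !ffunE iter_linear.
Qed.

Lemma decomposition0 : lefschetz_decomposition w 0 0.
Proof.
split=> [r s|r s _|]; rewrite ?ffunE //; first exact: primitive0.
rewrite big1 // => r _; rewrite big1 // => s _.
by rewrite ffunE iter_linear0.
Qed.

(* Applying [L^(n-s-r)] kills the terms of the same degree with a larger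
   primitive degree, while those with a smaller one vanish by induction. *)
Lemma decomposition0_unique B : lefschetz_decomposition w 0 B -> B = 0.
Proof.
move=> [PB ZB E0]; apply/ffunP => -[r s]; rewrite ffunE.
have [N] := ubnP s; elim: N r s => // N IHN r s sN.
have [rs|rs] := ltnP n (r + s); first exact: ZB.
apply: (@primitive_inj s (n - s)); [lia|exact: PB|].
(* The degree of L^(n-s) B_s. Elements mix degrees, so the equation is compared on index sets of
   cardinality [k] only. *)
set k : int := (s + (n - s).*2)%N.
apply/ffunP => S; rewrite ffunE.
have [Sk|Sk] := eqVneq (#|S|%:Z) k; last first.
  apply: (homE _ Sk); have := hom_iter_Lef (n - s) (primitive_hom (PB r s)).
  by congr hom; rewrite /k; lia.
move/(congr1 (fun a => iter (n - s - r) (Lef w) a S)): E0.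
rewrite iter_linear0 iter_linear_sum ffunE ext_sumE (bigD1 r) //=.
rewrite iter_linear_sum ext_sumE (bigD1 s) //=.
rewrite big1 => [|s' /andP[rs' s's]]; last first.
  apply: (homE (hom_iter_Lef _ (hom_iter_Lef _ (primitive_hom (PB _ _))))).
  by rewrite Sk /k; move: s's; rewrite -val_eqE /=; lia.
rewrite big1 => [|r' r'r]; last first.
  rewrite iter_linear_sum ext_sumE big1 // => s' rs'.
  have [E|E] := eqVneq (s' + r'.*2)%N (s + r.*2)%N; last first.
    apply: (homE (hom_iter_Lef _ (hom_iter_Lef _ (primitive_hom (PB _ _))))).
    by rewrite Sk /k; lia.
  have [ss|ss] := ltnP s' s.
    by rewrite IHN ?iter_linear0 ?ffunE //; lia.
  rewrite -iterD (@primitive_iter0 s') ?ffunE //.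
  by move: r'r; rewrite -val_eqE /=; lia.
by rewrite !addr0 -iterD subnK; [move/esym|lia].
Qed.

Lemma decomposition_unique a B B' : lefschetz_decomposition w a B ->
  lefschetz_decomposition w a B' -> B = B'.
Proof.
move=> h h'; apply/eqP; rewrite -subr_eq0; apply/eqP.
apply: decomposition0_unique; rewrite addrC -scaleN1r.
by rewrite -[0](addNr a) -(scaleN1r a); apply: decomposition_lin.
Qed.

Lemma lefschetzE a B : lefschetz_decomposition w a B -> lefschetz w a = B.
Proof.
by move=> h; apply: xget_unique => // B' h'; apply: decomposition_unique h' h.
Qed.

Lemma decomposition_single (r s : 'I_n.+1) b : (r + s <= n)%N ->
  primitive w s b -> lefschetz_decomposition w (iter r (Lef w) b)
    [ffun rs => if rs == (r, s) then b else 0].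
Proof.
move=> rs Pb; split=> [r' s'|r' s' rs'|].
- by rewrite ffunE; case: eqP => [[_ ->]|_] //; apply: primitive0.
- by rewrite ffunE; case: eqP => // -[rr ss]; move: rs'; rewrite rr ss; lia.
- rewrite (bigD1 r) //= (bigD1 s) //= ffunE eqxx.
  rewrite big1 ?addr0 => [|s' /andP[_ s's]]; last first.
    by rewrite ffunE xpair_eqE (negbTE s's) andbF iter_linear0.
  rewrite big1 ?addr0 // => r' r'r; rewrite big1 // => s' _.
  by rewrite ffunE xpair_eqE (negbTE r'r) iter_linear0.
Qed.

(** The induction principle behind the identities for projection and reflection: an additive
    property needs checking only on single terms L^r b with b primitive, where both operators are
    explicit. *)
Lemma hom_ind k (P : ext -> Prop) : P 0 -> (forall a b, P a -> P b -> P (a + b)) ->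
  (forall (r s : 'I_n.+1) b, primitive w s b -> (r + s <= n)%N ->
     k = s%:Z + r%:Z *+ 2 -> P (iter r (Lef w) b)) ->
  forall a, hom k a -> P a.
Proof.
move=> P0 PD PL a ha.
have [B [hB PB ZB ->]] := lefschetz_exists (@hom0 _ _) (@hom_lin _ _) homLef
  (@hom_cowedge _ _ _) hom_out2 comm_cowedge_Lef ha.
apply: (big_ind P) => // r _.
have [h|h] := boolP ((k - r%:Z *+ 2 < 0) || (n%:Z < k - r%:Z)).
  by rewrite ZB // iter_linear0.
have s_lt : (absz (k - r%:Z *+ 2)%R < n.+1)%N by lia.
apply: (PL r (Ordinal s_lt)) => /=; [|lia|lia].
apply/primitiveP => /=; first by lia.
split; first by move: (hB r); congr hom; lia.
by rewrite -[RHS](PB r); congr (iter _ (Lef w)); lia.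
Qed.

Lemma decomposition_exists a : exists B, lefschetz_decomposition w a B.
Proof.
have dD a1 a2 : (exists B, lefschetz_decomposition w a1 B) ->
    (exists B, lefschetz_decomposition w a2 B) ->
    exists B, lefschetz_decomposition w (a1 + a2) B.
  move=> [B1 h1] [B2 h2]; exists (1%:R *: B1 + B2).
  by rewrite -[a1]scale1r; apply: decomposition_lin.
have d0 : exists B, lefschetz_decomposition w 0 B.
  by exists 0; apply: decomposition0.
have aE : a = \sum_S a S *: dx R S by exact: ext_dxE.
rewrite aE; apply: (big_ind (fun a => exists B, lefschetz_decomposition w a B)) => //.
move=> S _; have hS : hom #|S|%:Z (a S *: dx R S).
  by rewrite -[X in hom _ X]addr0; apply: hom_lin (hom0 _ _ _); apply: hom_dx.
apply: (hom_ind d0 dD _ hS) => r s b Pb rs _.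
by exists [ffun rs => if rs == (r, s) then b else 0]; apply: decomposition_single.
Qed.

Lemma lefschetzP a : lefschetz_decomposition w a (lefschetz w a).
Proof. by have [B h] := decomposition_exists a; rewrite (lefschetzE h). Qed.

Lemma lefschetz_is_linear : linear (lefschetz w).
Proof.
move=> x a b; apply: lefschetzE.
by apply: decomposition_lin; apply: lefschetzP.
Qed.

Lemma lefschetz_single (r s : 'I_n.+1) b : (r + s <= n)%N -> primitive w s b ->
  lefschetz w (iter r (Lef w) b) = [ffun rs => if rs == (r, s) then b else 0].
Proof. by move=> rs Pb; apply: lefschetzE; apply: decomposition_single. Qed.

End PointwiseLefschetz.

(** * Projection, reflection and the primitive splitting at a point *)

Section ProjectionReflection.
Variables (R : realType) (n : nat).
Local Notation ext := (ext R (2 * n)).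
Implicit Types (a b c : ext) (k : int).
Variables (w : ext) (hw : symplectic_form w).

Lemma lefschetz_entry_linear (r s : 'I_n.+1) x a b :
  lefschetz w (x *: a + b) (r, s) = x *: lefschetz w a (r, s) + lefschetz w b (r, s).
Proof. by rewrite (lefschetz_is_linear hw) !ffunE. Qed.

Lemma projection_is_linear p : linear (projection w p).
Proof.
move=> x a b; rewrite /projection scaler_sumr -big_split; apply: eq_bigr => r _ /=.
rewrite scaler_sumr -big_split; apply: eq_bigr => s _ /=.
by rewrite lefschetz_entry_linear iter_linear.
Qed.

Lemma reflection_is_linear : linear (reflection w).
Proof.
move=> x a b; rewrite /reflection scaler_sumr -big_split; apply: eq_bigr => r _ /=.
rewrite scaler_sumr -big_split; apply: eq_bigr => s _ /=.
by rewrite lefschetz_entry_linear iter_linear.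
Qed.

Lemma projectionB p a b : projection w p (a - b) = projection w p a - projection w p b.
Proof.
by rewrite addrC -scaleN1r projection_is_linear scaleN1r addrC.
Qed.

Lemma projectionD p a b : projection w p (a + b) = projection w p a + projection w p b.
Proof. by rewrite -[a]scale1r projection_is_linear !scale1r. Qed.

Lemma projection0 p : projection w p 0 = 0.
Proof. by apply: (addrI (projection w p 0)); rewrite -projectionD !addr0. Qed.

Lemma projectionZ p x a : projection w p (x *: a) = x *: projection w p a.
Proof. by rewrite -[x *: a]addr0 projection_is_linear projection0 addr0. Qed.

Lemma reflectionD a b : reflection w (a + b) = reflection w a + reflection w b.
Proof. by rewrite -[a]scale1r reflection_is_linear !scale1r. Qed.

Lemma reflection0 : reflection w 0 = 0.
Proof. by apply: (addrI (reflection w 0)); rewrite -reflectionD !addr0. Qed.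

Lemma reflectionZ x a : reflection w (x *: a) = x *: reflection w a.
Proof. by rewrite -[x *: a]addr0 reflection_is_linear reflection0 addr0. Qed.

Lemma projection_single p (r s : 'I_n.+1) b : (r + s <= n)%N -> primitive w s b ->
  projection w p (iter r (Lef w) b) = if (r <= p)%N then iter r (Lef w) b else 0.
Proof.
move=> rs Pb; rewrite /projection (lefschetz_single hw rs Pb).
have Z (r' s' : 'I_n.+1) : (r', s') != (r, s) ->
   iter r' (Lef w) ([ffun rs => if rs == (r, s) then b else 0] (r', s')) = 0.
  by move=> /negbTE h; rewrite ffunE h iter_linear0.
case: ifP => rp.
  rewrite (bigD1 r) //= (bigD1 s) //= ffunE eqxx.
  rewrite big1 ?addr0 => [|s' /andP[_ s's]]; last first.
    by rewrite Z // xpair_eqE (negbTE s's) andbF.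
  rewrite big1 ?addr0 // => r' /andP[_ r'r]; rewrite big1 // => s' _.
  by rewrite Z // xpair_eqE (negbTE r'r).
rewrite big1 // => r' r'p; rewrite big1 // => s' _; rewrite Z //.
by rewrite xpair_eqE; apply: contraFN rp => /andP[/eqP <-].
Qed.

Lemma reflection_single (r s : 'I_n.+1) b : (r + s <= n)%N -> primitive w s b ->
  reflection w (iter r (Lef w) b) = iter (n - r - s) (Lef w) b.
Proof.
move=> rs Pb; rewrite /reflection (lefschetz_single hw rs Pb).
rewrite (bigD1 r) //= (bigD1 s) //= ffunE eqxx.
rewrite big1 ?addr0 => [|s' /andP[_ s's]]; last first.
  by rewrite ffunE xpair_eqE (negbTE s's) andbF iter_linear0.
rewrite big1 ?addr0 // => r' r'r; rewrite big1 // => s' _.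
by rewrite ffunE xpair_eqE (negbTE r'r) iter_linear0.
Qed.

Let iterL_hom := hom_iter_Lef hw.

Lemma projection_hom p k a : hom k a -> hom k (projection w p a).
Proof.
move: a; apply: (hom_ind hw) => [|a b ha hb|r s b Pb rs ->].
- by rewrite projection0; apply: hom0.
- by rewrite projectionD; apply: homD hb => //; apply: hom_lin.
- rewrite (projection_single _ rs Pb); case: ifP => _; last exact: hom0.
  exact: iterL_hom (primitive_hom Pb).
Qed.

Lemma projection_split p k a : hom k a ->
  exists2 c, hom (k - p.+1%:Z *+ 2) c & a = projection w p a + iter p.+1 (Lef w) c.
Proof.
move: a; apply: (hom_ind hw) => [|a b [c hc Ea] [c' hc' Eb]|r s b Pb rs ->].
- by exists 0; rewrite ?projection0 ?iter_linear0 ?addr0 //; apply: hom0.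
- exists (c + c'); first by apply: homD hc' => //; apply: hom_lin.
  by rewrite projectionD iter_linearD {1}Ea {1}Eb addrACA.
- rewrite (projection_single _ rs Pb); case: leqP => rp.
    by exists 0; rewrite ?iter_linear0 ?addr0 //; apply: hom0.
  exists (iter (r - p.+1) (Lef w) b); last by rewrite add0r -iterD subnKC.
  by have := iterL_hom (r - p.+1) (primitive_hom Pb); congr hom; lia.
Qed.

Lemma projection_iter_Lef p k c : hom k c ->
  projection w p (iter p.+1 (Lef w) c) = 0.
Proof.
move: c; apply: (hom_ind hw) => [|a b Ea Eb|r s b Pb rs _].
- by rewrite iter_linear0 projection0.
- by rewrite iter_linearD projectionD Ea Eb addr0.
- rewrite -iterD; have [prs|prs] := leqP (p.+1 + r + s) n; last first.
    by rewrite (primitive_iter0 prs Pb) projection0.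
  have pr_lt : (p.+1 + r < n.+1)%N by lia.
  by rewrite (projection_single p (r := Ordinal pr_lt) prs Pb) /= ifF //; lia.
Qed.

Lemma reflection_hom k a : hom k a -> hom (n%:Z *+ 2 - k) (reflection w a).
Proof.
move: a; apply: (hom_ind hw) => [|a b ha hb|r s b Pb rs ->].
- by rewrite reflection0; apply: hom0.
- by rewrite reflectionD; apply: homD hb => //; apply: hom_lin.
- rewrite (reflection_single rs Pb).
  by have := iterL_hom (n - r - s) (primitive_hom Pb); congr hom; lia.
Qed.

Lemma reflectionK k a : hom k a -> reflection w (reflection w a) = a.
Proof.
move: a; apply: (hom_ind hw) => [|a b Ea Eb|r s b Pb rs _].
- by rewrite !reflection0.
- by rewrite !reflectionD Ea Eb.
- rewrite (reflection_single rs Pb); have nrs : (n - r - s < n.+1)%N by lia.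
  rewrite (reflection_single (r := Ordinal nrs) _ Pb) /=; last by lia.
  by rewrite (_ : (n - (n - r - s) - s)%N = r) //; lia.
Qed.

(** Conjugating L^(p+1) by the reflection lowers the exponent r by p + 1 and kills the terms with r
    <= p; multiplying by L^(p+1) again restores the others. This gives the converse implication in
    [reflection_projection]. *)
Lemma reflection_complement p k a : hom k a ->
  iter p.+1 (Lef w) (reflection w (iter p.+1 (Lef w) (reflection w a))) =
  a - projection w p a.
Proof.
move: a; apply: (hom_ind hw) => [|a b Ea Eb|r s b Pb rs _].
- by rewrite !(reflection0, iter_linear0, projection0) subr0.
- rewrite reflectionD iter_linearD reflectionD iter_linearD projectionD Ea Eb.
  by rewrite opprD addrACA.
- rewrite (reflection_single rs Pb) (projection_single _ rs Pb) -iterD; case: leqP => rp.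
    rewrite (@primitive_iter0 _ _ _ s _ _ _ Pb) ?subrr; last by lia.
    by rewrite reflection0 iter_linear0.
  have lt : (p.+1 + (n - r - s) < n.+1)%N by lia.
  rewrite (reflection_single (r := Ordinal lt) _ Pb); last by rewrite /=; lia.
  by rewrite subr0 -iterD (_ : (p.+1 + (n - Ordinal lt - s))%N = r) //=; lia.
Qed.

Lemma reflection_projection p k a : hom k a ->
  projection w p a = a <-> iter p.+1 (Lef w) (reflection w a) = 0.
Proof.
move=> ha; split=> [<-|E].
  move: a ha; apply: (hom_ind hw) => [|a b Ea Eb|r s b Pb rs _].
  - by rewrite projection0 reflection0 iter_linear0.
  - by rewrite projectionD reflectionD iter_linearD Ea Eb addr0.
  - rewrite (projection_single _ rs Pb); case: leqP => rp; last first.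
      by rewrite reflection0 iter_linear0.
    by rewrite (reflection_single rs Pb) -iterD (primitive_iter0 _ Pb) //; lia.
have := reflection_complement p ha; rewrite E reflection0 iter_linear0.
by move/esym/eqP; rewrite subr_eq0 => /eqP <-.
Qed.

Lemma reflection_prim p b : (p <= n)%N -> hom (n%:Z - p%:Z) b ->
  iter p.+1 (Lef w) b = 0 -> reflection w b = iter p (Lef w) b.
Proof.
move=> pn hb Lb; have lt : (n - p < n.+1)%N by lia.
have Pb : primitive w (Ordinal lt) b.
  apply/primitiveP => /=; first by lia.
  by split; [move: hb; congr hom; lia|rewrite (_ : (_ - _)%N = p.+1) //; lia].
have := reflection_single (r := ord0) _ Pb; rewrite /= => ->; last by lia.
by rewrite (_ : (n - 0 - (n - p))%N = p) //; lia.
Qed.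

(** Integer degrees absorb the boundary case: for s = 0 the degree -1 alone forces b = 0. In
    [primitive_succP] the case s = n is absorbed likewise, the exponent n - s being 0. *)
Lemma primitive_predP (s : nat) b : (s <= n)%N ->
  primitive_pred w s b <-> hom (s%:Z - 1) b /\ iter (n.+2 - s) (Lef w) b = 0.
Proof.
case: s => [_|s sn] /=.
  split=> [->|[hb _]]; last by apply: hom_out2 hb.
  by split; [exact: hom0|rewrite iter_linear0 !linear0].
rewrite (primitiveP _ _ (ltnW sn)) subSS.
by split=> -[hb Lb]; split=> //; move: hb; congr hom; lia.
Qed.

Lemma primitive_succP (s : nat) b : (s <= n)%N ->
  primitive w s.+1 b <-> hom (s%:Z + 1) b /\ iter (n - s) (Lef w) b = 0.
Proof.
move=> sn; have [sn'|sn'] := leqP s.+1 n.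
  rewrite primitiveP // subSS.
  by split=> -[hb Lb]; split=> //; move: hb; congr hom; lia.
have -> : (n - s = 0)%N by lia.
rewrite /primitive /mkset leqNgt sn' /=.
by split=> [->|[]//]; split=> //; apply: hom0.
Qed.

(** For two splittings, L^(n-s) removes the first components, so L^(n-s+1) kills the difference of
    the second ones; in degree s - 1 that power is injective. *)
Lemma primitive_splitE (s : nat) b1 b2 : (s <= n)%N ->
  hom (s%:Z + 1) b1 -> iter (n - s) (Lef w) b1 = 0 ->
  hom (s%:Z - 1) b2 -> iter (n.+2 - s) (Lef w) b2 = 0 ->
  primitive_split w s (b1 + Lef w b2) = (b1, b2).
Proof.
move=> sn h1 L1 h2 L2; apply: xget_unique => [|[b1' b2']].
  by split=> //=; [apply/primitive_succP|apply/primitive_predP].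
move=> /= [/(primitive_succP _ sn)[h1' L1'] /(primitive_predP _ sn)[h2' L2'] E].
have E2 : b2' = b2.
  apply/eqP; rewrite -subr_eq0; apply/eqP.
  apply: (iter_Lef_inj hw (m := (n - s).+1) (k := s%:Z - 1)); first by lia.
    exact: (homB (@hom_lin _ _) h2' h2).
  rewrite iterSr linearB.
  have -> : Lef w b2' - Lef w b2 = b1 - b1'.
    by apply/eqP; rewrite subr_eq addrAC E [b1' + _]addrC addrK.
  by rewrite iter_linearB L1 L1' subrr.
by rewrite E2; congr pair; move: E; rewrite E2 => /addIr.
Qed.

End ProjectionReflection.

(** * Maps that intertwine two Lefschetz operators *)

Section Naturality.
Variables (R : realType) (n : nat).
Local Notation ext := (ext R (2 * n)).
Variables (w w' : ext) (hw : symplectic_form w) (hw' : symplectic_form w').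
Variable P : {linear ext -> ext}.
Hypothesis P_hom : forall k a, hom k a -> hom k (P a).
Hypothesis P_Lef : forall a, P (Lef w' a) = Lef w (P a).

Lemma iter_Lef_natural m a : P (iter m (Lef w') a) = iter m (Lef w) (P a).
Proof. by elim: m => //= m IH; rewrite P_Lef IH. Qed.

Lemma primitive_natural s a : primitive w' s a -> primitive w s (P a).
Proof.
rewrite /primitive /mkset; case: ifP => _; last by move=> ->; rewrite linear0.
rewrite !homogeneousP => -[/P_hom ha Ea]; split=> //.
by rewrite -iter_Lef_natural Ea linear0.
Qed.

Lemma lefschetz_natural a rs : lefschetz w (P a) rs = P (lefschetz w' a rs).
Proof.
rewrite (lefschetzE hw (B := [ffun rs => P (lefschetz w' a rs)])) ?ffunE //.
have [PB ZB E] := lefschetzP hw' a; split=> [r s|r s rs'|].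
- by rewrite ffunE; apply: primitive_natural.
- by rewrite ffunE ZB ?linear0.
- rewrite {1}E linear_sum; apply: eq_bigr => r _ /=.
  rewrite linear_sum; apply: eq_bigr => s _ /=.
  by rewrite iter_Lef_natural ffunE.
Qed.

Lemma projection_natural p a : projection w p (P a) = P (projection w' p a).
Proof.
rewrite /projection linear_sum; apply: eq_bigr => r _ /=.
rewrite linear_sum; apply: eq_bigr => s _ /=.
by rewrite iter_Lef_natural lefschetz_natural.
Qed.

Lemma reflection_natural a : reflection w (P a) = P (reflection w' a).
Proof.
rewrite /reflection linear_sum; apply: eq_bigr => r _ /=.
rewrite linear_sum; apply: eq_bigr => s _ /=.
by rewrite iter_Lef_natural lefschetz_natural.
Qed.

End Naturality.

(** * Multiplication by a covector and pullback at a point *)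

Section CovectorPullback.
Variables (R : realType) (m : nat).
Local Notation ext := (ext R m).
Implicit Types (w a b c : ext) (S T U : {set 'I_m}) (i j : 'I_m) (k : int).

Lemma ctr_covector_wedge i x a :
  ctr i (wedge (covector x) a) = x 0 i *: a - wedge (covector x) (ctr i a).
Proof.
rewrite covectorE !wedge_suml linear_sum /=.
have -> : x 0 i *: a = \sum_j (x 0 j * (i == j)%:R) *: a.
  rewrite -scaler_suml (bigD1 i) //= eqxx mulr1 big1 ?addr0 // => j ji.
  by rewrite eq_sym (negbTE ji) mulr0.
rewrite -sumrB; apply: eq_bigr => j _.
by rewrite !wedgeZl linearZ /= -scalerA -(ctr_dx1_wedge i j a) -scalerBr addrK.
Qed.

(** Contraction along a coordinate i with x_i nonzero, divided by x_i, is a contracting homotopy. *)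
Lemma covector_acyclic x k a : x != 0 -> hom k a -> wedge (covector x) a = 0 ->
  exists2 b, hom (k - 1) b & a = wedge (covector x) b.
Proof.
move=> x0 ha E; have [i xi|x_0] := pickP (fun i => x 0 i != 0); last first.
  by case/eqP: x0; apply/rowP => i; rewrite mxE; apply/eqP/negbFE/x_0.
exists ((x 0 i)^-1 *: ctr i a); first exact: homZ (@hom0 _ _) (@hom_lin _ _) _ _ _ (hom_ctr i ha).
have /esym/eqP := ctr_covector_wedge i x a.
rewrite E linear0 subr_eq0 wedgeZr => /eqP <-.
by rewrite scalerA mulVf ?scale1r.
Qed.

Lemma covector_sqA x a : wedge (covector x) (wedge (covector x) a) = 0.
Proof. by rewrite wedgeA covector_wedge_sq wedge0l. Qed.

Lemma form_row_covector w i : form_row w i = covector (row i (form_mx w)).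
Proof. by rewrite covectorE; apply: eq_bigr => j _; rewrite [row _ _ _ _]mxE. Qed.

Lemma covector_wedgeCA x y a :
  wedge (covector x) (wedge (covector y) a) =
  - wedge (covector y) (wedge (covector x) a).
Proof. by rewrite wedgeA covector_wedge_anti wedgeNl -wedgeA. Qed.

Lemma covector_two_comm w x a : hom 2 w ->
  wedge (covector x) (wedge w a) = wedge w (wedge (covector x) a).
Proof.
move=> hw; rewrite (two_formE hw) !wedgeZl wedgeZr !wedge_suml wedge_sumr.
congr (_ *: _); apply: eq_bigr => i _.
rewrite -covector_delta form_row_covector -!wedgeA.
by rewrite covector_wedgeCA (covector_wedgeCA x) wedgeNr opprK.
Qed.

Variable theta : 'I_m -> 'rV[R]_m.

Definition theta_prod (s : seq 'I_m) : ext :=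
  \big[@wedge R m/ext1 R m]_(i <- s) covector (theta i).

(** The algebra map with dx_i sent to [theta i]; with the gradients of the components of a map as
    [theta], it is the pullback. *)
Definition pull a : ext := \sum_S a S *: theta_prod (enum S).

Lemma pull_is_linear : linear pull.
Proof.
move=> x a b; rewrite /pull scaler_sumr -big_split; apply: eq_bigr => S _ /=.
by rewrite ext_addE ext_scaleE scalerDl scalerA.
Qed.
HB.instance Definition _ :=
  GRing.isLinear.Build R ext ext *:%R pull pull_is_linear.

Lemma pull_dx S : pull (dx R S) = theta_prod (enum S).
Proof.
rewrite /pull (bigD1 S) //= ffunE eqxx scale1r big1 ?addr0 // => T /negbTE TS.
by rewrite ffunE TS scale0r.
Qed.

Lemma theta_prod_hom s : hom (size s)%:Z (theta_prod s).
Proof.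
rewrite /theta_prod; elim: s => [|i s IH]; rewrite (big_nil, big_cons).
  by have := @hom_dx R m finset.set0; rewrite cards0 ext1E.
by have := hom_wedge (hom_covector (theta i)) IH; congr hom; rewrite /=; lia.
Qed.

Lemma pull_hom k a : hom k a -> hom k (pull a).
Proof.
move=> ha; apply: hom_sum => S _.
have [Sk|/(homE ha) ->] := eqVneq (#|S|%:Z) k; last by rewrite scale0r; apply: hom0.
apply: homZ => //; [exact: hom0|exact: hom_lin|].
by rewrite -Sk cardE; apply: theta_prod_hom.
Qed.

Lemma enum_setU1_min i S : (forall j, j \in S -> (i < j)%N) ->
  enum (i |: S) = i :: enum S.
Proof.
move=> iS; have i_tr : transitive (relpre (@nat_of_ord m) ltn).
  by move=> a b c /=; apply: ltn_trans.
have i_irr : irreflexive (relpre (@nat_of_ord m) ltn) by move=> a /=; apply: ltnn.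
have enum_sorted T : sorted (relpre (@nat_of_ord m) ltn) (enum T).
  rewrite /enum_mem -enumT; apply: sorted_filter => //.
  by rewrite -(sorted_map (e' := ltn)) val_enum_ord iota_ltn_sorted.
apply: (irr_sorted_eq i_tr i_irr) => //.
  rewrite /= path_min_sorted; first exact: enum_sorted.
  by apply/allP => j; rewrite mem_enum => /iS.
by move=> j; rewrite mem_enum in_cons mem_enum !inE.
Qed.

Lemma theta_prod_min i S : (forall j, j \in S -> (i < j)%N) ->
  theta_prod (enum (i |: S)) = wedge (covector (theta i)) (theta_prod (enum S)).
Proof. by move=> iS; rewrite enum_setU1_min // /theta_prod big_cons. Qed.

Lemma dx_wedge_min i S : (forall j, j \in S -> (i < j)%N) ->
  wedge (dx R [set i]%SET) (dx R S) = dx R (i |: S).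
Proof.
move=> iS; have niS : i \notin S by apply/negP => /iS; rewrite ltnn.
rewrite dx_wedge disjoints1 niS wedge_signE big_set1 big1 ?scale1r // => j /iS ij.
by rewrite /swap_sign ltnNge ltnW.
Qed.

(** Adding a new minimum puts it in front of the increasing enumeration and creates no sign, so
    induction in this order matches the definition of [pull]. *)
Lemma set_min_ind (P : {set 'I_m} -> Prop) : P finset.set0 ->
  (forall i S, (forall j, j \in S -> (i < j)%N) -> P S -> P (i |: S)) ->
  forall S, P S.
Proof.
move=> P0 PU S; have [N] := ubnP #|S|; elim: N S => // N IHN S SN.
have [->//|[i0 i0S]] := set_0Vmem S.
have [i iS imin] := arg_minnP (fun i : 'I_m => i : nat) i0S.
rewrite -(finset.setD1K iS); apply: PU => [j|].
  rewrite !inE => /andP[ji /imin]; rewrite leq_eqVlt => /orP[/eqP/val_inj E|//].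
  by rewrite E eqxx in ji.
by apply: IHN; move: SN; rewrite (cardsD1 i S) (iS : i \in S).
Qed.

(** An insertion sort: dx_i is moved past the minimum j of the set when j < i, with the same sign on
    both sides, and both sides vanish when i = j. *)
Lemma pull_dx1_dx i S : pull (wedge (dx R [set i]%SET) (dx R S)) =
  wedge (covector (theta i)) (theta_prod (enum S)).
Proof.
elim/set_min_ind: S i => [|j S jS IH] i.
  rewrite -ext1E wedge1r pull_dx enum_set0 enum_set1 /theta_prod.
  by rewrite big_cons !big_nil.
rewrite (theta_prod_min jS) -(dx_wedge_min jS).
have [ij|ji|/val_inj ->] := ltngtP (i : nat) j.
- have iS l : l \in j |: S -> (i < l)%N.
    by rewrite !inE => /orP[/eqP ->//|/jS]; apply: ltn_trans.
  by rewrite (dx_wedge_min jS) (dx_wedge_min iS) pull_dx !theta_prod_min.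
- rewrite dx1_wedgeCA linearN /= covector_wedgeCA; congr (- _).
  rewrite -IH dx_wedge disjoints1; case: ifP => iS; last first.
    by rewrite wedge0r !linear0.
  have jiS l : l \in i |: S -> (j < l)%N.
    by rewrite !inE => /orP[/eqP ->//|/jS].
  by rewrite wedgeZr !(linearZZ (pull)) /= wedgeZr (dx_wedge_min jiS) !pull_dx theta_prod_min.
- by rewrite !wedgeA covector_wedge_sq dx1_wedge_sq !wedge0l linear0.
Qed.

Lemma pull_dx1 i a : pull (wedge (dx R [set i]%SET) a) =
  wedge (covector (theta i)) (pull a).
Proof.
apply: (ext_linear_ind (f := pull \o wedge (dx R [set i]%SET))
          (g := wedge (covector (theta i)) \o pull)) => S /=.
by rewrite pull_dx1_dx pull_dx.
Qed.

Lemma pull_wedge a b : pull (wedge a b) = wedge (pull a) (pull b).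
Proof.
apply: (ext_linear_ind (f := pull \o wedger b) (g := wedger (pull b) \o pull)).
move=> S /=; rewrite /wedger.
elim/set_min_ind: S b => [|i S iS IH] b.
  by rewrite -ext1E wedge1l ext1E pull_dx enum_set0 /theta_prod big_nil wedge1l.
by rewrite -(dx_wedge_min iS) -wedgeA !pull_dx1 IH wedgeA.
Qed.

End CovectorPullback.

(** * Smooth functions *)

Local Open Scope classical_set_scope.
Local Open Scope ring_scope.

Lemma near0_differentiable (R : realType) (V W : normedModType R) (h : V -> W) x :
  (\forall z \near x, h z = 0) -> differentiable h x.
Proof.
move=> h0; have hx : h x = 0 by apply: nbhs_singleton h0.
have E : h \o shift x = cst (h x) + (\0 : V -> W) +o_ 0 id.
  apply/eqaddoP => e e0; have := h0; rewrite (near_shift 0 x) /=.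
  apply: filterS => z; rewrite /= subr0 => hz.
  by rewrite /= !fctE /= hx hz addr0 subr0 normr0 mulr_ge0 // ltW.
have d0 : continuous (\0 : V -> W) by move=> ?; apply: cst_continuous.
have Ed := diff_unique d0 E.
by apply/diff_locallyP; rewrite Ed.
Qed.

(** Locality of differentiability: g is f plus a function vanishing near x, whose differential is
    0. *)
Lemma near_differentiable (R : realType) (V W : normedModType R) (f g : V -> W) x :
  (\forall z \near x, f z = g z) -> differentiable f x -> differentiable g x.
Proof.
move=> fg df; have -> : g = f + (g - f) by rewrite addrC subrK.
apply: differentiableD => //; apply: near0_differentiable.
by apply: filterS fg => z; rewrite !fctE => ->; rewrite subrr.
Qed.

Section SmoothFunctions.
Variables (R : realType) (m : nat).
Local Notation E := 'rV[R]_m.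
Variables (U : set E) (oU : open U).
Implicit Types (f g : E -> R) (y : E) (i j : 'I_m).

Lemma near_open y (P : E -> Prop) : U y -> (forall z, U z -> P z) ->
  \forall z \near y, P z.
Proof.
by move=> Uy UP; apply: (@filterS _ (nbhs y) _ U) => //; apply: open_nbhs_nbhs.
Qed.

Lemma partial_ext i f g y : U y -> (forall z, U z -> f z = g z) ->
  partial i f y = partial i g y.
Proof. by move=> Uy fg; apply: near_eq_derive; apply: near_open fg. Qed.

Lemma class_C_ext k f g : (forall z, U z -> f z = g z) ->
  class_C k U f -> class_C k U g.
Proof.
elim: k f g => [|k IH] f g fg /=.
  move=> cf y Uy; have := cf y Uy; rewrite /prop_for /continuous_at -(fg _ Uy).
  apply: cvg_trans; apply: (@near_eq_cvg _ _ (nbhs y)).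
  by apply: (near_open Uy) => z Uz; rewrite fg.
move=> [df cf]; split=> [y Uy|i].
  by apply: near_differentiable (df y Uy); apply: near_open fg.
by apply: IH (cf i) => z Uz; apply: partial_ext.
Qed.

Lemma class_CW k f : class_C k.+1 U f -> class_C k U f.
Proof.
elim: k f => [|k IH] f [df cf] /=.
  by move=> y Uy; apply: differentiable_continuous; apply: df.
by split=> // i; apply: IH.
Qed.

Lemma class_C_cst k c : class_C k U (fun=> c).
Proof.
elim: k c => [|k IH] c /=; first by move=> y _; apply: cst_continuous.
split=> [y _|i]; first exact: differentiable_cst.
apply: class_C_ext (IH 0) => z _.
by rewrite /partial derive_cst.
Qed.

Lemma class_C_D k f g : class_C k U f -> class_C k U g ->
  class_C k U (fun y => f y + g y).
Proof.
elim: k f g => [|k IH] f g /=.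
  by move=> cf cg y Uy; apply: continuousD; [apply: cf|apply: cg].
move=> [df cf] [dg cg]; split=> [y Uy|i].
  by apply: differentiableD; [apply: df|apply: dg].
apply: class_C_ext (IH _ _ (cf i) (cg i)) => z Uz; apply/esym.
by apply: deriveD; apply: diff_derivable; [apply: df|apply: dg].
Qed.

Lemma class_C_M k f g : class_C k U f -> class_C k U g ->
  class_C k U (fun y => f y * g y).
Proof.
elim: k f g => [|k IH] f g /=.
  by move=> cf cg y Uy; apply: continuousM; [apply: cf|apply: cg].
move=> hf hg; have := hf; have := hg => -[dg cg] [df cf]; split=> [y Uy|i].
  by apply: differentiableM; [apply: df|apply: dg].
apply: class_C_ext (class_C_D (IH _ _ (class_CW hf) (cg i))
                              (IH _ _ (class_CW hg) (cf i))) => z Uz.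
apply/esym; apply: deriveM; apply: diff_derivable; [exact: df|exact: dg].
Qed.

Lemma class_C_V k f : (forall y, U y -> f y != 0) -> class_C k U f ->
  class_C k U (fun y => (f y)^-1).
Proof.
move=> f0; elim: k => [|k IH] /=.
  by move=> cf y Uy; exact: (@cvgV R E (nbhs y) _ f (f y) (f0 y Uy) (cf y Uy)).
move=> hf; have := hf => -[df cf]; split=> [y Uy|i].
  by apply: differentiableV; [apply: df|apply: f0].
have hV := IH (class_CW hf).
have := class_C_M (class_C_M (class_C_cst k (-1)) (class_C_M hV hV)) (cf i).
apply: class_C_ext => z Uz; rewrite /partial deriveV; last 2 first.
- exact: f0.
- by apply: diff_derivable; apply: df.
by rewrite -invfM -expr2 mulN1r.
Qed.

Lemma class_C_sum k I (r : seq I) (P : pred I) (F : I -> E -> R) :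
  (forall a, P a -> class_C k U (F a)) ->
  class_C k U (fun y => \sum_(a <- r | P a) F a y).
Proof.
move=> hF; elim: r => [|a r IH].
  apply: class_C_ext (class_C_cst k 0) => z _.
  by rewrite big_nil.
case Pa: (P a); last first.
  by apply: class_C_ext IH => z _; rewrite big_cons Pa.
by apply: class_C_ext (class_C_D (hF a Pa) IH) => z _; rewrite big_cons Pa.
Qed.

Lemma class_C_prod k I (r : seq I) (P : pred I) (F : I -> E -> R) :
  (forall a, P a -> class_C k U (F a)) ->
  class_C k U (fun y => \prod_(a <- r | P a) F a y).
Proof.
move=> hF; elim: r => [|a r IH].
  apply: class_C_ext (class_C_cst k 1) => z _.
  by rewrite big_nil.
case Pa: (P a); last first.
  by apply: class_C_ext IH => z _; rewrite big_cons Pa.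
by apply: class_C_ext (class_C_M (hF a Pa) IH) => z _; rewrite big_cons Pa.
Qed.

Lemma smooth_ext_fun f g : (forall z, U z -> f z = g z) -> smooth U f -> smooth U g.
Proof. by move=> fg hf k; apply: class_C_ext fg (hf k). Qed.

Lemma smooth_partial i f : smooth U f -> smooth U (partial i f).
Proof. by move=> hf k; have [_ /(_ i)] := hf k.+1. Qed.

Lemma smooth_differentiable f y : smooth U f -> U y -> differentiable f y.
Proof. by move=> hf; have [+ _] := hf 1%N; apply. Qed.

Lemma smooth_derivable i f y : smooth U f -> U y -> derivable f y (delta_mx 0 i).
Proof. by move=> hf Uy; apply: diff_derivable; apply: smooth_differentiable. Qed.

Lemma smooth_cst c : smooth U (fun=> c).
Proof. by move=> k; apply: class_C_cst. Qed.

Lemma smoothD f g : smooth U f -> smooth U g -> smooth U (fun y => f y + g y).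
Proof. by move=> hf hg k; apply: class_C_D. Qed.

Lemma smoothM f g : smooth U f -> smooth U g -> smooth U (fun y => f y * g y).
Proof. by move=> hf hg k; apply: class_C_M. Qed.

Lemma smoothV f : (forall y, U y -> f y != 0) -> smooth U f ->
  smooth U (fun y => (f y)^-1).
Proof. by move=> f0 hf k; apply: class_C_V. Qed.

Lemma smooth_sum I (r : seq I) (P : pred I) (F : I -> E -> R) :
  (forall a, P a -> smooth U (F a)) -> smooth U (fun y => \sum_(a <- r | P a) F a y).
Proof. by move=> hF k; apply: class_C_sum => a /hF. Qed.

Lemma smooth_prod I (r : seq I) (P : pred I) (F : I -> E -> R) :
  (forall a, P a -> smooth U (F a)) -> smooth U (fun y => \prod_(a <- r | P a) F a y).
Proof. by move=> hF k; apply: class_C_prod => a /hF. Qed.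

Lemma partialD i f g y : smooth U f -> smooth U g -> U y ->
  partial i (fun z => f z + g z) y = partial i f y + partial i g y.
Proof. by move=> hf hg Uy; apply: deriveD; apply: smooth_derivable. Qed.

Lemma partialM i f g y : smooth U f -> smooth U g -> U y ->
  partial i (fun z => f z * g z) y = f y * partial i g y + g y * partial i f y.
Proof. by move=> hf hg Uy; apply: deriveM; apply: smooth_derivable. Qed.

Lemma partial_cst i c y : partial i (fun=> c) y = 0.
Proof. by rewrite /partial derive_cst. Qed.

Lemma partial_sum i I (r : seq I) (P : pred I) (F : I -> E -> R) y :
  (forall a, P a -> smooth U (F a)) -> U y ->
  partial i (fun z => \sum_(a <- r | P a) F a z) y =
  \sum_(a <- r | P a) partial i (F a) y.
Proof.
move=> hF Uy; elim: r => [|a r IH].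
  rewrite big_nil -[RHS](partial_cst i 0 y).
  by apply: (partial_ext i Uy) => z _; rewrite big_nil.
rewrite big_cons; case Pa: (P a); last first.
  by rewrite -IH; apply: (partial_ext i Uy) => z _; rewrite big_cons Pa.
rewrite -IH -partialD //; [|exact: hF|exact: smooth_sum].
by apply: (partial_ext i Uy) => z _; rewrite big_cons Pa.
Qed.

End SmoothFunctions.

(** * The chain rule for partial derivatives *)

Section ChainRule.
Variables (R : realType) (m : nat).
Local Notation E := 'rV[R]_m.

Lemma differentiable_row (tau : E -> E) y :
  (forall j, differentiable (fun z => tau z 0 j) y) -> differentiable tau y.
Proof.
move=> dtau; have -> : tau = \sum_j (fun z => tau z 0 j *: (delta_mx 0 j : E)).
  by apply/funext => z; rewrite fct_sumE [LHS]row_sum_delta.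
by apply: differentiable_sum => j; apply: differentiableZl.
Qed.

Lemma partial_comp (tau : E -> E) (f : E -> R) i y :
  (forall j, differentiable (fun z => tau z 0 j) y) -> differentiable f (tau y) ->
  partial i (fun z => f (tau z)) y =
  \sum_j partial j f (tau y) * partial i (fun z => tau z 0 j) y.
Proof.
move=> dtau df; have dt := differentiable_row dtau.
rewrite /partial (deriveE _ (differentiable_comp dt df)) (diff_comp dt df) /=.
rewrite -(deriveE _ dt) derive_mx; last exact: diff_derivable.
rewrite [X in 'd f _ X]row_sum_delta linear_sum; apply: eq_bigr => j _.
by rewrite linearZ /= mxE -deriveE // mulrC.
Qed.

End ChainRule.

(** * Symmetry of second derivatives *)

Section Schwarz.
Variables (R : realType) (V : normedModType R).
Implicit Types (f : V -> R) (u v y : V).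

Lemma is_derive_line f p v (t : R) : differentiable f (p + t *: v) ->
  is_derive t 1 (fun s : R => f (p + s *: v)) ('D_v f (p + t *: v)).
Proof.
move=> df; have [dl El] : is_diff t (cst p + *:%R^~ v) (0 + *:%R^~ v : R -> V).
  exact: is_diffD.
have dfl := differentiable_comp dl df.
apply: DeriveDef; first exact: diff_derivable.
by rewrite (deriveE _ dfl) (diff_comp dl df) /= El -deriveE // !fctE add0r scale1r.
Qed.

Lemma MVT_line (g dg : R -> R) (h : R) : 0 < h ->
  (forall t, 0 <= t <= h -> is_derive t 1 g (dg t)) ->
  exists2 t, 0 <= t <= h & g h - g 0 = dg t * h.
Proof.
move=> h0 hg; have [||t th E] := @MVT R g dg 0 h h0.
- by move=> t; rewrite in_itv /= => /andP[t0 th]; apply: hg; rewrite !ltW.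
- apply: derivable_within_continuous => t; rewrite in_itv /= => th.
  by have [] := hg t th.
by exists t; [move: th; rewrite in_itv /= => /andP[? ?]; rewrite !ltW|rewrite E subr0].
Qed.

(** The mean value theorem along u, applied to the increment of f in the direction v, and then along
    v, applied to the derivative along u. *)
Lemma second_difference f u v y (h : R) : 0 < h ->
  (forall s t, 0 <= s <= h -> 0 <= t <= h ->
     differentiable f (y + s *: u + t *: v) /\
     differentiable ('D_u f) (y + s *: u + t *: v)) ->
  exists s t, [/\ 0 <= s <= h, 0 <= t <= h &
    f (y + h *: u + h *: v) - f (y + h *: u) - (f (y + h *: v) - f y) =
    'D_v ('D_u f) (y + s *: u + t *: v) * (h * h)].
Proof.
move=> h0 df; have h01 : 0 <= h <= h by rewrite ltW /=.
have h00 : 0 <= (0 : R) <= h by rewrite lexx ltW.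
pose phi s := f (y + h *: v + s *: u) - f (y + s *: u).
have [s hs|s hs Es] := @MVT_line phi
    (fun s => 'D_u f (y + h *: v + s *: u) - 'D_u f (y + s *: u)) h h0.
  apply: is_deriveB; apply: is_derive_line.
    by rewrite addrAC; have [] := df s h hs h01.
  by have [] := df s 0 hs h00; rewrite scale0r addr0.
pose psi t := 'D_u f (y + s *: u + t *: v).
have [t ht|t ht Et] := @MVT_line psi
    (fun t => 'D_v ('D_u f) (y + s *: u + t *: v)) h h0.
  by apply: is_derive_line; have [] := df s t hs ht.
exists s, t; split=> //; rewrite mulrA -Et.
move: Es; rewrite /phi /psi !scale0r !addr0 [y + h *: v + h *: u]addrAC.
by rewrite [y + h *: v + s *: u]addrAC => <-; ring.
Qed.

(** The second difference does not change when u and v are exchanged, so the two mixed derivatives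
    agree at two possibly different points near y; continuity at y brings them together. *)
Lemma schwarz f u v y : (\forall z \near y, differentiable f z) ->
  (\forall z \near y, differentiable ('D_u f) z) ->
  (\forall z \near y, differentiable ('D_v f) z) ->
  {for y, continuous ('D_v ('D_u f))} -> {for y, continuous ('D_u ('D_v f))} ->
  'D_v ('D_u f) y = 'D_u ('D_v f) y.
Proof.
move=> df du dv cuv cvu; apply/eqP; rewrite -subr_eq0 -normr_le0.
apply/ler_addgt0Pl => e e0; rewrite addr0.
have e2 : 0 < e / 2 by rewrite divr_gt0.
move/cvgrPdist_lt : cuv => /(_ _ e2) cuv.
move/cvgrPdist_lt : cvu => /(_ _ e2) cvu.
pose I := @filterI V (nbhs y) (nbhs_filter y).
have H := I _ _ df (I _ _ du (I _ _ dv (I _ _ cuv cvu))).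
have [d /= d0 Bd] := (nbhs_ballP _ _).1 H.
(* With h = d / (2 K), the parallelogram stays within h K = d / 2 of y; the summand 1 keeps K
   positive when u and v vanish. *)
pose K := `|u| + `|v| + 1.
have K0 : 0 < K by rewrite ltr_wpDl // addr_ge0.
pose h := d / (2 * K).
have h0 : 0 < h by rewrite divr_gt0 // mulr_gt0.
have inball s t : 0 <= s <= h -> 0 <= t <= h -> ball y d (y + s *: u + t *: v).
  move=> /andP[s0 sh] /andP[t0 th]; rewrite -ball_normE /ball_ /=.
  rewrite -addrA opprD addNKr normrN; apply: (le_lt_trans (ler_normD _ _)).
  rewrite !normrZ !ger0_norm //.
  have : s * `|u| + t * `|v| <= h * K.
    rewrite /K !mulrDr mulr1 -[X in X <= _]addr0; apply: lerD; last exact: ltW.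
    by apply: lerD; apply: ler_wpM2r.
  move/le_lt_trans; apply; rewrite /h invfM mulrA mulfVK ?gt_eqF //.
  by rewrite ltr_pdivrMr // ltr_pMr // ltr1n.
have [s t hs ht|s [t [hs ht E1]]] := @second_difference f u v y h h0.
  by have [? []] := Bd _ (inball s t hs ht).
have [s' t' hs' ht'|s' [t' [hs' ht' E2]]] := @second_difference f v u y h h0.
  by rewrite addrAC; have [? [? []]] := Bd _ (inball t' s' ht' hs').
have [_ [_ [_ [b1 _]]]] := Bd _ (inball s t hs ht).
have [_ [_ [_ [_ b2]]]] := Bd _ (inball t' s' ht' hs').
rewrite [y + t' *: u + _]addrAC in b2.
rewrite [y + h *: v + h *: u]addrAC in E2.
move: E1 E2 b1 b2.
move: ('D_v ('D_u f) (y + s *: u + t *: v)) => p.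
move: ('D_u ('D_v f) (y + s' *: v + t' *: u)) => q.
move: (f (y + h *: u + h *: v)) (f (y + h *: u)) (f (y + h *: v)) (f y) => a1 a2 a3 a4.
move: ('D_v ('D_u f) y) ('D_u ('D_v f) y) => p0 q0 E1 E2 b1 b2.
have E : p = q.
  have hh : h * h != 0 by rewrite mulf_neq0 ?gt_eqF.
  by apply: (mulIf hh); rewrite -E1 -E2; ring.
rewrite -(subrKA p) E; apply: (le_trans (ler_normD _ _)); rewrite [e]splitr.
by rewrite lerD // ltW // -?E // E distrC.
Qed.

End Schwarz.

(** * Smooth forms and the exterior derivative in coordinates *)

Section SmoothForms.
Variables (R : realType) (m : nat).
Local Notation E := 'rV[R]_m.
Local Notation ext := (ext R m).
Variables (U : set E) (oU : open U).
Implicit Types (A B : E -> ext) (f : E -> R) (y : E) (i j : 'I_m) (k : int).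

Lemma smooth_schwarz i j f y : smooth U f -> U y ->
  partial i (partial j f) y = partial j (partial i f) y.
Proof.
move=> hf Uy; apply: schwarz.
- by apply: (near_open oU Uy) => z; apply: smooth_differentiable.
- by apply: (near_open oU Uy) => z; apply: smooth_differentiable;
    apply: smooth_partial.
- by apply: (near_open oU Uy) => z; apply: smooth_differentiable;
    apply: smooth_partial.
- by have := smooth_partial i (smooth_partial j hf) => /(_ 0%N) /(_ y Uy).
- by have := smooth_partial j (smooth_partial i hf) => /(_ 0%N) /(_ y Uy).
Qed.

Lemma smooth_ext_eq A B : (forall z, U z -> A z = B z) ->
  smooth_ext U A -> smooth_ext U B.
Proof. by move=> AB hA S; apply: (smooth_ext_fun oU) (hA S) => z /AB ->. Qed.

Lemma smooth_ext_cst a : smooth_ext U (fun=> a).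
Proof. by move=> S; apply: smooth_cst. Qed.

Lemma smooth_extD A B : smooth_ext U A -> smooth_ext U B ->
  smooth_ext U (fun y => A y + B y).
Proof.
move=> hA hB S; apply: (smooth_ext_fun oU) (smoothD oU (hA S) (hB S)) => z _.
by rewrite ext_addE.
Qed.

Lemma smooth_extZ f A : smooth U f -> smooth_ext U A ->
  smooth_ext U (fun y => f y *: A y).
Proof.
move=> hf hA S; apply: (smooth_ext_fun oU) (smoothM oU hf (hA S)) => z _.
by rewrite ext_scaleE.
Qed.

Lemma smooth_ext_sum I (r : seq I) (P : pred I) (F : I -> E -> ext) :
  (forall a, P a -> smooth_ext U (F a)) ->
  smooth_ext U (fun y => \sum_(a <- r | P a) F a y).
Proof.
move=> hF S.
have := @smooth_sum _ _ _ oU _ r P (fun a y => F a y S) (fun a Pa => hF a Pa S).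
by apply: (smooth_ext_fun oU) => z _; rewrite ext_sumE.
Qed.

Lemma smooth_wedge A B : smooth_ext U A -> smooth_ext U B ->
  smooth_ext U (fun y => wedge (A y) (B y)).
Proof.
move=> hA hB S.
apply: (smooth_ext_fun oU (f := fun y => \sum_(T : {set 'I_m} | T \subset S)
     wedge_sign R T (S :\: T) * A y T * B y (S :\: T))) => [z _|].
  by rewrite ffunE.
apply: (smooth_sum oU) => T _; apply: (smoothM oU); last exact: hB.
by apply: (smoothM oU); [exact: smooth_cst|exact: hA].
Qed.

Lemma smooth_ctr i A : smooth_ext U A -> smooth_ext U (fun y => ctr i (A y)).
Proof.
move=> hA S; case iS: (i \in S).
  by apply: (smooth_ext_fun oU) (smooth_cst oU 0) => z _; rewrite ctrE iS.
apply: (smooth_ext_fun oU) (smoothM oU (smooth_cst oU _) (hA (i |: S)%SET)) => z _.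
by rewrite ctrE iS.
Qed.

Definition smooth_mx (Q : E -> 'M[R]_m) := forall i j, smooth U (fun y => Q y i j).

(** The size of the matrix is independent of the dimension of the space because cofactors are
    determinants of a smaller size. *)
Lemma smooth_det_gen n (Q : E -> 'M[R]_n) :
  (forall a b, smooth U (fun y => Q y a b)) -> smooth U (fun y => \det (Q y)).
Proof.
move=> hQ; rewrite /determinant; apply: (smooth_sum oU) => s _.
by apply: (smoothM oU); [exact: smooth_cst|apply: (smooth_prod oU) => a _; exact: hQ].
Qed.

Lemma smooth_invmx Q : smooth_mx Q -> (forall y, U y -> Q y \in unitmx) ->
  smooth_mx (fun y => invmx (Q y)).
Proof.
move=> hQ uQ i j.
have hdet := smooth_det_gen hQ.
have dV : smooth U (fun y => (\det (Q y))^-1).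
  apply: (smoothV oU) hdet => y Uy.
  by have := uQ y Uy; rewrite unitmxE unitfE.
have hcof : smooth U (fun y => cofactor (Q y) j i).
  apply: (smoothM oU); first exact: smooth_cst.
  apply: smooth_det_gen => a b.
  by apply: (smooth_ext_fun oU) (hQ (lift j a) (lift i b)) => z _; rewrite !mxE.
apply: (smooth_ext_fun oU) (smoothM oU dV hcof) => z Uz.
by rewrite /invmx uQ // !mxE.
Qed.

Lemma smooth_cowedge Q A : smooth_mx Q -> smooth_ext U A ->
  smooth_ext U (fun y => cowedge (Q y) (A y)).
Proof.
move=> hQ hA; rewrite /cowedge; apply: smooth_extZ; first exact: smooth_cst.
apply: smooth_ext_sum => i _; apply: smooth_ext_sum => j _.
by apply: smooth_extZ; [exact: hQ|do 2!apply: smooth_ctr].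
Qed.

Lemma smooth_form_mx w : smooth_ext U w -> smooth_mx (fun y => form_mx (w y)).
Proof.
move=> hw i j.
have := smooth_ctr j (smooth_ctr i hw) => /(_ finset.set0).
by apply: (smooth_ext_fun oU) => z _; rewrite [RHS]mxE.
Qed.

Definition ext_partial i A y : ext := [ffun S => partial i (fun z => A z S) y].

Lemma ext_dE A y : ext_d A y = \sum_i wedge (dx R [set i]%SET) (ext_partial i A y).
Proof. by apply: eq_bigr => i _; rewrite covector_delta. Qed.

Lemma smooth_ext_partial i A : smooth_ext U A -> smooth_ext U (ext_partial i A).
Proof.
move=> hA S; apply: (smooth_ext_fun oU) (smooth_partial i (hA S)) => z _.
by rewrite ffunE.
Qed.

Lemma smooth_ext_d A : smooth_ext U A -> smooth_ext U (ext_d A).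
Proof.
move=> hA; rewrite /ext_d; apply: smooth_ext_sum => i _.
by apply: smooth_wedge; [exact: smooth_ext_cst|exact: smooth_ext_partial].
Qed.

Lemma ext_partial_eq i A B y : (forall z, U z -> A z = B z) -> U y ->
  ext_partial i A y = ext_partial i B y.
Proof.
move=> AB Uy; apply/ffunP => S; rewrite !ffunE.
by apply: (partial_ext oU _ Uy) => z /AB ->.
Qed.

Lemma ext_d_eq A B y : (forall z, U z -> A z = B z) -> U y -> ext_d A y = ext_d B y.
Proof.
move=> AB Uy; rewrite !ext_dE; apply: eq_bigr => i _.
by rewrite (ext_partial_eq _ AB Uy).
Qed.

Lemma ext_partial_cst i a y : ext_partial i (fun=> a) y = 0.
Proof. by apply/ffunP => S; rewrite !ffunE partial_cst. Qed.

Lemma ext_partialD i A B y : smooth_ext U A -> smooth_ext U B -> U y ->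
  ext_partial i (fun z => A z + B z) y = ext_partial i A y + ext_partial i B y.
Proof.
move=> hA hB Uy; apply/ffunP => S; rewrite ext_addE !ffunE.
rewrite -(partialD (U := U)) //; apply: (partial_ext oU _ Uy) => z _.
by rewrite ext_addE.
Qed.

Lemma ext_partial_sum i (I : Type) (r : seq I) (P : pred I) (F : I -> E -> ext) y :
  (forall a, P a -> smooth_ext U (F a)) -> U y ->
  ext_partial i (fun z => \sum_(a <- r | P a) F a z) y =
  \sum_(a <- r | P a) ext_partial i (F a) y.
Proof.
move=> hF Uy; apply/ffunP => S; rewrite ffunE ext_sumE.
under [RHS]eq_bigr => a _ do rewrite ffunE.
rewrite -(partial_sum oU) // => [|a Pa]; last exact: hF.
by apply: (partial_ext oU _ Uy) => z _; rewrite ext_sumE.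
Qed.

Lemma ext_partialZ i f A y : smooth U f -> smooth_ext U A -> U y ->
  ext_partial i (fun z => f z *: A z) y =
  partial i f y *: A y + f y *: ext_partial i A y.
Proof.
move=> hf hA Uy; apply/ffunP => S; rewrite ext_addE !ext_scaleE !ffunE.
rewrite addrC [X in _ = _ + X]mulrC -(partialM (U := U)) //.
by apply: (partial_ext oU _ Uy) => z _; rewrite ext_scaleE.
Qed.

Lemma ext_partial_wedge i A B y : smooth_ext U A -> smooth_ext U B -> U y ->
  ext_partial i (fun z => wedge (A z) (B z)) y =
  wedge (ext_partial i A y) (B y) + wedge (A y) (ext_partial i B y).
Proof.
move=> hA hB Uy; apply/ffunP => S; rewrite ext_addE [LHS]ffunE.
pose F (T : {set 'I_m}) z := wedge_sign R T (S :\: T) * (A z T * B z (S :\: T)).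
have hF (T : {set 'I_m}) : T \subset S -> smooth U (F T).
  move=> _; apply: (smoothM oU); first exact: smooth_cst.
  by apply: (smoothM oU); [exact: hA|exact: hB].
transitivity (partial i (fun z => \sum_(T : {set 'I_m} | T \subset S) F T z) y).
  apply: (partial_ext oU _ Uy) => z _; rewrite ffunE.
  by apply: eq_bigr => T _; rewrite /F mulrA.
rewrite (partial_sum oU) // !ffunE -big_split; apply: eq_bigr => T _ /=.
rewrite (partialM (U := U)) //; [|exact: smooth_cst|by apply: (smoothM oU)].
by rewrite partial_cst mulr0 addr0 (partialM (U := U)) // !ffunE; ring.
Qed.

Lemma ext_dD A B y : smooth_ext U A -> smooth_ext U B -> U y ->
  ext_d (fun z => A z + B z) y = ext_d A y + ext_d B y.
Proof.
move=> hA hB Uy; rewrite !ext_dE -big_split; apply: eq_bigr => i _ /=.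
by rewrite ext_partialD // wedgeDr.
Qed.

Lemma ext_d_sum (I : Type) (r : seq I) (P : pred I) (F : I -> E -> ext) y :
  (forall a, P a -> smooth_ext U (F a)) -> U y ->
  ext_d (fun z => \sum_(a <- r | P a) F a z) y = \sum_(a <- r | P a) ext_d (F a) y.
Proof.
move=> hF Uy; rewrite ext_dE; under [RHS]eq_bigr => a _ do rewrite ext_dE.
rewrite exchange_big; apply: eq_bigr => i _ /=.
by rewrite ext_partial_sum // wedge_sumr.
Qed.

Lemma covector_grad f y : covector (grad f y) = \sum_i partial i f y *: dx R [set i]%SET.
Proof. by rewrite covectorE; apply: eq_bigr => i _; rewrite mxE. Qed.

Lemma ext_dZ f A y : smooth U f -> smooth_ext U A -> U y ->
  ext_d (fun z => f z *: A z) y = wedge (covector (grad f y)) (A y) + f y *: ext_d A y.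
Proof.
move=> hf hA Uy; rewrite !ext_dE covector_grad wedge_suml scaler_sumr -big_split.
by apply: eq_bigr => i _ /=; rewrite ext_partialZ // wedgeDr !wedgeZr wedgeZl.
Qed.

Lemma ext_d_hom k A y : (forall z, U z -> hom k (A z)) -> U y -> hom (k + 1) (ext_d A y).
Proof.
move=> hA Uy; rewrite ext_dE; apply: hom_sum => i _; rewrite addrC.
apply: hom_wedge; first by rewrite -covector_delta; apply: hom_covector.
constructor=> S hS; rewrite ffunE -(partial_cst i 0 y).
by apply: (partial_ext oU _ Uy) => z Uz; apply: homE (hA z Uz) hS.
Qed.

(** Exchanging the two summation indices shows that the double sum is its own opposite: second
    partials are symmetric, dx_i /\ dx_j is antisymmetric. *)
Lemma ext_d_sq A y : smooth_ext U A -> U y -> ext_d (ext_d A) y = 0.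
Proof.
move=> hA Uy; set X := ext_d _ _.
have XE : X = \sum_j \sum_i wedge (dx R [set j]%SET) (wedge (dx R [set i]%SET)
    (ext_partial j (ext_partial i A) y)).
  rewrite /X ext_dE; apply: eq_bigr => j _; rewrite -wedge_sumr; congr wedge.
  transitivity (ext_partial j (fun z => \sum_i wedge (dx R [set i]%SET) (ext_partial i A z)) y).
    by apply: ext_partial_eq => // z _; rewrite ext_dE.
  rewrite ext_partial_sum // => [|i _]; last first.
    by apply: smooth_wedge; [exact: smooth_ext_cst|exact: smooth_ext_partial].
  apply: eq_bigr => i _.
  rewrite (ext_partial_wedge _ (smooth_ext_cst _)) //; last exact: smooth_ext_partial.
  by rewrite ext_partial_cst wedge0l add0r.
have sym i j : ext_partial j (ext_partial i A) y = ext_partial i (ext_partial j A) y.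
  apply/ffunP => S; rewrite [LHS]ffunE [RHS]ffunE.
  transitivity (partial j (partial i (fun z => A z S)) y).
    by apply: (partial_ext oU _ Uy) => z _; rewrite ffunE.
  rewrite smooth_schwarz //.
  by apply: (partial_ext oU _ Uy) => z _; rewrite ffunE.
have XN : X = - X.
  rewrite {1}XE exchange_big XE -sumrN; apply: eq_bigr => i _ /=.
  by rewrite -sumrN; apply: eq_bigr => j _; rewrite sym dx1_wedgeCA.
apply/eqP; rewrite -[X == 0]/(X == 0); have /eqP := XN.
by rewrite -addr_eq0 -mulr2n -scaler_nat scaler_eq0 pnatr_eq0.
Qed.

Lemma ext_d_wedge_two w A y : (forall z, U z -> hom 2 (w z)) -> smooth_ext U w ->
  (forall z, U z -> ext_d w z = 0) -> smooth_ext U A -> U y ->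
  ext_d (fun z => wedge (w z) (A z)) y = wedge (w y) (ext_d A y).
Proof.
move=> hw sw dw sA Uy; rewrite !ext_dE wedge_sumr.
transitivity (wedge (ext_d w y) (A y) + \sum_i wedge (w y)
    (wedge (dx R [set i]%SET) (ext_partial i A y))); last by rewrite dw // wedge0l add0r.
rewrite ext_dE wedge_suml -big_split; apply: eq_bigr => i _ /=.
rewrite ext_partial_wedge // wedgeDr wedgeA; congr (_ + _).
by rewrite -covector_delta covector_two_comm //; apply: hw.
Qed.

Lemma ext_d_wedge_one (t : E -> 'rV[R]_m) B y : smooth_ext U (fun z => covector (t z)) ->
  smooth_ext U B -> U y ->
  ext_d (fun z => wedge (covector (t z)) (B z)) y =
  wedge (ext_d (fun z => covector (t z)) y) (B y) - wedge (covector (t y)) (ext_d B y).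
Proof.
move=> st sB Uy; rewrite !ext_dE wedge_suml wedge_sumr -sumrB.
apply: eq_bigr => i _; rewrite ext_partial_wedge // wedgeDr wedgeA; congr (_ + _).
by rewrite -covector_delta covector_wedgeCA.
Qed.

Lemma covector_grad_E f y S :
  covector (grad f y) S = \sum_i (S == [set i]%SET)%:R * partial i f y.
Proof. by rewrite ffunE; apply: eq_bigr => i _; rewrite mxE. Qed.

Lemma smooth_covector_grad f : smooth U f -> smooth_ext U (fun z => covector (grad f z)).
Proof.
move=> hf S; have h : smooth U (fun y => \sum_i (S == [set i]%SET)%:R * partial i f y).
  apply: (smooth_sum oU) => i _.
  by apply: (smoothM oU); [exact: smooth_cst|exact: smooth_partial].
by apply: (smooth_ext_fun oU) h => z _; rewrite covector_grad_E.
Qed.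

(** The one-form df is d of the 0-form f, so this is an instance of d d = 0. *)
Lemma ext_d_grad f y : smooth U f -> U y -> ext_d (fun z => covector (grad f z)) y = 0.
Proof.
move=> hf Uy; set f1 := fun z => f z *: ext1 R m.
have s1 : smooth_ext U f1 by apply: smooth_extZ => //; apply: smooth_ext_cst.
rewrite -[RHS](ext_d_sq s1 Uy); apply: (ext_d_eq _ Uy) => z Uz.
rewrite /f1 ext_dZ //; last exact: smooth_ext_cst.
rewrite wedge1r [ext_d _ _](_ : _ = 0) ?scaler0 ?addr0 //.
by rewrite ext_dE big1 // => i _; rewrite ext_partial_cst wedge0r.
Qed.

End SmoothForms.

(** * Fields of forms on an open set *)

Section Pullback.
Variables (R : realType) (m : nat).
Local Notation E := 'rV[R]_m.
Local Notation ext := (ext R m).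
Variables (W U : set E) (oW : open W) (oU : open U) (tau : E -> E).
Hypothesis tau_smooth : forall i, smooth W (fun y => tau y 0 i).
Hypothesis tau_U : forall y, W y -> U (tau y).

Lemma tau_differentiable j y : W y -> differentiable (fun z => tau z 0 j) y.
Proof. exact: smooth_differentiable. Qed.

Lemma class_C_comp k (f : E -> R) : class_C k U f -> class_C k W (fun y => f (tau y)).
Proof.
elim: k f => [|k IH] f /=.
  move=> cf y Wy; apply: (@continuous_comp _ _ _ tau f); last exact/cf/tau_U.
  apply: differentiable_continuous; apply: differentiable_row => j.
  exact: tau_differentiable.
move=> [df cf]; split=> [y Wy|i].
  apply: (@differentiable_comp _ _ _ _ tau f); last exact/df/tau_U.
  by apply: differentiable_row => j; apply: tau_differentiable.
have h : class_C k W (fun y => \sum_j partial j f (tau y) *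
                               partial i (fun z => tau z 0 j) y).
  apply: (class_C_sum oW) => j _; apply: (class_C_M oW); first exact: IH.
  by have := smooth_partial i (tau_smooth j) => /(_ k).
apply: (class_C_ext oW) h => z Wz; rewrite partial_comp //.
  by move=> j; apply: tau_differentiable.
exact/df/tau_U.
Qed.

Lemma smooth_comp (f : E -> R) : smooth U f -> smooth W (fun y => f (tau y)).
Proof. by move=> hf k; apply: class_C_comp. Qed.

Let theta y (i : 'I_m) := grad (fun z => tau z 0 i) y.

Lemma pullbackE y a : pullback tau y a = pull (theta y) a.
Proof. by []. Qed.

Lemma smooth_theta_prod s : smooth_ext W (fun y => theta_prod (theta y) s).
Proof.
elim: s => [|i s IH].
  by apply: (smooth_ext_eq oW) (smooth_ext_cst oW (ext1 R m)) => z _; rewrite /theta_prod big_nil.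
apply: (smooth_ext_eq oW) (smooth_wedge oW (smooth_covector_grad oW (tau_smooth i)) IH) => z _.
by rewrite /theta_prod big_cons.
Qed.

Lemma ext_d_theta_prod s y : W y -> ext_d (fun z => theta_prod (theta z) s) y = 0.
Proof.
move=> Wy; elim: s => [|i s IH].
  rewrite (ext_d_eq (B := fun=> ext1 R m) oW _ Wy) => [|z _]; last first.
    by rewrite /theta_prod big_nil.
  by rewrite ext_dE big1 // => i _; rewrite ext_partial_cst wedge0r.
rewrite (ext_d_eq (B := fun z => wedge (covector (theta z i)) (theta_prod (theta z) s)) oW _ Wy);
  last by move=> z _; rewrite /theta_prod big_cons.
have sg := smooth_covector_grad oW (tau_smooth i).
rewrite (ext_d_wedge_one oW sg (smooth_theta_prod s) Wy) IH wedge0r subr0.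
by rewrite (ext_d_grad oW (tau_smooth i) Wy) wedge0l.
Qed.

(** The pullback is a sum of functions times products of the closed one-forms dtau_i, so d acts on
    the functions only; the chain rule expands their differentials in the dtau_j. *)
Lemma ext_d_pullback (A A' : E -> ext) y : smooth_ext U A' ->
  (forall z, W z -> A z = pullback tau z (A' (tau z))) -> W y ->
  ext_d A y = pullback tau y (ext_d A' (tau y)).
Proof.
move=> sA' EA Wy; pose f S z := A' (tau z) S.
have sf S : smooth W (f S) by apply: (smooth_comp (f := fun z => A' z S)).
rewrite (ext_d_eq oW EA Wy) /pullback.
rewrite (@ext_d_sum _ _ _ oW _ _ _
    (fun S z => f S z *: theta_prod (theta z) (enum S)) y) //;
  last by move=> S _; apply: (smooth_extZ oW) => //; apply: smooth_theta_prod.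
transitivity (\sum_S \sum_j partial j (fun z => A' z S) (tau y) *:
    wedge (covector (theta y j)) (theta_prod (theta y) (enum S))).
  apply: eq_bigr => S _.
  rewrite (ext_dZ oW (sf S) (smooth_theta_prod (enum S)) Wy).
  rewrite (ext_d_theta_prod _ Wy) scaler0 addr0 covector_grad.
  have -> : \sum_i partial i (f S) y *: dx R [set i]%SET =
      \sum_j partial j (fun z => A' z S) (tau y) *: covector (theta y j).
    transitivity (\sum_i \sum_j (partial j (fun z => A' z S) (tau y) *
        partial i (fun z => tau z 0 j) y) *: dx R [set i]%SET).
      apply: eq_bigr => i _; rewrite -scaler_suml; congr (_ *: _).
      apply: partial_comp => [j|]; first exact: tau_differentiable.
      by apply: smooth_differentiable (sA' S) _; apply: tau_U.
    rewrite exchange_big; apply: eq_bigr => j _.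
    rewrite covector_grad scaler_sumr; apply: eq_bigr => i _.
    by rewrite scalerA.
  by rewrite wedge_suml; apply: eq_bigr => j _; rewrite wedgeZl.
rewrite exchange_big -/(pullback _ _ _) pullbackE ext_dE linear_sum.
apply: eq_bigr => j _ /=; rewrite pull_dx1 /pull wedge_sumr.
by apply: eq_bigr => S _; rewrite wedgeZr ffunE.
Qed.

End Pullback.

(** * Hard Lefschetz for smooth fields *)

Section LefschetzFields.
Variables (R : realType) (n : nat).
Local Notation E := 'rV[R]_(2 * n).
Local Notation ext := (ext R (2 * n)).
Variables (U : set E) (oU : open U) (w : E -> ext).
Hypothesis w_symp : forall y, U y -> symplectic_form (w y).
Hypothesis w_smooth : smooth_ext U w.
Implicit Types (A B C : E -> ext) (k : int).

(* Fields are extended by 0 outside of U, so that equality of fields on U is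
   equality of functions. *)
Definition hom_field k A : Prop :=
  [/\ forall y, ~ U y -> A y = 0, smooth_ext U A & forall y, U y -> hom k (A y)].

Definition Lef_field A : E -> ext := fun y => Lef (w y) (A y).

Lemma Lef_field_is_linear : linear Lef_field.
Proof. by move=> x A B; apply/funext => y; rewrite /Lef_field !fctE linearP. Qed.
HB.instance Definition _ :=
  GRing.isLinear.Build R (E -> ext) (E -> ext) *:%R Lef_field Lef_field_is_linear.

Definition coLef_field A : E -> ext :=
  fun y => cowedge (invmx (form_mx (w y))) (A y).

Lemma coLef_field_is_linear : linear coLef_field.
Proof. by move=> x A B; apply/funext => y; rewrite /coLef_field !fctE linearP. Qed.
HB.instance Definition _ :=
  GRing.isLinear.Build R (E -> ext) (E -> ext) *:%R coLef_field coLef_field_is_linear.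

Definition restr A : E -> ext := fun y => if pselect (U y) then A y else 0.

Lemma restrE A y : U y -> restr A y = A y.
Proof. by rewrite /restr; case: pselect. Qed.

Lemma restr_out A y : ~ U y -> restr A y = 0.
Proof. by rewrite /restr; case: pselect. Qed.

Lemma hom_restr k A : smooth_ext U A -> (forall y, U y -> hom k (A y)) ->
  hom_field k (restr A).
Proof.
move=> sA hA; split=> [y /restr_out //||y Uy].
  by apply: (smooth_ext_eq oU) sA => z Uz; rewrite restrE.
by rewrite restrE //; apply: hA.
Qed.

Lemma hom_field0 k : hom_field k 0.
Proof. by split=> // [|y _]; [exact: (smooth_ext_cst oU)|exact: hom0]. Qed.

Lemma hom_field_lin k x A B : hom_field k A -> hom_field k B -> hom_field k (x *: A + B).
Proof.
move=> [A0 sA hA] [B0 sB hB]; split=> [y Uy||y Uy].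
- by rewrite !fctE A0 // B0 // scaler0 addr0.
- by apply: (smooth_extD oU) => //; apply: (smooth_extZ oU) => //; apply: smooth_cst.
- by rewrite !fctE; apply: hom_lin; [exact: hA|exact: hB].
Qed.

Lemma hom_field_L k A : hom_field k A -> hom_field (k + 2) (Lef_field A).
Proof.
move=> [A0 sA hA]; split=> [y Uy||y Uy].
- by rewrite /Lef_field A0 // linear0.
- exact: (smooth_wedge oU).
- by apply: hom_Lef; [exact: (w_symp Uy).1|exact: hA].
Qed.

Lemma hom_field_coL k A : hom_field k A -> hom_field (k - 2) (coLef_field A).
Proof.
move=> [A0 sA hA]; split=> [y Uy||y Uy].
- by rewrite /coLef_field A0 // linear0.
- apply: (smooth_cowedge oU) => //; apply: (smooth_invmx oU).
    exact: (smooth_form_mx oU).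
  by move=> y /w_symp[].
- by apply: hom_cowedge; apply: hA.
Qed.

Lemma hom_field_out k A : (k < 0) || (n%:Z *+ 2 < k) -> hom_field k A -> A = 0.
Proof.
move=> hk [A0 _ hA]; apply/funext => y; have [Uy|Uy] := pselect (U y); last exact: A0.
exact: hom_out2 hk (hA y Uy).
Qed.

Lemma comm_field k A : hom_field k A ->
  coLef_field (Lef_field A) = Lef_field (coLef_field A) + (n%:Z - k)%:~R *: A.
Proof.
move=> [A0 _ hA]; apply/funext => y; rewrite !fctE /coLef_field /Lef_field.
have [Uy|Uy] := pselect (U y); last by rewrite A0 // !linear0 addr0.
exact: comm_cowedge_Lef (w_symp Uy) _ _ (hA y Uy).
Qed.

Lemma iter_Lef_field r A y : iter r Lef_field A y = iter r (Lef (w y)) (A y).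
Proof. by elim: r => //= r IH; rewrite /Lef_field IH. Qed.

Lemma Lef_field_surj m k A : n%:Z + m%:Z <= k -> hom_field k A ->
  exists2 C, hom_field (k - m%:Z *+ 2) C & A = iter m Lef_field C.
Proof.
exact: (iter_L_surj hom_field0 hom_field_lin hom_field_L hom_field_coL
  hom_field_out comm_field).
Qed.

Lemma Lef_field_inj m k A : k + m%:Z <= n%:Z -> hom_field k A ->
  iter m Lef_field A = 0 -> A = 0.
Proof.
exact: (iter_L_inj hom_field_L hom_field_coL hom_field_out comm_field).
Qed.

(** The field is decomposed as an element of the module of fields, which yields smooth components;
    at each point they form a Lefschetz decomposition, hence are those selected by [lefschetz]. *)
Lemma smooth_lefschetz k A (rs : 'I_n.+1 * 'I_n.+1) : smooth_ext U A ->
  (forall y, U y -> hom k (A y)) -> smooth_ext U (fun y => lefschetz (w y) (A y) rs).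
Proof.
move=> sA hA.
have [B [hB PB ZB EB]] := lefschetz_exists hom_field0 hom_field_lin hom_field_L
  hom_field_coL hom_field_out comm_field (hom_restr sA hA).
(* The components of the field are indexed by r alone; in degree k the slot (r, s) is filled only if
   s + 2r = k and r + s <= n. *)
pose b y (rs : 'I_n.+1 * 'I_n.+1) : ext :=
  if (rs.2%:Z + rs.1%:Z *+ 2 == k) && (rs.1 + rs.2 <= n)%N then B rs.1 y else 0.
have sb : smooth_ext U (fun y => b y rs).
  rewrite /b; case: (_ && _); last exact: smooth_ext_cst.
  by have [_ h _] := hB (nat_of_ord rs.1).
apply: (smooth_ext_eq oU) sb => y Uy.
suff dec : lefschetz_decomposition (w y) (A y) [ffun rs => b y rs].
  by rewrite (lefschetzE (w_symp Uy) dec) ffunE.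
split=> [r s|r s rs'|].
- rewrite ffunE /b /=; case: ifP => [/andP[/eqP hk hrs]|_]; last exact: primitive0.
  apply/primitiveP; first by have := ltn_ord s; lia.
  have [_ _ /(_ y Uy) h] := hB r; split; first by move: h; congr hom; lia.
  have := congr1 (fun X : E -> ext => X y) (PB r).
  rewrite iter_Lef_field /=; congr (iter _ _ _ = _); lia.
- by rewrite ffunE /b /= (leqNgt _ n) rs' andbF.
- have := congr1 (fun X : E -> ext => X y) EB; rewrite restrE // => ->.
  rewrite fct_sumE; apply: eq_bigr => r _; rewrite iter_Lef_field.
  have [h|h] := boolP ((k - r%:Z *+ 2 < 0) || (n%:Z < k - r%:Z)).
    rewrite ZB // iter_linear0 big1 // => s hs; rewrite ffunE /b /= ifF ?iter_linear0 //.
    lia.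
  have s_lt : (absz (k - r%:Z *+ 2)%R < n.+1)%N by lia.
  rewrite (bigD1 (Ordinal s_lt)) /=; last by lia.
  rewrite ffunE /b /= ifT; last by lia.
  rewrite big1 ?addr0 // => s /andP[rs' ns]; rewrite ffunE /b /= ifF ?iter_linear0 //.
  by move: ns; rewrite -val_eqE /=; lia.
Qed.

Lemma smooth_iter_Lef r A : smooth_ext U A ->
  smooth_ext U (fun y => iter r (Lef (w y)) (A y)).
Proof. by move=> sA; elim: r => //= r IH; apply: (smooth_wedge oU). Qed.

Lemma smooth_projection p k A : smooth_ext U A -> (forall y, U y -> hom k (A y)) ->
  smooth_ext U (fun y => projection (w y) p (A y)).
Proof.
move=> sA hA; apply: (smooth_ext_sum oU) => r _; apply: (smooth_ext_sum oU) => s _.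
by apply: smooth_iter_Lef; apply: smooth_lefschetz hA.
Qed.

Lemma smooth_reflection k A : smooth_ext U A -> (forall y, U y -> hom k (A y)) ->
  smooth_ext U (fun y => reflection (w y) (A y)).
Proof.
move=> sA hA; apply: (smooth_ext_sum oU) => r _; apply: (smooth_ext_sum oU) => s _.
by apply: smooth_iter_Lef; apply: smooth_lefschetz hA.
Qed.

End LefschetzFields.

(** * The symbol sequence *)

Section SymbolComplex.
Variables (R : realType) (n p : nat) (hpn : (p <= n)%N).
Local Notation ext := (ext R (2 * n)).
Variables (w : ext) (hw : symplectic_form w) (xi : 'rV[R]_(2 * n)).
Implicit Types (a b c : ext) (k : int).

Let Xi := wedge (covector xi).
Let Pi := projection w p.
Let Refl := reflection w.

(* The symbol of the second-order operator: [xi /\ a = L^(p+1) c] determines c. *)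
Definition mid_symbol a : ext :=
  iter p (Lef w) (wedge (covector xi)
    (xget 0 [set c | hom (n%:Z - p%:Z - 1) c /\
       wedge (covector xi) a = iter p.+1 (Lef w) c])).

Definition symbol_map : nat -> ext -> ext := filt_map n p Xi Pi Refl mid_symbol.

Lemma mid_symbolE a c : hom (n%:Z - p%:Z - 1) c ->
  wedge (covector xi) a = iter p.+1 (Lef w) c ->
  mid_symbol a = iter p (Lef w) (wedge (covector xi) c).
Proof.
move=> hc Ec; rewrite /mid_symbol; congr (iter _ _ (wedge _ _)).
apply: xget_unique => [|c' [hc' Ec']]; first by split.
apply/eqP; rewrite -subr_eq0; apply/eqP.
apply: (iter_Lef_inj hw (m := p.+1)) (homB (@hom_lin _ _) hc' hc) _.
  by lia.
by rewrite iter_linearB -Ec -Ec' subrr.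
Qed.

Lemma filteredP (k : nat) a : filtered w p k a <-> filt (@hom R (2 * n)) Pi k%:Z a.
Proof.
split=> [[b /homogeneousP hb <-]|[ha <-]].
  split; first exact: projection_hom.
  have [c hc Ec] := projection_split hw p hb.
  rewrite /Pi [in RHS]Ec projectionD // (projection_iter_Lef hw p hc) addr0.
  by [].
by exists a => //; apply/homogeneousP.
Qed.

Lemma symbol_lefschetz_complex :
  lefschetz_complex n p (@hom R (2 * n)) (Lef w) Xi Pi Refl mid_symbol.
Proof.
split.
- exact: hom0.
- exact: hom_lin.
- by move=> k a; apply: hom_Lef hw.1.
- by move=> k a ha; rewrite addrC; apply: hom_wedge ha; apply: hom_covector.
- by move=> k a b _ _; rewrite /Xi linearB.
- exact: iter_Lef_inj.
- exact: iter_Lef_surj.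
- by move=> k a _; apply: covector_two_comm hw.1.
- by move=> k a _; apply: covector_sqA.
- by move=> k a; apply: projection_hom.
- by move=> k a b _ _; apply: projectionB.
- by move=> k a; apply: projection_split.
- by move=> k a; apply: projection_iter_Lef.
- by move=> k a; apply: reflection_hom.
- exact: reflection0.
- by move=> k a; apply: reflectionK.
- by move=> k a; apply: reflection_projection.
- by move=> b; apply: reflection_prim.
- by move=> a c _; apply: mid_symbolE.
Qed.

Lemma symbol_exact (xi0 : xi != 0) (V := fun j => filtered w p (cplx_degree n p j)) :
  exact_sequence V symbol_map (cplx_last n p).
Proof.
have S := symbol_lefschetz_complex.
have acyc k a : hom k a -> Xi a = 0 -> exists2 b, hom (k - 1) b & a = Xi b.
  exact: covector_acyclic.
(* In dimension 0 there is no nonzero covector. With n > 0 the first map is of type d_plus and the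
   last of type d_minus, as the end lemmas require. *)
have n0 : (0 < n)%N.
  rewrite lt0n; apply: contra_neq xi0 => n0.
  by apply/rowP => -[i im]; exfalso; move: im; rewrite n0 muln0.
have np0 : (0 < n + p)%N by rewrite addn_gt0 n0.
split=> [a /filteredP fa Ea|j hj|].
- apply: (filt_exact0 hpn S acyc np0 _ _ Ea); last exact: fa.
  by move=> b; apply: hom_out2.
- apply/seteqP; split=> [b [a /filteredP fa <-]|b [/filteredP fb Eb]].
    split; first by apply/filteredP; apply: (filt_map_filt hpn S) fa; lia.
    exact: (filt_map_comp hpn S hj fa).
  have [a fa Ea] := filt_map_exact hpn S acyc hj fb Eb.
  by exists a => //; apply/filteredP.
- have Vl : V (cplx_last n p) = filtered w p 0.
    by rewrite /V /cplx_degree /cplx_last ifF ?subnn //; lia.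
  have Vl1 : V (cplx_last n p).-1 = filtered w p 1.
    by rewrite /V /cplx_degree /cplx_last ifF ?subSnn //; lia.
  rewrite Vl Vl1; apply/seteqP; split=> [b [a /filteredP fa <-]|b /filteredP fb].
    have := filt_map_filt (j := (cplx_last n p).-1) hpn S.
    rewrite /cplx_degree /cplx_last /= ltnSn ifF; last by lia.
    rewrite subSnn ifF ?subnn; last by lia.
    by move=> /(_ a isT fa) h; apply/filteredP.
  have [|a fa Ea] := filt_map_surj hpn S acyc np0 _ fb.
    by move=> c; apply: hom_out2; lia.
  by exists a => //; apply/filteredP.
Qed.

End SymbolComplex.

(** * The filtered complex on an open set *)

Section FieldComplex.
Variables (R : realType) (n p : nat) (hpn : (p <= n)%N).
Local Notation E := 'rV[R]_(2 * n).
Local Notation ext := (ext R (2 * n)).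
Variables (U : set E) (oU : open U) (w : E -> ext).
Hypothesis w_symp : forall y, U y -> symplectic_form (w y).
Hypothesis w_smooth : smooth_ext U w.
Hypothesis w_closed : forall y, U y -> ext_d w y = 0.
Implicit Types (A B C : E -> ext) (k : int) (y : E).

Local Notation homU := (hom_field U).
Local Notation LefU := (Lef_field w).
Local Notation restrU := (restr U).

Definition d_field A : E -> ext := restrU (ext_d A).
Definition projection_field A : E -> ext := restrU (fun y => projection (w y) p (A y)).
Definition reflection_field A : E -> ext := restrU (fun y => reflection (w y) (A y)).
Definition mid_field A : E -> ext := restrU (del_plus w (del_minus w A)).

Lemma restr_ext A B : (forall y, U y -> A y = B y) -> restrU A = restrU B.
Proof.
by move=> AB; apply/funext => y; rewrite /restr; case: pselect => //= /AB.
Qed.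

Lemma hom_field_d k A : homU k A -> homU (k + 1) (d_field A).
Proof.
move=> [_ sA hA]; apply: (hom_restr oU); first exact: smooth_ext_d.
by move=> y Uy; apply: (ext_d_hom oU).
Qed.

Lemma hom_field_projection k A : homU k A -> homU k (projection_field A).
Proof.
move=> [_ sA hA]; apply: (hom_restr oU).
  exact: (smooth_projection oU w_symp w_smooth p sA hA).
by move=> y Uy; apply: (projection_hom (w_symp Uy)); apply: hA.
Qed.

Lemma hom_field_reflection k A : homU k A ->
  homU (n%:Z *+ 2 - k) (reflection_field A).
Proof.
move=> [_ sA hA]; apply: (hom_restr oU).
  exact: (smooth_reflection oU w_symp w_smooth sA hA).
by move=> y Uy; apply: (reflection_hom (w_symp Uy)); apply: hA.
Qed.

Lemma hom_field_at k A y : homU k A -> U y -> hom k (A y).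
Proof. by case=> _ _; apply. Qed.

Lemma hom_field_smooth k A : homU k A -> smooth_ext U A.
Proof. by case. Qed.

Lemma hom_field_outE k A y : homU k A -> ~ U y -> A y = 0.
Proof. by case=> + _ _; apply. Qed.

Lemma d_fieldB k A B : homU k A -> homU k B ->
  d_field (A - B) = d_field A - d_field B.
Proof.
move=> [_ sA _] [_ sB _].
have sB1 : smooth_ext U (fun z => -1 *: B z).
  by apply: (smooth_extZ oU) => //; apply: (smooth_cst oU).
have -> : A - B = (fun z => A z + -1 *: B z).
  by apply/funext => z; rewrite scaleN1r.
apply/funext => y; rewrite -[RHS]/(d_field A y - d_field B y) /d_field.
have [Uy|Uy] := pselect (U y); last by rewrite !restr_out // subr0.
rewrite !restrE // (ext_dD oU sA sB1 Uy) (ext_dZ oU (smooth_cst oU (-1)) sB Uy).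
rewrite covector_grad big1 => [|i _]; last by rewrite partial_cst scale0r.
by rewrite wedge0l add0r scaleN1r.
Qed.

Lemma d_field_Lef k A : homU k A ->
  d_field (LefU A) = LefU (d_field A).
Proof.
move=> [A0 sA hA]; apply/funext => y; rewrite /d_field {2}/Lef_field.
have [Uy|Uy] := pselect (U y); last by rewrite !restr_out // linear0.
rewrite !restrE // /Lef -(ext_d_wedge_two oU _ w_smooth w_closed sA Uy) //.
by move=> z /w_symp[].
Qed.

Lemma d_field_sq k A : homU k A -> d_field (d_field A) = 0.
Proof.
move=> [_ sA _]; apply/funext => y; rewrite /d_field.
have [Uy|Uy] := pselect (U y); last by rewrite restr_out.
rewrite restrE // (ext_d_eq (B := ext_d A) oU _ Uy) => [|z Uz]; last by rewrite restrE.
exact: (ext_d_sq oU sA Uy).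
Qed.

(* For k <= n + p, [A - Pi A = L^(p+1) C] is solved smoothly by raising it to
   the degree n + (n + p + 1 - k) + (p + 1), where L is onto for smooth forms;
   pointwise injectivity of the larger power of L recovers the equation. *)
Lemma projection_field_split k A : homU k A ->
  exists2 C, homU (k - p.+1%:Z *+ 2) C &
    A = projection_field A + iter p.+1 LefU C.
Proof.
move=> hA; have [k_le|k_gt] := lerP k (n%:Z + p%:Z); last first.
  have [|C hC EC] := Lef_field_surj oU w_symp w_smooth (m := p.+1) _ hA; first by lia.
  exists C => //; rewrite {1}EC -[LHS]add0r; congr (_ + _).
  apply/funext => y; rewrite /projection_field.
  have [Uy|Uy] := pselect (U y); last by rewrite restr_out.
  rewrite restrE // EC iter_Lef_field.
  by rewrite (projection_iter_Lef (w_symp Uy) p (hom_field_at hC Uy)).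
have hD : homU k (A - projection_field A).
  exact: (homB (@hom_field_lin _ _ _ oU) hA (hom_field_projection hA)).
have [|C hC EC] := Lef_field_surj oU w_symp w_smooth
    (m := absz (n%:Z + p.+1%:Z - k + p.+1%:Z)%R)
    (k := k + (absz (n%:Z + p.+1%:Z - k)%R)%:Z *+ 2)
    _ (hom_iter_L (@hom_field_L _ _ _ oU _ w_symp w_smooth)
        (absz (n%:Z + p.+1%:Z - k)%R) hD).
  by lia.
have hC' : homU (k - p.+1%:Z *+ 2) C by move: hC; congr homU; lia.
exists C => //; apply/funext => y; rewrite !fctE iter_Lef_field.
have [Uy|Uy] := pselect (U y); last first.
  by rewrite (hom_field_outE hA) // (hom_field_outE (hom_field_projection hA)) //
    (hom_field_outE hC') // iter_linear0 addr0.
have [c hc Ec] := projection_split (w_symp Uy) p (hom_field_at hA Uy).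
rewrite {1}Ec /projection_field restrE //; congr (_ + iter _ _ _).
apply/eqP; rewrite -subr_eq0; apply/eqP.
apply: (iter_Lef_inj (w_symp Uy) (m := absz (n%:Z + p.+1%:Z - k + p.+1%:Z)%R)
  (k := k - p.+1%:Z *+ 2)); first by lia.
  exact: (homB (@hom_lin _ _) hc (hom_field_at hC' Uy)).
have := congr1 (fun X : E -> ext => X y) EC.
rewrite !iter_Lef_field !fctE /projection_field restrE // {1}Ec addrC addKr -iterD.
rewrite iter_linearB => <-.
rewrite (_ : (_ + p.+1)%N = absz (n%:Z + p.+1%:Z - k + p.+1%:Z)%R) ?subrr //.
by lia.
Qed.

Lemma split_d_eq r s A B y : (forall z, U z -> A z = B z) -> U y ->
  split_d w r s A y = split_d w r s B y.
Proof.
move=> AB Uy; rewrite /split_d; congr primitive_split.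
by apply: (ext_d_eq oU _ Uy) => z /AB ->.
Qed.

(** Only the slot (r, s) of the decomposition is nonzero on U, and the zero field in every other
    slot splits as (0, 0), so the double sums collapse. *)
Lemma del_single (r s : 'I_n.+1) A B y b1 b2 : (r + s <= n)%N ->
  (forall z, U z -> primitive (w z) s (B z)) ->
  (forall z, U z -> A z = iter r (Lef (w z)) (B z)) -> U y ->
  ext_d B y = b1 + Lef (w y) b2 ->
  hom (s%:Z + 1) b1 -> iter (n - s) (Lef (w y)) b1 = 0 ->
  hom (s%:Z - 1) b2 -> iter (n.+2 - s) (Lef (w y)) b2 = 0 ->
  del_plus w A y = iter r (Lef (w y)) b1 /\ del_minus w A y = iter r (Lef (w y)) b2.
Proof.
move=> rs PB EA Uy EB h1 L1 h2 L2.
have wy := w_symp Uy.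
have splitE (r' s' : 'I_n.+1) : split_d w r' s' A y =
    if (r', s') == (r, s) then (b1, b2) else (0, 0).
  have lef z : U z -> lefschetz (w z) (A z) (r', s') =
      if (r', s') == (r, s) then B z else 0.
    move=> Uz; rewrite (EA z Uz) (lefschetz_single (w_symp Uz) rs (PB z Uz)).
    by rewrite ffunE.
  rewrite /split_d (ext_d_eq oU lef Uy); case: eqP => [[_ ->]|_].
    rewrite EB; apply: (primitive_splitE wy) => //.
    by rewrite -ltnS.
  have -> : ext_d (fun=> 0) y = 0 + Lef (w y) 0 :> ext.
    by rewrite linear0 addr0 ext_dE big1 // => i _; rewrite ext_partial_cst wedge0r.
  apply: (primitive_splitE wy); rewrite ?iter_linear0 //; try exact: hom0.
  by rewrite -ltnS.
split.
- rewrite /del_plus (bigD1 r) //= (bigD1 s) //= splitE eqxx /=.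
  rewrite big1 ?addr0 => [|s' /andP[_ s's]]; last first.
    by rewrite splitE xpair_eqE (negbTE s's) andbF iter_linear0.
  rewrite big1 ?addr0 // => r' r'r; rewrite big1 // => s' _.
  by rewrite splitE xpair_eqE (negbTE r'r) iter_linear0.
- rewrite /del_minus (bigD1 r) //= (bigD1 s) //= splitE eqxx /=.
  rewrite big1 ?addr0 => [|s' /andP[_ s's]]; last first.
    by rewrite splitE xpair_eqE (negbTE s's) andbF iter_linear0.
  rewrite big1 ?addr0 // => r' r'r; rewrite big1 // => s' _.
  by rewrite splitE xpair_eqE (negbTE r'r) iter_linear0.
Qed.

Lemma del_plus_eq A B y : (forall z, U z -> A z = B z) -> U y ->
  del_plus w A y = del_plus w B y.
Proof.
move=> AB Uy; apply: eq_bigr => r _; apply: eq_bigr => s _.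
by rewrite (split_d_eq _ _ AB Uy).
Qed.

Lemma del_minus_eq A B y : (forall z, U z -> A z = B z) -> U y ->
  del_minus w A y = del_minus w B y.
Proof.
move=> AB Uy; apply: eq_bigr => r _; apply: eq_bigr => s _.
by rewrite (split_d_eq _ _ AB Uy).
Qed.

Lemma reflection_fieldK k A : homU k A -> reflection_field (reflection_field A) = A.
Proof.
move=> hA; apply/funext => y; rewrite /reflection_field.
have [Uy|Uy] := pselect (U y); last by rewrite restr_out // (hom_field_outE hA).
by rewrite !restrE // (reflectionK (w_symp Uy) (hom_field_at hA Uy)).
Qed.

Lemma reflection_projection_field k A : homU k A ->
  projection_field A = A <-> iter p.+1 LefU (reflection_field A) = 0.
Proof.
move=> hA; split=> [PA|RA]; apply/funext => y.
  have [Uy|Uy] := pselect (U y); last first.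
    by rewrite iter_Lef_field /reflection_field restr_out // iter_linear0.
  rewrite iter_Lef_field /reflection_field restrE //.
  apply/(reflection_projection (w_symp Uy) p (hom_field_at hA Uy)).
  by rewrite -[in RHS]PA /projection_field restrE.
rewrite /projection_field.
have [Uy|Uy] := pselect (U y); last by rewrite restr_out // (hom_field_outE hA).
rewrite restrE //; apply/(reflection_projection (w_symp Uy) p (hom_field_at hA Uy)).
have := congr1 (fun X : E -> ext => X y) RA.
by rewrite iter_Lef_field /reflection_field restrE.
Qed.

Lemma reflection_prim_field B : homU (n%:Z - p%:Z) B ->
  iter p.+1 LefU B = 0 -> reflection_field B = iter p LefU B.
Proof.
move=> hB LB; apply/funext => y; rewrite iter_Lef_field /reflection_field.
have [Uy|Uy] := pselect (U y); last first.
  by rewrite restr_out // (hom_field_outE hB) // iter_linear0.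
rewrite restrE //; apply: (reflection_prim (w_symp Uy) hpn (hom_field_at hB Uy)).
by have := congr1 (fun X : E -> ext => X y) LB; rewrite iter_Lef_field.
Qed.

Lemma d_field0 : d_field 0 = 0.
Proof.
by have := d_fieldB (hom_field0 oU 0) (hom_field0 oU 0); rewrite !subrr.
Qed.

Lemma d_iter_Lef_field m k A : homU k A ->
  d_field (iter m LefU A) = iter m LefU (d_field A).
Proof.
move=> hA; elim: m => //= m IH.
by rewrite (d_field_Lef (hom_iter_L (@hom_field_L _ _ _ oU _ w_symp w_smooth) m hA)) IH.
Qed.

(** The form A is L^p B with B primitive of degree n - p. Writing dB = b1 + L b2 with L^p b1 = 0
    gives dA = L^(p+1) b2, so C = b2 and del_minus A = L^p C. Moreover L^(p+1) dC = d dA = 0 makes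
    dC primitive, so dC has no L-part and del_plus (L^p C) = L^p dC. *)
Lemma mid_fieldE A C : homU (n%:Z + p%:Z) A -> projection_field A = A ->
  homU (n%:Z - p%:Z - 1) C -> d_field A = iter p.+1 LefU C ->
  mid_field A = iter p LefU (d_field C).
Proof.
move=> hA PA hC EC.
set B := reflection_field A.
have hB : homU (n%:Z - p%:Z) B.
  by move: (hom_field_reflection hA); congr homU; lia.
have LB : iter p.+1 LefU B = 0 by apply/(reflection_projection_field hA).
have AB : A = iter p LefU B.
  by rewrite -(reflection_prim_field hB LB) (reflection_fieldK hA).
have hdB := hom_field_d hB.
have LdB : iter p.+1 LefU (d_field B) = 0.
  by rewrite -(d_iter_Lef_field _ hB) LB d_field0.
have [||||b1 [b2 [h1 L1 h2 L2 Edb]]] := prim_split_exists (hom_field0 oU)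
  (@hom_field_lin _ _ _ oU) (@hom_field_L _ _ _ oU _ w_symp w_smooth)
  (@hom_field_coL _ _ _ oU _ w_symp w_smooth) (@hom_field_out _ _ _)
  (@comm_field _ _ _ _ w_symp) (s := n%:Z - p%:Z) (a := d_field B).
- by lia.
- by lia.
- exact: hdB.
- by rewrite -[RHS]LdB; congr (iter _ _ _); lia.
have pE : absz (n%:Z - (n%:Z - p%:Z))%R = p by lia.
have p2E : absz (n%:Z + 2 - (n%:Z - p%:Z))%R = p.+2 by lia.
rewrite pE in L1; rewrite p2E in L2.
have Cb2 : C = b2.
  apply/eqP; rewrite -subr_eq0; apply/eqP.
  apply: (Lef_field_inj oU w_symp w_smooth (m := p.+1) (k := n%:Z - p%:Z - 1)).
  - by lia.
  - exact: (homB (@hom_field_lin _ _ _ oU) hC h2).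
  - rewrite iter_linearB -EC AB (d_iter_Lef_field _ hB) Edb iter_linearD L1 add0r.
    by rewrite -iterSr subrr.
have at0 m (X : E -> ext) y : iter m LefU X = 0 -> iter m (Lef (w y)) (X y) = 0.
  by move=> /(congr1 (fun X : E -> ext => X y)); rewrite iter_Lef_field.
have dC : homU (n%:Z - p%:Z) (d_field C).
  by move: (hom_field_d hC); congr homU; lia.
have LdC : iter p.+1 LefU (d_field C) = 0.
  by rewrite -(d_iter_Lef_field _ hC) -EC (d_field_sq hA).
have p_lt : (p < n.+1)%N by lia.
have s_lt : (n - p < n.+1)%N by lia.
pose r := Ordinal p_lt; pose s := Ordinal s_lt.
have PB z : U z -> primitive (w z) s (B z).
  move=> Uz; apply/primitiveP; first by rewrite /=; lia.
  split; first by move: (hom_field_at hB Uz); congr hom; rewrite /=; lia.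
  by rewrite (_ : (n.+1 - s)%N = p.+1); [exact: at0|rewrite /=; lia].
have delA z : U z -> del_minus w A z = iter p (Lef (w z)) (C z).
  move=> Uz; rewrite Cb2.
  have [] // := @del_single r s A B z (b1 z) (b2 z) _ PB _ Uz.
  - by rewrite /=; lia.
  - by move=> y Uy; rewrite AB iter_Lef_field.
  - have := congr1 (fun X : E -> ext => X z) Edb.
    by rewrite /d_field restrE.
  - by move: (hom_field_at h1 Uz); congr hom; rewrite /=; lia.
  - by rewrite (_ : (n - s)%N = p); [exact: at0|rewrite /=; lia].
  - by move: (hom_field_at h2 Uz); congr hom; rewrite /=; lia.
  - by rewrite (_ : (n.+2 - s)%N = p.+2); [exact: at0|rewrite /=; lia].
apply/funext => y; rewrite iter_Lef_field /mid_field.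
have [Uy|Uy] := pselect (U y); last first.
  by rewrite restr_out // (hom_field_outE dC) // iter_linear0.
rewrite restrE // (del_plus_eq delA Uy).
(* For p = n the field C has degree -1 and vanishes; its primitive degree n - p - 1 is a natural
   number only for p < n. *)
have [pn|pn] := ltnP p n; last first.
  have C0 : C = 0 by apply: (hom_field_out (k := n%:Z - p%:Z - 1)) hC; lia.
  have P0 z : U z -> primitive (w z) s (0 : ext) by move=> _; apply: primitive0.
  rewrite C0 d_field0.
  have [] // := @del_single r s (fun z => iter p (Lef (w z)) 0) (fun=> 0) y 0 0 _ P0 _ Uy.
  - by rewrite /=; lia.
  - by rewrite linear0 addr0 ext_dE big1 // => i _; rewrite ext_partial_cst wedge0r.
  - exact: hom0.
  - by rewrite iter_linear0.
  - exact: hom0.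
  - by rewrite iter_linear0.
have s'_lt : (n - p.+1 < n.+1)%N by lia.
pose s' := Ordinal s'_lt.
have LC : iter p.+2 LefU C = 0.
  rewrite iterS -EC AB (d_iter_Lef_field _ hB).
  by rewrite -iterS.
have PC z : U z -> primitive (w z) s' (C z).
  move=> Uz; apply/primitiveP; first by rewrite /=; lia.
  split; first by move: (hom_field_at hC Uz); congr hom; rewrite /=; lia.
  by rewrite (_ : (n.+1 - s')%N = p.+2); [exact: at0|rewrite /=; lia].
have [] // := @del_single r s' (fun z => iter p (Lef (w z)) (C z)) C y
  (d_field C y) 0 _ PC _ Uy.
- by rewrite /=; lia.
- by rewrite linear0 addr0 /d_field restrE.
- by move: (hom_field_at dC Uy); congr hom; rewrite /=; lia.
- by rewrite (_ : (n - s')%N = p.+1); [exact: at0|rewrite /=; lia].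
- exact: hom0.
- by rewrite iter_linear0.
Qed.

Lemma projection_fieldB k A B : homU k A -> homU k B ->
  projection_field (A - B) = projection_field A - projection_field B.
Proof.
move=> _ _; apply/funext => y.
rewrite -[RHS]/(projection_field A y - projection_field B y) /projection_field.
have [Uy|Uy] := pselect (U y); last by rewrite !restr_out // subr0.
by rewrite !restrE // -(projectionB (w_symp Uy)).
Qed.

Lemma field_lefschetz_complex : lefschetz_complex n p homU LefU
  d_field projection_field reflection_field mid_field.
Proof.
split.
- exact: hom_field0.
- exact: hom_field_lin.
- exact: hom_field_L.
- exact: hom_field_d.
- exact: d_fieldB.
- exact: Lef_field_inj.
- exact: Lef_field_surj.
- exact: d_field_Lef.
- exact: d_field_sq.
- exact: hom_field_projection.
- exact: projection_fieldB.
- exact: projection_field_split.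
- move=> k C hC; apply/funext => y; rewrite /projection_field.
  have [Uy|Uy] := pselect (U y); last by rewrite restr_out.
  rewrite restrE // iter_Lef_field.
  exact: (projection_iter_Lef (w_symp Uy) p (hom_field_at hC Uy)).
- exact: hom_field_reflection.
- apply/funext => y; rewrite /reflection_field.
  have [Uy|Uy] := pselect (U y); last by rewrite restr_out.
  by rewrite restrE // (reflection0 (w_symp Uy)).
- exact: reflection_fieldK.
- exact: reflection_projection_field.
- exact: reflection_prim_field.
- by move=> A C [hA PA]; apply: mid_fieldE.
Qed.

Definition field_map := filt_map n p d_field projection_field reflection_field mid_field.

Lemma cplx_mapE j A y : U y -> cplx_map w p j A y = field_map j (restrU A) y.
Proof.
move=> Uy; have EA z : U z -> A z = restrU A z by move=> Uz; rewrite restrE.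
rewrite /cplx_map /field_map /filt_map; case: ifP => _; last case: ifP => _.
- rewrite /d_plus /projection_field (restrE _ Uy) /d_field (restrE _ Uy).
  by rewrite (ext_d_eq oU EA Uy).
- rewrite /mid_field (restrE _ Uy); apply: (del_plus_eq _ Uy) => z Uz.
  exact: del_minus_eq.
- rewrite /d_minus /reflection_field (restrE _ Uy) /d_field (restrE _ Uy).
  congr reflection; apply: (ext_d_eq oU _ Uy) => z Uz.
  by rewrite (restrE _ Uz) EA.
Qed.

End FieldComplex.

(** * Symbols and manifolds *)

Section Symbols.
Variables (R : realType) (n p : nat) (hpn : (p <= n)%N).
Local Notation E := 'rV[R]_(2 * n).
Local Notation ext := (ext R (2 * n)).
Variables (U : set E) (oU : open U) (w : E -> ext).
Hypothesis w_symp : forall y, U y -> symplectic_form (w y).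
Hypothesis w_smooth : smooth_ext U w.
Hypothesis w_closed : forall y, U y -> ext_d w y = 0.
Implicit Types (A B C : E -> ext) (f : E -> R) (k : int) (y : E).

Lemma filt_restr (k : nat) A : smooth_ext U A ->
  (forall z, U z -> filtered (w z) p k (A z)) ->
  filt (hom_field U) (projection_field p U w) k%:Z (restr U A).
Proof.
move=> sA FA; split.
  apply: (hom_restr oU) => // z Uz.
  by have [] := (filteredP p (w_symp Uz) k (A z)).1 (FA z Uz).
apply/funext => z; rewrite /projection_field.
have [Uz|Uz] := pselect (U z); last by rewrite !restr_out.
rewrite (restrE _ Uz) (restrE _ Uz).
by have [] := (filteredP p (w_symp Uz) k (A z)).1 (FA z Uz).
Qed.

Lemma ext_d_sqrZ f A y : smooth U f -> smooth_ext U A -> U y ->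
  ext_d (fun z => f z ^+ 2 *: A z) y =
  (2 * f y) *: wedge (covector (grad f y)) (A y) + f y ^+ 2 *: ext_d A y.
Proof.
move=> sf sA Uy; have sff : smooth U (fun z => f z * f z) by apply: (smoothM oU).
rewrite (ext_d_eq (B := fun z => (f z * f z) *: A z) oU _ Uy) => [|z _]; last first.
  by rewrite expr2.
rewrite (ext_dZ oU sff sA Uy) expr2; congr (_ + _).
rewrite !covector_grad !wedge_suml scaler_sumr; apply: eq_bigr => i _.
by rewrite (partialM i sf sf Uy) !wedgeZl scalerA; congr (_ *: _); ring.
Qed.

Lemma symbol_d_plus (k : nat) y xi : U y ->
  principal_symbol 1 (d_plus w p) U (fun z => filtered (w z) p k) y xi
    (fun a => projection (w y) p (wedge (covector xi) a)).
Proof.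
move=> Uy f A sf fy <- sA FA; rewrite invr1 scale1r /d_plus.
rewrite (ext_d_eq (B := fun z => f z *: A z) oU _ Uy) => [|z _]; last by rewrite expr1.
by rewrite (ext_dZ oU sf sA Uy) fy scale0r addr0.
Qed.

Lemma symbol_d_minus (k : nat) y xi : U y ->
  principal_symbol 1 (d_minus w) U (fun z => filtered (w z) p k) y xi
    (fun a => reflection (w y) (wedge (covector xi) (reflection (w y) a))).
Proof.
move=> Uy f A sf fy <- sA FA; rewrite invr1 scale1r /d_minus.
have hA z : U z -> hom k%:Z (A z).
  by move=> Uz; have [] := (filteredP p (w_symp Uz) k (A z)).1 (FA z Uz).
have sR := smooth_reflection oU w_symp w_smooth sA hA.
rewrite (ext_d_eq (B := fun z => f z *: reflection (w z) (A z)) oU _ Uy).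
  by rewrite (ext_dZ oU sf sR Uy) fy scale0r addr0.
by move=> z Uz; rewrite expr1 (reflectionZ (w_symp Uz)).
Qed.

(* If [dA = L^(p+1) C] and [df /\ A = L^(p+1) C1], then
   [d(f^2 A) = L^(p+1) (2 f C1 + f^2 C)], and d of the bracket is [2 df /\ C1]
   where f vanishes. *)
Lemma symbol_mid y xi : U y ->
  principal_symbol 2 (del_plus w \o del_minus w) U
    (fun z => filtered (w z) p (n + p)) y xi (mid_symbol p (w y) xi).
Proof.
move=> Uy f A sf fy fxi sA FA.
have S := field_lefschetz_complex hpn oU w_symp w_smooth w_closed.
have hL m k B (hB : hom_field U k B) :=
  hom_iter_L (@hom_field_L _ _ _ oU _ w_symp w_smooth) m hB.
have := filt_restr sA FA; rewrite PoszD => fA'.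
have [hA' PA'] := fA'.
have [C hC EC] := mid_witness hpn S hA'.
have EdA z : U z -> ext_d A z = iter p.+1 (Lef (w z)) (C z).
  move=> Uz; have := congr1 (fun X : E -> ext => X z) EC.
  rewrite iter_Lef_field /d_field (restrE _ Uz) => <-.
  by apply: (ext_d_eq oU _ Uz) => t Ut; rewrite (restrE _ Ut).
have sgrad := smooth_covector_grad oU sf.
have hA z : U z -> hom (n%:Z + p%:Z) (A z).
  by move=> Uz; have := hom_field_at hA' Uz; rewrite (restrE _ Uz).
have hX : hom_field U (n%:Z + p.+1%:Z)
    (restr U (fun z => wedge (covector (grad f z)) (A z))).
  apply: (hom_restr oU); first exact: (smooth_wedge oU).
  move=> z Uz; rewrite (_ : n%:Z + _ = 1 + (n%:Z + p%:Z)); last by lia.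
  by apply: hom_wedge (hA z Uz); apply: hom_covector.
(* A smooth solution on all of U is needed, not just its value at y, because d is applied to it
   below. *)
have [|C1 hC1 EC1] := Lef_field_surj oU w_symp w_smooth (m := p.+1) _ hX; first by lia.
have {}hC1 : hom_field U (n%:Z - p%:Z - 1) C1 by move: hC1; congr hom_field; lia.
have EX z : U z -> wedge (covector (grad f z)) (A z) = iter p.+1 (Lef (w z)) (C1 z).
  move=> Uz; have := congr1 (fun X : E -> ext => X z) EC1.
  by rewrite iter_Lef_field (restrE _ Uz).
pose fA z := f z ^+ 2 *: A z.
have sff : smooth U (fun z => f z ^+ 2).
  by apply: (smooth_ext_fun oU) (smoothM oU sf sf) => z _; rewrite expr2.
have sfA : smooth_ext U fA by apply: (smooth_extZ oU).
have FfA z : U z -> filtered (w z) p (n + p) (fA z).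
  move=> Uz; have [hz Pz] := (filteredP p (w_symp Uz) _ (A z)).1 (FA z Uz).
  apply/(filteredP p (w_symp Uz)); split.
    by apply: homZ hz; [exact: hom0|exact: hom_lin].
  by rewrite (projectionZ (w_symp Uz)) Pz.
have := filt_restr sfA FfA; rewrite PoszD => ffA.
have sC := hom_field_smooth hC; have sC1 := hom_field_smooth hC1.
pose C2a z := (2 * f z) *: C1 z; pose C2b z := f z ^+ 2 *: C z.
have s2f : smooth U (fun z => 2 * f z) by apply: (smoothM oU) => //; apply: (smooth_cst oU).
have sC2a : smooth_ext U C2a by apply: (smooth_extZ oU).
have sC2b : smooth_ext U C2b by apply: (smooth_extZ oU).
have hC2 : hom_field U (n%:Z - p%:Z - 1) (restr U (fun z => C2a z + C2b z)).
  apply: (hom_restr oU); first exact: (smooth_extD oU).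
  move=> z Uz; apply: hom_lin; first exact: (hom_field_at hC1 Uz).
  by apply: homZ (hom_field_at hC Uz); [exact: hom0|exact: hom_lin].
have EC2 : d_field U (restr U fA) = iter p.+1 (Lef_field w) (restr U (fun z => C2a z + C2b z)).
  apply/funext => z; rewrite iter_Lef_field /d_field.
  have [Uz|Uz] := pselect (U z); last by rewrite !(restr_out _ Uz) iter_linear0.
  rewrite !(restrE _ Uz) (ext_d_eq (B := fA) oU _ Uz) => [|t Ut]; last by rewrite (restrE _ Ut).
  rewrite (ext_d_sqrZ sf sA Uz) (EX z Uz) (EdA z Uz).
  by rewrite iter_linearD !iter_linearZ.
have := mid_fieldE hpn oU w_symp w_smooth w_closed ffA.1 ffA.2 hC2 EC2.
move/(congr1 (fun X : E -> ext => X y)).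
rewrite iter_Lef_field /mid_field (restrE _ Uy) /d_field (restrE _ Uy).
have Edel : del_plus w (del_minus w (restr U fA)) y = (del_plus w \o del_minus w) fA y.
  apply: (del_plus_eq oU w _ Uy) => z Uz.
  by apply: (del_minus_eq oU w _ Uz) => t Ut; rewrite (restrE _ Ut).
rewrite Edel => ->.
rewrite (ext_d_eq (B := fun z => C2a z + C2b z) oU _ Uy) => [|z Uz]; last by rewrite (restrE _ Uz).
rewrite (ext_dD oU sC2a sC2b Uy) (ext_dZ oU s2f sC1 Uy) (ext_d_sqrZ sf sC Uy).
rewrite fy mulr0 expr0n !scale0r !addr0.
have -> : covector (grad (fun z => 2 * f z) y) = 2 *: covector (grad f y) :> ext.
  rewrite !covector_grad scaler_sumr; apply: eq_bigr => i _.
  rewrite (partialM i (smooth_cst oU 2) sf Uy) partial_cst mulr0 addr0.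
  by rewrite scalerA.
(* The 2 from the differential of f^2 cancels the 1/2! in the definition of a second-order
   symbol. *)
rewrite wedgeZl iter_linearZ scalerA mulVf ?scale1r; last by rewrite pnatr_eq0.
rewrite fxi; apply: (mid_symbolE hpn (w_symp Uy)); first exact: (hom_field_at hC1 Uy).
by rewrite -fxi; apply: EX.
Qed.

Lemma symbol_cplx j y xi : U y ->
  principal_symbol (cplx_order n p j) (cplx_map w p j) U
    (fun z => filtered (w z) p (cplx_degree n p j)) y xi (symbol_map p (w y) xi j).
Proof.
move=> Uy; rewrite /cplx_order /cplx_map /symbol_map /filt_map.
have [jn|jn|->] := ltngtP j (n + p)%N.
- exact: symbol_d_plus.
- exact: symbol_d_minus.
- by rewrite /cplx_degree leqnn; apply: symbol_mid.
Qed.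

End Symbols.

(** * Changes of charts and the complex on the manifold *)

Section ManifoldForms.
Variables (R : realType) (n p : nat) (hpn : (p <= n)%N).
Variables (M : manifold R (2 * n)) (w : form_field M) (hw : symplectic w).
Local Notation E := 'rV[R]_(2 * n).
Local Notation ext := (ext R (2 * n)).
Implicit Types (A B : form_field M) (c : chart M) (y : E) (k : nat).

Lemma chart_img_open c : open (img c).
Proof. exact: img_open. Qed.

Lemma chart_symplectic c y : img c y -> symplectic_form (w c y).
Proof.
move=> Uy; have [[hom_w _ _] _ nd] := hw; split.
  by apply/homogeneousP; apply: hom_w.
by apply: form_mx_unit; apply: nd.
Qed.

Lemma chart_smooth c : smooth_ext (img c) (w c).
Proof. by have [[_ + _] _ _] := hw; apply. Qed.

Lemma chart_closed c y : img c y -> ext_d (w c) y = 0.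
Proof. by have [_ + _] := hw; apply. Qed.

Definition overlap c c' : set E := Defs.coord c @` (dom c `&` dom c').

Lemma overlap_img c c' y : overlap c c' y -> img c y.
Proof. by move=> [x [cx _] <-]; exists x. Qed.

Lemma transition_img c c' y : overlap c c' y -> img c' (transition c c' y).
Proof. by move=> [x [cx c'x] <-]; exists x => //; rewrite /transition coordK. Qed.

Lemma overlap_open c c' : open (overlap c c').
Proof.
rewrite openE => y [x [cx c'x] <-]; rewrite /interior.
have cy : img c (Defs.coord c x) by exists x.
have pc : nbhs (Defs.coord c x) (param c @^-1` dom c').
  apply: (param_continuous cy); rewrite coordK //.
  by apply: open_nbhs_nbhs; split => //; apply: dom_open.
have oc : nbhs (Defs.coord c x) (img c).
  by apply: open_nbhs_nbhs; split => //; apply: chart_img_open.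
apply: filterS (filterI pc oc) => z [/= c'z [t ct tz]].
by exists t => //; split=> //; move: c'z; rewrite -tz coordK.
Qed.

Definition natural_field A := forall c c' y, overlap c c' y ->
  A c y = pullback (transition c c') y (A c' (transition c c' y)).

Section Transition.
Variables (c c' : chart M).
Local Notation tau := (transition c c').
Local Notation P y := (pull (fun i => grad (fun z => tau z 0 i) y)).

Lemma pull_Lef y a : overlap c c' y ->
  P y (Lef (w c' (tau y)) a) = Lef (w c y) (P y a).
Proof.
move=> Wy; have [[_ _ nat_w] _ _] := hw.
by rewrite /Lef pull_wedge (nat_w c c' y Wy).
Qed.

Lemma projection_pull y a : overlap c c' y ->
  projection (w c y) p (P y a) = P y (projection (w c' (tau y)) p a).
Proof.
move=> Wy; have sy := chart_symplectic (overlap_img Wy).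
have sty := chart_symplectic (transition_img Wy).
exact: (projection_natural sy sty (@pull_hom _ _ _) (fun a => pull_Lef a Wy)).
Qed.

Lemma reflection_pull y a : overlap c c' y ->
  reflection (w c y) (P y a) = P y (reflection (w c' (tau y)) a).
Proof.
move=> Wy; have sy := chart_symplectic (overlap_img Wy).
have sty := chart_symplectic (transition_img Wy).
exact: (reflection_natural sy sty (@pull_hom _ _ _) (fun a => pull_Lef a Wy)).
Qed.

Lemma iter_Lef_pull m y a : overlap c c' y ->
  P y (iter m (Lef (w c' (tau y))) a) = iter m (Lef (w c y)) (P y a).
Proof. by move=> Wy; apply: iter_Lef_natural => b; apply: pull_Lef. Qed.

Lemma ext_d_pull (A A' : E -> ext) y : smooth_ext (img c') A' ->
  (forall z, overlap c c' z -> A z = P z (A' (tau z))) -> overlap c c' y ->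
  ext_d A y = P y (ext_d A' (tau y)).
Proof.
move=> sA' EA Wy.
apply: (ext_d_pullback (@overlap_open c c') _ _ sA' EA Wy).
  by move=> i; apply: transition_smooth.
by move=> z; apply: transition_img.
Qed.

End Transition.

Local Notation filt_chart c k A :=
  (filt (hom_field (img c)) (projection_field p (img c) (w c)) k (restr (img c) A)).

Lemma chart_complex c : lefschetz_complex n p (hom_field (img c)) (Lef_field (w c))
  (d_field (img c)) (projection_field p (img c) (w c)) (reflection_field (img c) (w c))
  (mid_field (img c) (w c)).
Proof.
exact: (field_lefschetz_complex hpn (@chart_img_open c) (@chart_symplectic c)
  (@chart_smooth c) (@chart_closed c)).
Qed.

Lemma hom_field_restr_smooth c (k : int) (A : E -> ext) :
  hom_field (img c) k (restr (img c) A) -> smooth_ext (img c) A.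
Proof.
move=> [_ sA _]; apply: (smooth_ext_eq (@chart_img_open c)) sA => z Uz.
by rewrite restrE.
Qed.

Lemma hom_field_restr_hom c (k : int) (A : E -> ext) y :
  hom_field (img c) k (restr (img c) A) -> img c y -> hom k (A y).
Proof. by move=> [_ _ hA] Uy; have := hA y Uy; rewrite restrE. Qed.

(** Separates a global filtered form into a filtered field in each chart, to which [chart_complex]
    applies, and compatibility under transitions. Since Pi fixes A in each chart, A serves as its
    own unprojected form. *)
Lemma F_OmegaP k A : F_Omega w p k A <->
  (forall c, filt_chart c k%:Z (A c)) /\ natural_field A.
Proof.
split=> [[A' [hA' sA' nA'] EA]|[fA nA]].
  split=> [c|c c' y Wy].
    have hR : hom_field (img c) k%:Z (restr (img c) (A' c)).
      apply: (hom_restr (@chart_img_open c)) => // z Uz.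
      by apply/homogeneousP; apply: hA'.
    have -> : restr (img c) (A c) =
        projection_field p (img c) (w c) (restr (img c) (A' c)).
      apply: restr_ext => y Uy; rewrite (restrE _ Uy); exact: EA.
    exact: (filt_Pi (chart_complex c) hR).
  rewrite (EA c y (overlap_img Wy)) (nA' c c' y Wy) (EA c' _ (transition_img Wy)).
  exact: projection_pull.
exists A.
  split=> // c.
    by move=> y Uy; apply/homogeneousP; apply: hom_field_restr_hom (fA c).1 Uy.
  exact: hom_field_restr_smooth (fA c).1.
move=> c y Uy; have := congr1 (fun X : E -> ext => X y) (fA c).2.
by rewrite /projection_field !(restrE _ Uy).
Qed.

Lemma restr_cplx_map c j (A : E -> ext) : (j < cplx_last n p)%N ->
  filt_chart c (cplx_degree n p j)%:Z A ->
  restr (img c) (cplx_map (w c) p j A) = field_map p (img c) (w c) j (restr (img c) A).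
Proof.
move=> hj fA; have [hF _] := filt_map_filt hpn (chart_complex c) hj fA.
apply/funext => y; have [Uy|Uy] := pselect (img c y).
  by rewrite (restrE _ Uy) (cplx_mapE p (@chart_img_open c) _ _ _ Uy).
by rewrite (restr_out _ Uy) /field_map (hom_field_outE hF Uy).
Qed.

(** The operators are not transported one by one: in each chart the value is L^p dC with dA =
    L^(p+1) C. Injectivity of L^(p+1) makes C compatible with the pullback, and dC follows. *)
Lemma del_natural c c' (A A' : E -> ext) y :
  filt_chart c (n%:Z + p%:Z) A -> filt_chart c' (n%:Z + p%:Z) A' ->
  (forall z, overlap c c' z ->
     A z = pullback (transition c c') z (A' (transition c c' z))) ->
  overlap c c' y ->
  del_plus (w c) (del_minus (w c) A) y =
  pullback (transition c c') y
    (del_plus (w c') (del_minus (w c') A') (transition c c' y)).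
Proof.
move=> fA fA' EA Wy.
have [C hC EC] := mid_witness hpn (chart_complex c) fA.1.
have [C' hC' EC'] := mid_witness hpn (chart_complex c') fA'.1.
have d_at (b : chart M) (X Y : E -> ext) z :
    d_field (img b) (restr (img b) X) = iter p.+1 (Lef_field (w b)) Y -> img b z ->
    ext_d X z = iter p.+1 (Lef (w b z)) (Y z).
  move=> /(congr1 (fun X : E -> ext => X z)) + Uz.
  rewrite iter_Lef_field /d_field (restrE _ Uz) => <-.
  by apply: (ext_d_eq (@chart_img_open b) _ Uz) => t Ut; rewrite (restrE _ Ut).
have del_at (b : chart M) (X Y : E -> ext) z : filt_chart b (n%:Z + p%:Z) X ->
    hom_field (img b) (n%:Z - p%:Z - 1) Y ->
    d_field (img b) (restr (img b) X) = iter p.+1 (Lef_field (w b)) Y -> img b z ->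
    del_plus (w b) (del_minus (w b) X) z = iter p (Lef (w b z)) (ext_d Y z).
  move=> fX hY EY Uz.
  have := mid_fieldE hpn (@chart_img_open b) (@chart_symplectic b) (@chart_smooth b)
    (@chart_closed b) fX.1 fX.2 hY EY.
  move/(congr1 (fun X : E -> ext => X z)).
  rewrite iter_Lef_field /mid_field /d_field !(restrE _ Uz) => <-.
  apply: (del_plus_eq (@chart_img_open b) _ _ Uz) => t Ut.
  by apply: (del_minus_eq (@chart_img_open b) _ _ Ut) => s Us; rewrite (restrE _ Us).
have sA' := hom_field_restr_smooth fA'.1.
have CP z : overlap c c' z ->
    C z = pullback (transition c c') z (C' (transition c c' z)).
  move=> Wz; have Uz := overlap_img Wz; have U'z := transition_img Wz.
  have sz := chart_symplectic Uz.
  apply/eqP; rewrite -subr_eq0; apply/eqP.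
  apply: (iter_Lef_inj sz (m := p.+1) (k := n%:Z - p%:Z - 1)); first by lia.
    apply: (homB (@hom_lin _ _)); first exact: (hom_field_at hC Uz).
    by apply: pull_hom; apply: (hom_field_at hC' U'z).
  rewrite iter_linearB -(d_at c A C z EC Uz) -(iter_Lef_pull _ _ Wz).
  by rewrite -(d_at c' A' C' _ EC' U'z) -(ext_d_pull sA' EA Wz) subrr.
rewrite (del_at c A C y fA hC EC (overlap_img Wy)).
rewrite (del_at c' A' C' _ fA' hC' EC' (transition_img Wy)).
rewrite (ext_d_pull (hom_field_smooth hC') CP Wy).
by rewrite /pullback -/(pull _ _) (iter_Lef_pull _ _ Wy).
Qed.

Lemma cplx_operator_natural j A : (j < cplx_last n p)%N ->
  (forall c, filt_chart c (cplx_degree n p j)%:Z (A c)) -> natural_field A ->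
  natural_field (cplx_operator w p j A).
Proof.
move=> hj fA nA c c' y Wy; rewrite /cplx_operator /cplx_map.
have sA b := hom_field_restr_smooth (fA b).1.
have [jn|jn|jn] := ltngtP j (n + p)%N.
- rewrite /d_plus (ext_d_pull (sA c') (nA c c') Wy).
  exact: projection_pull.
- rewrite /d_minus.
  have sR : smooth_ext (img c') (fun z => reflection (w c' z) (A c' z)).
    apply: (smooth_reflection (@chart_img_open c') (@chart_symplectic c')
      (@chart_smooth c') (sA c')) => z Uz.
    exact: hom_field_restr_hom (fA c').1 Uz.
  rewrite (ext_d_pull sR _ Wy) => [|z Wz]; first exact: reflection_pull.
  by rewrite (nA c c' z Wz); apply: reflection_pull.
- have fA' b : filt_chart b (n%:Z + p%:Z) (A b).
    by move: (fA b); rewrite /cplx_degree jn leqnn.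
  exact: (del_natural (fA' c) (fA' c') (nA c c') Wy).
Qed.

Lemma filtered_differential_complex : differential_complex w p.
Proof.
split=> [j A hj /F_OmegaP[fA nA]|j A hj /F_OmegaP[fA nA] c y Uy].
  apply/F_OmegaP; split=> [c|]; last exact: cplx_operator_natural.
  rewrite /cplx_operator restr_cplx_map //.
  exact: (filt_map_filt hpn (chart_complex c) hj (fA c)).
rewrite /cplx_operator (cplx_mapE p (@chart_img_open c) _ _ _ Uy).
rewrite restr_cplx_map ?(ltnW hj) //.
by rewrite /field_map (filt_map_comp hpn (chart_complex c) hj (fA c)).
Qed.

Lemma filtered_elliptic : elliptic w p.
Proof.
move=> c x xi cx xi0; have Uy : img c (Defs.coord c x) by exists x.
exists (symbol_map p (w c (Defs.coord c x)) xi); split=> [j _|].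
  exact: (symbol_cplx hpn (@chart_img_open c) (@chart_symplectic c)
    (@chart_smooth c) (@chart_closed c)).
exact: (symbol_exact hpn (chart_symplectic Uy) xi0).
Qed.

End ManifoldForms.

Theorem theorem3p1 (R : realType) (n : nat) (M : manifold R (2 * n))
    (w : form_field M) (hw : symplectic w) (p : nat) (hp : (p <= n)%N) :
  differential_complex w p /\ elliptic w p.
Proof.
split; [exact: filtered_differential_complex|exact: filtered_elliptic].
Qed.
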